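(* Let $p_m\in C^\infty[a,b]$ and $s_m\in C_0^\infty(a,b)$, $m\in\mathbb N$, be real-valued with $p_m>0$ on $[a,b]$, $\|1/p_m-1/p\|_1\to0$ and $\|s_m-s\|_1\to0$ as $m\to\infty$. Fix a self-adjoint boundary condition $AY(a)+BY(b)=0$; let $L=L(p,s)$ be the Sturm–Liouville operator generated by $\frac1r\left(-(y^{[1]})'+sy^{[1]}+qy\right)$, $y^{[1]}=p(y'+sy)$, on $(a,b)$ and this boundary condition, and let $L_m=L(p_m,s_m)$ be the operator obtained by replacing $p,s$ with $p_m,s_m$ (also in the quasi-derivative). Denote the $n$-th eigenvalues of $L_m$ and $L$ by $\lambda_n(m)$ and $\lambda_n(0)$, respectively, $n\in\mathbb N_0$. Then $\lambda_n(m)\to\lambda_n(0)$ as $m\to\infty$.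
   Context: Let $J=(a,b)$ with $-\infty<a<b<\infty$, and let $p,q,r,s$ be real-valued functions on $J$ with $1/p,q,r,s\in L^1(J,\mathbb R)$, $p>0$ and $r>0$ a.e. on $J$; $\|\cdot\|_1$ is the $L^1(J)$ norm. $Y=(y,y^{[1]})^T$. Self-adjoint boundary condition: $A,B$ are complex $2\times2$ matrices with $(A|B)$ of rank $2$ and $AEA^*=BEB^*$, $E=\begin{pmatrix}0&-1\\1&0\end{pmatrix}$. The operators act in $L^2_r(J)$ on the domain of all $y$ with $y,y^{[1]}$ absolutely continuous on $[a,b]$, satisfying the boundary condition, and with image in $L^2_r(J)$. The eigenvalues of each of these operators are real and, counted with multiplicity (algebraic and geometric multiplicities coincide), are ordered as a non-decreasing sequence indexed by $n\in\mathbb N_0=\{0,1,2,\ldots\}$ tending to $+\infty$. *)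

(* Defs.v *)
From HB Require Import structures.
From mathcomp Require Import all_boot all_order all_algebra.
From mathcomp Require Import complex.
From mathcomp Require Import all_classical all_reals all_analysis.

Set Implicit Arguments.
Unset Strict Implicit.
Unset Printing Implicit Defensive.

Import Order.TTheory GRing.Theory Num.Theory.
Import numFieldNormedType.Exports.

Local Open Scope classical_set_scope.
Local Open Scope ring_scope.
Local Open Scope complex_scope.

Section SturmLiouville.
Context {R : realType}.
Local Notation mu := (@lebesgue_measure R).
Local Notation normc := (@ComplexField.Normc.normc R).
Implicit Types (a b : R) (p q r s : R -> R) (y f : R -> R[i]).

(* Functions on J = (a, b) are represented by total functions on R; every
   notion below depends only on their values on J (or on [a, b]). *)

Definition ae_on a b (P : R -> Prop) : Prop :=
  {ae mu, forall x, `]a, b[%classic x -> P x}.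

Definition in_L1 a b (g : R -> R) : Prop :=
  mu.-integrable `]a, b[ (EFin \o g).

Definition L1norm a b (g : R -> R) : \bar R :=
  (\int[mu]_(x in `]a, b[) `|g x|%:E)%E.

(* L^2_r(J), complex-valued *)
Definition in_L2 a b r f : Prop :=
  [/\ measurable_fun `]a, b[ (fun x => complex.Re (f x)),
      measurable_fun `]a, b[ (fun x => complex.Im (f x)) &
      mu.-integrable `]a, b[ (fun x => (normc (f x) ^+ 2 * r x)%:E)].

Definition smooth_on_open a b (g : R -> R) : Prop :=
  forall n x, `]a, b[%classic x -> derivable (derive1n n g) x 1.

(* C^oo[a, b]: all derivatives exist in (a, b) and extend continuously to the
   end points. *)
Definition smooth_on_closed a b (g : R -> R) : Prop :=
  [/\ smooth_on_open a b g,
      {within `[a, b], continuous g},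
      forall n, cvg (derive1n n g x @[x --> a^'+]) &
      forall n, cvg (derive1n n g x @[x --> b^'-])].

(* C_0^oo(a, b) *)
Definition smooth_compact_support a b (g : R -> R) : Prop :=
  smooth_on_open a b g /\
  exists K : set R, [/\ compact K, K `<=` `]a, b[ &
    forall x, `]a, b[%classic x -> ~ K x -> g x = 0].

Definition abs_continuous_on a b f : Prop :=
  forall e : R, 0 < e -> exists2 d : R, 0 < d &
    forall (n : nat) (u v : 'I_n -> R),
      (forall i, [/\ a <= u i, u i <= v i & v i <= b]) ->
      trivIset setT (fun i => `]u i, v i[%classic) ->
      \sum_(i < n) (v i - u i) < d ->
      \sum_(i < n) normc (f (v i) - f (u i)) < e.

Definition cderivable f (x : R) : Prop :=
  derivable (fun t => complex.Re (f t)) x 1 /\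
  derivable (fun t => complex.Im (f t)) x 1.

Definition cderive f (x : R) : R[i] :=
  derive1 (fun t => complex.Re (f t)) x +i*
  derive1 (fun t => complex.Im (f t)) x.

(* y1 is y^[1] = p (y' + s y).  As y' exists only almost everywhere, y^[1] is
   determined up to a null set, and "y^[1] is absolutely continuous on [a, b]"
   refers to its unique continuous representative y1, which also provides the
   boundary values.  The a.e. differentiability required here and in SL_expr is
   automatic for absolutely continuous functions. *)
Definition quasi_derivative a b p s y (y1 : R -> R[i]) : Prop :=
  ae_on a b (fun x => cderivable y x /\
    y1 x = (p x)%:C * (cderive y x + (s x)%:C * y x)).

Definition SL_expr a b q r s y (y1 f : R -> R[i]) : Prop :=
  ae_on a b (fun x => cderivable y1 x /\
    f x = ((r x)^-1)%:C *
          (- cderive y1 x + (s x)%:C * y1 x + (q x)%:C * y x)).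

Definition Ymx y (y1 : R -> R[i]) (x : R) : 'cV[R[i]]_2 :=
  \col_(i < 2) (if i == 0 then y x else y1 x).

Definition Emx : 'M[R[i]]_2 :=
  \matrix_(i < 2, j < 2) nth 0 (nth [::] [:: [:: 0; -1]; [:: 1; 0]] i) j.

Definition adjoint_mx (A : 'M[R[i]]_2) : 'M[R[i]]_2 := map_mx conjc A^T.

Definition selfadjoint_bc (A B : 'M[R[i]]_2) : Prop :=
  \rank (row_mx A B) = 2%N /\
  A *m Emx *m adjoint_mx A = B *m Emx *m adjoint_mx B.

(* Graph of the operator L(p, s): y is in its domain and L y = f. *)
Definition SL_operator a b p q r s (A B : 'M[R[i]]_2) y f : Prop :=
  [/\ in_L2 a b r y, in_L2 a b r f &
    exists y1 : R -> R[i],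
      [/\ abs_continuous_on a b y, abs_continuous_on a b y1,
          quasi_derivative a b p s y y1,
          A *m Ymx y y1 a + B *m Ymx y y1 b = 0 &
          SL_expr a b q r s y y1 f]].

Definition SL_eigenspace a b p q r s (A B : 'M[R[i]]_2) (z : R[i]) :
    set (R -> R[i]) :=
  [set y | exists f, SL_operator a b p q r s A B y f /\
                     ae_on a b (fun x => f x = z * y x)].

(* The eigenspace for z has dimension k as a subspace of L^2_r(J), that is,
   modulo equality a.e. on J; z is an eigenvalue iff k is positive. *)
Definition SL_multiplicity a b p q r s (A B : 'M[R[i]]_2) (z : R[i])
    (k : nat) : Prop :=
  exists e : 'I_k -> R -> R[i],
    [/\ forall i, SL_eigenspace a b p q r s A B z (e i),
        forall c : 'I_k -> R[i],
          ae_on a b (fun x => \sum_(i < k) c i * e i x = 0) ->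
          forall i, c i = 0 &
        forall y, SL_eigenspace a b p q r s A B z y ->
          exists c : 'I_k -> R[i],
            ae_on a b (fun x => y x = \sum_(i < k) c i * e i x)].

(* lam n is the n-th eigenvalue, n >= 0, counted with multiplicity.  As z runs
   over all complex numbers, this includes that all eigenvalues are real. *)
Definition SL_eigenvalues a b p q r s (A B : 'M[R[i]]_2)
    (lam : nat -> R) : Prop :=
  [/\ {homo lam : m n / (m <= n)%N >-> m <= n},
      lam n @[n --> \oo] --> +oo &
      forall (z : R[i]) (k : nat),
        SL_multiplicity a b p q r s A B z k <->
        ([set n | (lam n)%:C = z] #= `I_k)%card].

End SturmLiouville.

(* Main.v *)
(** Put w = 1/p and let F(l) be the fundamental matrix at b, normalized at a, of
    the system y' = w y1 - s y, y1' = s y1 + (q - l r) y. The real number l is an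
    eigenvalue of multiplicity 2 - rank (A + B F(l)), and by Gronwall's inequality
    F depends continuously on l and on w, s in L^1. Lagrange's identity
    F(l) = F(k) (1 - (l - k) E G(k, l)), where G(k, l) is the matrix of L^2_r inner
    products of the basic solutions for k and l, together with the positivity of
    G(k, k) shows, in place of complex analysis, that near an eigenvalue of L of
    multiplicity d the operators L_m have d eigenvalues for large m, and near any
    other real number none. No eigenvalue escapes to - infinity: for l below a
    bound independent of m the Riccati inequality
    rho' <= q - l r + 2 rho s - w rho^2 has a solution with rho(a) and rho(b) so
    large, negative and positive, that the monotonicity of y y1 - rho y^2
    contradicts the boundary condition. Convergence of the n-th eigenvalue follows
    by induction on n and compactness. *)

Require Import Defs.
From HB Require Import structures.
From mathcomp Require Import all_boot all_order all_algebra.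
From mathcomp Require Import complex.
From mathcomp Require Import all_classical all_reals all_analysis.
From mathcomp Require Import measurable_realfun.
From mathcomp Require Import ring lra.

Set Implicit Arguments.
Unset Strict Implicit.
Unset Printing Implicit Defensive.

Import Order.TTheory GRing.Theory Num.Theory.
Import numFieldNormedType.Exports.

Local Open Scope classical_set_scope.
Local Open Scope ring_scope.

(** * Absolutely continuous functions *)

Section AC.
Context {R : realType}.
Local Notation mu := (@lebesgue_measure R).
Implicit Types (a b x : R) (f g : R -> R).

(** The obstacle is an eigenvalue of multiplicity two. For a self-adjoint condition, det (A + B F)
    is, up to a nonzero factor, a real function d0 + tr X, where X = P F with a real matrix P and
    d0^2 <= 4 det P. At a simple eigenvalue this function changes sign, which survives a small
    perturbation. At a double one it has a zero of second order without a change of sign, and a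
    perturbed real function might have no zero there at all. The way out is that det X is constant,
    because det F = 1, and that the off-diagonal entries of X do change sign: where one of them
    vanishes, the product of the diagonal entries is known, and the inequality of the arithmetic and
    geometric means bounds the trace. That there are no more than two zeros is a matter of
    orthogonality in the plane of initial values. The coefficients are only integrable, so
    derivatives exist only almost everywhere. Every estimate is therefore phrased as a differential
    inequality between absolutely continuous functions, and all of them rest on a single
    monotonicity theorem. *)

Definition ac a b f : Prop :=
  forall e : R, 0 < e -> exists2 d : R, 0 < d &
    forall (n : nat) (u v : 'I_n -> R),
      (forall i, [/\ a <= u i, u i <= v i & v i <= b]) ->
      trivIset setT (fun i => `]u i, v i[%classic) ->
      \sum_(i < n) (v i - u i) < d ->
      \sum_(i < n) `|f (v i) - f (u i)| < e.

(** A list ordered from left to right, unlike a family over ['I_n], is extended by [rcons] when the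
    end point [x] moves to the right in [ac_derive_ge0_le]. *)
Definition chain a x (l : seq (R * R)) : bool :=
  all (fun p => [&& a <= p.1, p.1 <= p.2 & p.2 <= x]) l &&
  pairwise (fun p q : R * R => p.2 <= q.1) l.

Lemma chain_trivIset a x (l : seq (R * R)) : chain a x l ->
  trivIset setT (fun i : 'I_(size l) =>
    `](nth (0, 0) l i).1, (nth (0, 0) l i).2[%classic).
Proof.
move=> /andP[_ /(pairwiseP (0, 0)) h] i j _ _ [z /= []].
rewrite !in_itv /= => /andP[i1 i2] /andP[j1 j2].
apply: val_inj => /=; apply/eqP; case: ltngtP => // ij.
- have := h i j (ltn_ord i) (ltn_ord j) ij.
  by move=> /(lt_le_trans i2) /lt_trans /(_ j1); rewrite ltxx.
- have := h j i (ltn_ord j) (ltn_ord i) ij.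
  by move=> /(lt_le_trans j2) /lt_trans /(_ i1); rewrite ltxx.
Qed.

Lemma chain_sum_le_measure a x (l : seq (R * R)) (U : set R) : open U ->
  chain a x l -> (forall p, p \in l -> `]p.1, p.2[ `<=` U) ->
  ((\sum_(p <- l) (p.2 - p.1))%:E <= mu U)%E.
Proof.
move=> oU cl lU.
have tl := chain_trivIset cl.
have ml (i : 'I_(size l)) : measurable
  (`](nth (0, 0) l i).1, (nth (0, 0) l i).2[%classic : set R) by [].
have := measure_bigsetU_ord mu xpredT ml tl.
rewrite (big_nth (0, 0)) big_mkord.
pose z0 : R * R := (0, 0); rewrite -/z0.
have -> : (\sum_(i < size l) mu `](nth z0 l i).1, (nth z0 l i).2[ =
  (\sum_(i < size l) ((nth z0 l i).2 - (nth z0 l i).1)%R)%:E)%E.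
  rewrite -sumEFin; apply: eq_bigr => i _; rewrite lebesgue_measure_itv /= lte_fin.
  have := allP (andP cl).1 _ (mem_nth (0 : R, 0 : R) (ltn_ord i)).
  move=> /and3P[_ + _]; rewrite le_eqVlt => /orP[/eqP ->|->]; last by rewrite EFinB.
  by rewrite ltxx subrr.
move=> <-; apply: le_measure; rewrite ?inE.
- exact: bigsetU_measurable.
- exact: measurable_realfun.open_measurable.
- apply: (big_ind (fun X => X `<=` U)) => //.
  + by move=> X Y XU YU z [/XU|/YU].
  + by move=> i _; apply: lU; exact: mem_nth.
Qed.

(** An open set of small measure containing the intervals replaces the bound on their total length;
    outer regularity provides such a set around a null set. *)
Lemma ac_chain a b f : ac a b f -> forall e, 0 < e -> exists2 d : R, 0 < d &
  forall (U : set R) l, open U -> (mu U < d%:E)%E -> chain a b l ->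
   (forall p, p \in l -> `]p.1, p.2[ `<=` U) ->
   \sum_(p <- l) `|f p.2 - f p.1| < e.
Proof.
move=> acf e e0; have [d d0 h] := acf _ e0; exists d => // U l oU Ud cl lU.
rewrite (big_nth (0, 0)) big_mkord.
apply: (h _ (fun i => (nth (0, 0) l i).1) (fun i => (nth (0, 0) l i).2)).
- move=> i; have := allP (andP cl).1 _ (mem_nth (0 : R, 0 : R) (ltn_ord i)).
  by move=> /and3P.
- exact: chain_trivIset cl.
- have := chain_sum_le_measure oU cl lU.
  move=> /le_lt_trans /(_ Ud); rewrite lte_fin.
  by rewrite (big_nth (0, 0)) big_mkord.
Qed.

Lemma is_derive_near f x df : is_derive x 1 f df -> forall e, 0 < e ->
  exists2 d : R, 0 < d & forall y, `|y - x| < d ->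
    `|f y - f x - df * (y - x)| <= e * `|y - x|.
Proof.
move=> [dfx dE] e e0.
have : h^-1 *: (f (h *: 1 + x) - f x) @[h --> 0^'] --> df by rewrite -dE.
move=> /cvgrPdist_le /(_ _ e0).
rewrite /= /dnbhs near_withinE => /nbhs_ballP[d /= d0 h].
exists d => // y yx; have [->|yNx] := eqVneq y x.
  by rewrite !subrr mulr0 subrr normr0 mulr0.
have yx0 : y - x != 0 by rewrite subr_eq0.
have := h (y - x); rewrite /ball /= sub0r normrN => /(_ yx yx0).
rewrite /GRing.scale /= mulr1 subrK => {}h.
rewrite -ler_pdivrMr ?normr_gt0// -normf_div.
apply: le_trans h; rewrite distrC le_eqVlt; apply/orP; left; apply/eqP.
by congr (`|_|); field; rewrite yx0.
Qed.

(* A real-induction (Cousin) argument: near a point where the derivative exists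
   and is nonnegative, [f] decreases at most with slope [e]; the remaining
   points lie in an open set of small measure, where absolute continuity
   controls the variation. *)
Lemma ac_derive_ge0_le a b f : a <= b -> ac a b f ->
  {ae mu, forall x, `]a, b[%classic x ->
     exists2 df : R, is_derive x 1 f df & 0 <= df} -> f a <= f b.
Proof.
move=> ab acf [N [mN muN0 hN]].
suff H e : 0 < e -> f a - f b <= e * (b - a) + e.
  rewrite -subr_le0; apply/ler_addgt0Pr => e e0; rewrite add0r.
  have ba1 : 0 < b - a + 1 by rewrite ltr_pwDr// subr_ge0.
  have /H : 0 < e / (b - a + 1) by rewrite divr_gt0.
  have -> : e / (b - a + 1) * (b - a) + e / (b - a + 1) = e.
    by field; rewrite gt_eqF.
  by [].
move=> e0; have [d d0 hd] := ac_chain acf e0.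
(* The end points join the exceptional set because the derivative is controlled only inside the
   interval. *)
pose N' := N `|` ([set a] `|` [set b]).
have mN' : measurable N' by apply: measurableU => //; apply: measurableU.
have muN' : mu N' = 0%E.
  have ab0 : mu ([set a] `|` [set b]) = 0%E.
    by apply: null_set_setU => //; exact: lebesgue_measure_set1.
  by apply: null_set_setU => //; exact: measurableU.
have [||U [oU NU]] := @lebesgue_regularity_outer _ N' d mN' => //.
  by rewrite [X in (X < _)%E](_ : _ = 0%E).
rewrite -/mu => UNd.
have mU : measurable U by exact: measurable_realfun.open_measurable.
have {UNd}muU : (mu U < d%:E)%E.
  apply: le_lt_trans UNd.
  apply: (@le_trans _ _ (mu ((U `\` N') `|` N'))).
    apply: le_measure; rewrite ?inE//.
      by apply: measurableU => //; apply: measurableD.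
    by move=> z Uz; have [|] := pselect (N' z); [right|left].
  by rewrite measureU0//; exact: measurableD.
(* Invariant of the induction: up to [x], the decrease of [f] is bounded by a slope term and by the
   variation of [f] over a chain inside [U]. *)
pose good x := exists2 l, chain a x l & (forall p, p \in l -> `]p.1, p.2[ `<=` U) /\
  f a - f x <= e * (x - a) + \sum_(p <- l) `|f p.2 - f p.1|.
suff [l cl [lU]] : good b.
  move=> /le_trans; apply; rewrite lerD2l; apply: ltW.
  exact: hd oU muU cl lU.
have good_le x y : chain a x y -> forall z, x <= z -> chain a z y.
  move=> /andP[h1 h2] z xz; apply/andP; split => //.
  apply: sub_all h1 => p /and3P[-> ->] /= /le_trans; exact.
have step s : a <= s <= b -> exists2 dl : R, 0 < dl & forall x y,
    a <= x -> s - dl < x -> x <= s -> s <= y -> y < s + dl -> y <= b -> good x -> good y.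
  move=> /andP[sa sb]; have [Ns|Ns] := pselect (N' s).
    have /nbhs_ballP[dl /= dl0 hdl] : nbhs s U.
      by apply: open_nbhs_nbhs; split => //; exact: NU.
    exists dl => // x y ax xs1 xs2 ys1 ys2 yb [l cl [lU lf]].
    have xy : x <= y := le_trans xs2 ys1.
    exists (rcons l (x, y)); last split.
    - apply/andP; split.
        rewrite all_rcons /= ax xy lexx /=.
        by have /andP[] := good_le _ _ cl _ xy.
      rewrite pairwise_rcons (andP cl).2 andbT.
      by apply: sub_all (andP cl).1 => p /and3P[].
    - move=> p; rewrite mem_rcons inE => /orP[/eqP ->|/lU//] z /=.
      rewrite in_itv /= => /andP[xz zy]; apply: hdl; rewrite /ball /=.
      rewrite ltr_norml; apply/andP; split; lra.
    - rewrite big_rcons /=.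
      have : f x - f y <= `|f y - f x| by rewrite distrC ler_norm.
      have : e * (x - a) <= e * (y - a) by rewrite ler_pM2l// lerB.
      move: lf; lra.
  have {}Ns : `]a, b[%classic s /\ ~ N s.
    split; last by move=> ?; apply: Ns; left.
    rewrite /= in_itv /= !lt_neqAle sa sb !andbT.
    by apply/andP; split; apply/eqP => ?; subst; apply: Ns; right; [left|right].
  case: Ns => sab Ns.
  have [df fs df0] : exists2 df : R, is_derive s 1 f df & 0 <= df.
    have [//|nP] := pselect (exists2 df : R, is_derive s 1 f df & 0 <= df).
    by exfalso; apply: Ns; apply: hN => /= /(_ sab).
  have [dl dl0 hdl] := is_derive_near fs e0.
  exists dl => // x y ax xs1 xs2 ys1 ys2 yb [l cl [lU lf]].
  have xy : x <= y := le_trans xs2 ys1.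
  exists l; [exact: good_le xy|split => //].
  have hx : f x - f s <= e * (s - x).
    have /hdl : `|x - s| < dl by rewrite ltr_norml; apply/andP; split; lra.
    rewrite [`|x - s|]distrC (ger0_norm (_ : 0 <= s - x)) ?subr_ge0//.
    move=> /(le_trans (ler_norm _)).
    have : df * (x - s) <= 0 by rewrite mulr_ge0_le0// subr_le0.
    lra.
  have hy : f s - f y <= e * (y - s).
    have /hdl : `|y - s| < dl by rewrite ltr_norml; apply/andP; split; lra.
    rewrite (ger0_norm (_ : 0 <= y - s)) ?subr_ge0//.
    rewrite -normrN => /(le_trans (ler_norm _)).
    have : 0 <= df * (y - s) by rewrite mulr_ge0// subr_ge0.
    lra.
  have -> : e * (y - a) = e * (y - s) + e * (s - x) + e * (x - a) by ring.
  lra.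
pose S := [set x | a <= x <= b /\ good x].
have Sa : S a.
  split; first by rewrite lexx.
  by exists nil => //; split => //; rewrite big_nil !subrr mulr0 addr0.
have hS : has_sup S.
  by split; [exists a|exists b => x [/andP[]]].
have supa : a <= sup S by apply: ub_le_sup => //; exact: hS.2.
have supb : sup S <= b by apply: ge_sup; [exists a|move=> x [/andP[]]].
have [|dl dl0 hdl] := step (sup S); first by rewrite supa supb.
have [x Sx xs] := sup_adherent dl0 hS.
have xS : x <= sup S by apply: ub_le_sup => //; exact: hS.2.
have Sm : forall y, sup S <= y -> y < sup S + dl -> y <= b -> good y.
  by move=> y y1 y2 y3; apply: hdl Sx.2 => //; case/andP: Sx.1.
have [sbE|sb] := eqVneq (sup S) b.
  by apply: Sm; rewrite ?sbE// ltrDl.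
have {}sb : sup S < b by rewrite lt_neqAle sb.
pose y := Num.min b (sup S + dl / 2).
have y1 : sup S < y by rewrite lt_min sb ltrDl divr_gt0.
have : y <= sup S.
  apply: ub_le_sup; first exact: hS.2.
  split; first by rewrite (le_trans supa (ltW y1)) ge_min lexx.
  apply: Sm; [exact: ltW| |by rewrite ge_min lexx].
  by rewrite gt_min; apply/orP; right; rewrite ltrD2l ltr_pdivrMr// ltr_pMr// ltr1n.
by rewrite leNgt y1.
Qed.

End AC.

(** * Primitives of integrable functions *)

Section Primitive.
Context {R : realType} (a b : R).
Local Notation mu := (@lebesgue_measure R).
Local Notation J := (`]a, b[%classic : set R).
Implicit Types (f g : R -> R).

Lemma mJ : R.-ocitv.-measurable.-sigma.-measurable J.
Proof. exact: measurable_itv. Qed.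

Lemma ae_onS (A B : R -> Prop) : (forall x, J x -> A x -> B x) ->
  ae_on a b A -> ae_on a b B.
Proof.
move=> AB; apply: (@filterS _ _ (ae_filter_ringOfSetsType mu)) => x Ax Jx.
by apply: AB => //; apply: Ax.
Qed.

Lemma ae_onI (A B : R -> Prop) : ae_on a b A -> ae_on a b B ->
  ae_on a b (fun x => A x /\ B x).
Proof.
have := @filterS2 _ _ (ae_filter_ringOfSetsType mu); apply => x Ax Bx Jx.
by split; [apply: Ax|apply: Bx].
Qed.

Lemma ae_onW (A : R -> Prop) : (forall x, J x -> A x) -> ae_on a b A.
Proof. by move=> h; apply: aeW => x /h. Qed.

(** Extending [g] by zero and integrating from -oo gives a function on all of R that vanishes up to
    [a] and to which [FTC1Ny] applies. *)
Definition primitive g x : R := \int[mu]_(t in `]-oo, x]) (g \_ J) t.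
Local Notation P := primitive.

Lemma in_L1_patch g : in_L1 a b g -> mu.-integrable setT (EFin \o (g \_ J)).
Proof. by rewrite /in_L1 integrable_mkcond//= restrict_EFin. Qed.

Lemma in_L1_measurable g : in_L1 a b g -> measurable_fun J g.
Proof. by move=> /integrableP[/measurable_EFinP]. Qed.

Lemma in_L1_norm g : in_L1 a b g -> in_L1 a b (fun x => `|g x|).
Proof. exact: integrable_norm. Qed.

Lemma in_L1D f g : in_L1 a b f -> in_L1 a b g -> in_L1 a b (fun x => f x + g x).
Proof. by move=> hf hg; have := integrableD mJ hf hg. Qed.

Lemma in_L1Z k g : in_L1 a b g -> in_L1 a b (fun x => k * g x).
Proof. by move=> hg; have := integrableZl mJ k hg. Qed.

Lemma in_L1B f g : in_L1 a b f -> in_L1 a b g -> in_L1 a b (fun x => f x - g x).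
Proof. by move=> hf hg; have := integrableB mJ hf hg. Qed.

Lemma in_L1_le f g : measurable_fun J f -> (forall x, J x -> `|f x| <= `|g x|) ->
  in_L1 a b g -> in_L1 a b f.
Proof.
move=> mf fg; apply: le_integrable => //; first exact/measurable_EFinP.
Qed.

Lemma in_L1M (h g : R -> R) (C : R) : measurable_fun J h ->
  (forall x, J x -> `|h x| <= C) ->
  in_L1 a b g -> in_L1 a b (fun x => h x * g x).
Proof.
move=> mh hC hg; apply: (@in_L1_le _ (fun x => C * g x)).
- by apply: measurable_funM => //; exact: in_L1_measurable.
- move=> x Jx; rewrite !normrM ler_wpM2r// (le_trans (hC _ Jx))//.
  exact: ler_norm.
- exact: in_L1Z.
Qed.

Lemma primitive_diff g u v : in_L1 a b g -> u <= v ->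
  P g v - P g u = \int[mu]_(t in `]u, v]) (g \_ J) t.
Proof.
move=> /in_L1_patch gJ uv; apply: Rintegral_itvB => //.
by apply: integrableS gJ.
Qed.

Lemma primitive_norm_le g u v : in_L1 a b g -> u <= v ->
  `|P g v - P g u| <= P (fun x => `|g x|) v - P (fun x => `|g x|) u.
Proof.
move=> gJ uv; rewrite !primitive_diff//; last exact: in_L1_norm.
have gJ' := in_L1_patch gJ.
apply: (le_trans (le_normr_Rintegral _ _)) => //; first exact: integrableS gJ'.
rewrite le_eqVlt; apply/orP; left; apply/eqP; apply: eq_Rintegral => x _.
by rewrite !patchE; case: ifP => //; rewrite normr0.
Qed.

Lemma primitive_a g x : x <= a -> P g x = 0.
Proof.
move=> xa; rewrite /primitive (@eq_Rintegral _ _ _ _ _ (cst 0)).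
  by rewrite Rintegral_cst// mul0r.
move=> t; rewrite inE /= in_itv /= => tx.
rewrite patchE; case: ifPn => //; rewrite inE /= in_itv /= => /andP[at_ _].
by have := lt_le_trans at_ (le_trans tx xa); rewrite ltxx.
Qed.

Lemma primitive_b g : P g b = \int[mu]_(t in J) g t.
Proof.
rewrite /primitive Rintegral_mkcond [RHS]Rintegral_mkcond.
apply: eq_Rintegral => x _; rewrite patchE.
case: ifPn => // /negP h; rewrite patchE; case: ifPn => //.
rewrite inE /= in_itv /= => /andP[_ xb]; exfalso; apply: h.
by rewrite inE /= in_itv /= ltW.
Qed.

Lemma sum_Rintegral_le n (u v : 'I_n -> R) (k : R -> R) :
  (forall x, 0 <= k x) -> mu.-integrable setT (EFin \o k) ->
  trivIset setT (fun i => `]u i, v i[%classic) ->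
  \sum_(i < n) \int[mu]_(t in `]u i, v i[) k t <= \int[mu]_t k t.
Proof.
move=> k0 ik tI.
have mk : measurable_fun setT (EFin \o k) by case/integrableP: ik.
have fin (A : set R) : measurable A -> (\int[mu]_(t in A) (k t)%:E)%E \is a fin_num.
  by move=> mA; apply: integrable_fin_num => //; exact: integrableS ik.
rewrite -lee_fin -sumEFin /Rintegral fineK; last exact: fin.
rewrite (eq_bigr (fun i => (\int[mu]_(t in `]u i, v i[) (k t)%:E)%E)); last first.
  by move=> i _; rewrite fineK//; exact: fin.
have mI (i : 'I_n) : measurable (`]u i, v i[%classic : set R) by [].
have tI' : trivIset [set` index_enum 'I_n] (fun i => `]u i, v i[%classic).
  exact: sub_trivIset tI.
have := @ge0_integral_bigsetU _ _ _ mu _ _ (fun x => (k x)%:E) _ mI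
  (index_enum_uniq _) tI'.
move=> /= <-.
- apply: ge0_subset_integral => //.
  + exact: bigsetU_measurable.
  + by move=> x _; rewrite lee_fin.
- by apply: measurable_funS mk.
- by move=> x _; rewrite lee_fin.
Qed.

(** Dominated convergence: the excess of [|k|] over the level [n] is eventually zero at each point
    and never exceeds [|k|]. This splits [|k|] into a bounded part and a part of small integral. *)
Lemma tail_integral_small (k : R -> R) : mu.-integrable setT (EFin \o k) ->
  forall e, 0 < e -> exists n : nat,
    mu.-integrable setT (EFin \o (fun x => Num.max (`|k x| - n%:R) 0)) /\
    \int[mu]_t (Num.max (`|k t| - n%:R) 0) < e.
Proof.
move=> ik e e0.
have mk : measurable_fun setT k by apply/measurable_EFinP; case/integrableP: ik.
pose f_ n x := (Num.max (`|k x| - n%:R) 0)%:E.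
have mf n : measurable_fun setT (fun x => Num.max (`|k x| - n%:R) 0).
  apply: measurable_maxr => //; apply: measurable_funB => //.
  exact: measurableT_comp.
have dom n x : `|Num.max (`|k x| - n%:R) 0| <= `|k x|.
  rewrite ger0_norm ?le_max ?lexx ?orbT//.
  by rewrite ge_max normr_ge0 andbT gerBl.
have int n : mu.-integrable setT (EFin \o (fun x => Num.max (`|k x| - n%:R) 0)).
  apply: le_integrable ik => //.
    by apply/measurable_EFinP; exact: mf.
  by move=> x _; rewrite /= lee_fin dom.
have [] := @dominated_convergence _ _ _ mu setT measurableT f_ (cst 0%E)
   (EFin \o (fun x => `|k x|)).
- by move=> n; apply/measurable_EFinP; exact: mf.
- exact: measurable_cst.
- apply: aeW => x _; apply: cvg_near_cst.
  have [N _ hN] := nbhs_infty_ger `|k x|.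
  exists N => // n /hN /= h; rewrite /f_; congr (_%:E).
  by apply/max_idPr; rewrite subr_le0.
- exact: integrable_norm.
- by apply: aeW => x n _; rewrite /f_ /= lee_fin dom.
move=> _ _; rewrite integral0 => /fine_cvgP[_ /cvgrPdist_lt /(_ _ e0)].
move=> [N _ /(_ N (leqnn N))] /=; rewrite sub0r normrN => h.
by exists N; split => //; apply: le_lt_trans h; exact: ler_norm.
Qed.

Lemma ac_primitive g : in_L1 a b g -> ac a b (P g).
Proof.
move=> g1 e e0; have gJ := in_L1_patch g1.
have e2 : 0 < e / 2 by rewrite divr_gt0.
have [n [ikn kn]] := tail_integral_small gJ e2.
(* The part of [g] below the level [n] contributes at most [n%:R] times the total length, hence at
   most [e / 2]; the successor keeps the denominator positive. *)
exists (e / 2 / n.+1%:R); first by rewrite divr_gt0.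
move=> m u v uv tI; rewrite ltr_pdivlMr// => ud.
pose k x := Num.max (`|(g \_ J) x| - n%:R) 0.
have step i : `|P g (v i) - P g (u i)| <=
  \int[mu]_(t in `]u i, v i[) k t + n%:R * (v i - u i).
  have [_ uvi _] := uv i.
  apply: (le_trans (primitive_norm_le g1 uvi)); rewrite primitive_diff//; last exact: in_L1_norm.
  have ig : mu.-integrable setT (EFin \o ((fun x => `|g x|) \_ J)).
    exact/in_L1_patch/in_L1_norm.
  rewrite -Rintegral_itv_bndo_bndc; last by apply: integrableS ig.
  have in_ : mu.-integrable `]u i, v i[ (EFin \o (fun=> n%:R : R)).
    apply: (@measurable_bounded_integrable _ _ _ mu (fun=> n%:R : R)) => //.
      by rewrite [X in (X < _)%E]lebesgue_measure_itv; case: ifP => _; rewrite -?EFinB ltry.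
    exists n%:R; split; first exact: num_real.
    by move=> M nM x _ /=; rewrite normr_nat ltW.
  have -> : n%:R * (v i - u i) = \int[mu]_(t in `]u i, v i[) (n%:R : R).
    rewrite Rintegral_cst//; congr (_ * _).
    rewrite [X in fine X]lebesgue_measure_itv /= lte_fin.
    move: uvi; rewrite le_eqVlt => /orP[/eqP ->|->]; last by rewrite -EFinB.
    by rewrite ltxx subrr.
  have ik : mu.-integrable `]u i, v i[ (EFin \o k) by apply: integrableS ikn.
  rewrite -RintegralD//.
  apply: le_Rintegral => //; first by apply: integrableS ig.
    by have := integrableD _ ik in_; apply.
  move=> x _; rewrite -lerBlDr le_max; apply/orP; left.
  by rewrite lerB// !patchE; case: ifP => // _; rewrite normr0.
apply: (le_lt_trans (ler_sum _ (fun i _ => step i))).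
rewrite big_split /= -mulr_sumr [e]splitr.
apply: ltr_leD.
  apply: le_lt_trans kn; apply: sum_Rintegral_le => //.
  by move=> x; rewrite le_max lexx orbT.
apply: le_trans (ltW ud); rewrite mulrC ler_wpM2l ?ler_nat//.
by apply: sumr_ge0 => i _; rewrite subr_ge0; case: (uv i).
Qed.

(** Plays the role of f = f(a) + int g. Products and exponentials stay in this class, so integration
    by parts becomes the product rule, and inequalities between derivatives are integrated by
    [prim_mono]. *)
Definition prim f g : Prop :=
  ac a b f /\ ae_on a b (fun x => is_derive x 1 f (g x)).

Lemma prim_primitive g : in_L1 a b g -> prim (P g) g.
Proof.
move=> g1; split; first exact: ac_primitive.
have gJ := in_L1_patch g1.
have /FTC1Ny : forall y, mu.-integrable `]-oo, y] (EFin \o (g \_ J)).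
  by move=> y; apply: integrableS gJ.
move=> /(_ (integrable_locally mJ g1)).
apply: (@filterS _ _ (ae_filter_ringOfSetsType mu)) => x [dP prim_primitiveE] Jx.
by split => //; rewrite -derive1E prim_primitiveE patchE mem_set.
Qed.

End Primitive.

(** * Calculus with absolutely continuous functions and a.e. derivatives; Gronwall's inequality *)

Section ACtheory.
Context {R : realType} (a b : R) (ab : a < b).
Local Notation mu := (@lebesgue_measure R).
Local Notation J := (`]a, b[%classic : set R).
Implicit Types (f g h : R -> R).

Lemma ac_unif f : ac a b f -> forall e, 0 < e -> exists2 d : R, 0 < d &
  forall u v, a <= u <= b -> a <= v <= b -> `|v - u| < d -> `|f v - f u| < e.
Proof.
move=> acf e e0; have [d d0 H] := acf _ e0; exists d => //.
have {}H u v : a <= u -> u <= v -> v <= b -> v - u < d -> `|f v - f u| < e.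
  move=> au uv vb vud; have := H 1%N (fun=> u) (fun=> v).
  rewrite !big_ord1; apply => // i j _ _ _.
  by rewrite (ord1 i) (ord1 j).
move=> u v /andP[au ub] /andP[av vb]; have [uv|/ltW vu] := leP u v.
  by rewrite ger0_norm ?subr_ge0//; apply: H.
by rewrite ler0_norm ?subr_le0// opprB distrC; apply: H.
Qed.

Lemma ac_within f : ac a b f -> {within `[a, b], continuous f}.
Proof.
move=> acf; apply/subspace_continuousP => x /= xab.
apply/cvgrPdist_lt => e e0; have [d d0 H] := ac_unif acf e0.
rewrite near_withinE; near=> y => yab.
rewrite distrC; apply: H; rewrite ?(itvP xab) ?(itvP yab)//.
Unshelve. all: by end_near. Qed.

Lemma ac_continuous f : ac a b f -> {in `]a, b[, continuous f}.
Proof.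
move=> /ac_within acf x xab; apply: within_continuous_continuous ab acf xab.
Qed.

Lemma ac_bounded f : ac a b f ->
  exists2 C, 0 < C & forall x, a <= x <= b -> `|f x| <= C.
Proof.
move=> /ac_within cf.
have cnf : {within `[a, b], continuous (fun x => `|f x|)}.
  by move=> x; apply: continuous_comp; [exact: cf|exact: norm_continuous].
have [c _ hc] := EVT_max (ltW ab) cnf.
exists (`|f c| + 1); first by rewrite ltr_wpDl.
by move=> x xab; apply: ler_wpDr => //; apply: hc; rewrite in_itv.
Qed.

Lemma ac_measurable f : ac a b f -> measurable_fun J f.
Proof.
move=> acf; apply: open_continuous_measurable_fun; first exact: itv_open.
by move=> x; rewrite inE => xab; apply: ac_continuous.
Qed.

Lemma ac_sub f x y : a <= x -> y <= b -> ac a b f -> ac x y f.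
Proof.
move=> ax yb acf e /acf[d d0 H]; exists d => // n u v uv.
apply: H => i; have [h1 h2 h3] := uv i; split => //.
  exact: le_trans h1.
exact: le_trans yb.
Qed.

(** Sums, products and exponentials are all handled through a bound of their increments of this
    form. *)
Lemma ac_dominated f g h C : 0 < C ->
  (forall u v, a <= u -> u <= v -> v <= b ->
     `|h v - h u| <= C * (`|f v - f u| + `|g v - g u|)) ->
  ac a b f -> ac a b g -> ac a b h.
Proof.
move=> C0 H acf acg e e0.
have e1 : 0 < e / (2 * C) by rewrite divr_gt0// mulr_gt0.
have [d1 d10 H1] := acf _ e1; have [d2 d20 H2] := acg _ e1.
exists (Num.min d1 d2); first by rewrite lt_min d10.
move=> n u v uv tI; rewrite lt_min => /andP[s1 s2].
apply: (@le_lt_trans _ _ (\sum_(i < n) C * (`|f (v i) - f (u i)| + `|g (v i) - g (u i)|))).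
  by apply: ler_sum => i _; have [? ? ?] := uv i; apply: H.
rewrite -mulr_sumr big_split /=.
have /= := H1 _ _ _ uv tI s1; have /= := H2 _ _ _ uv tI s2.
rewrite -ltr_pdivlMl//.
have -> : C^-1 * e = e / (2 * C) + e / (2 * C) by field; rewrite gt_eqF.
lra.
Qed.

Lemma ac_cst k : ac a b (fun=> k).
Proof.
move=> e e0; exists 1 => // n u v _ _ _.
by rewrite big1// => i _; rewrite subrr normr0.
Qed.

Lemma acD f g : ac a b f -> ac a b g -> ac a b (fun x => f x + g x).
Proof.
apply: (@ac_dominated _ _ _ 1) => // u v _ _ _; rewrite mul1r.
by rewrite opprD addrACA; exact: ler_normD.
Qed.

Lemma acM f g : ac a b f -> ac a b g -> ac a b (fun x => f x * g x).
Proof.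
move=> acf acg; have [C1 C10 h1] := ac_bounded acf.
have [C2 C20 h2] := ac_bounded acg.
apply: (@ac_dominated f g _ (C1 + C2)) => //; first exact: addr_gt0.
move=> u v au uv vb.
have -> : f v * g v - f u * g u = (f v - f u) * g v + f u * (g v - g u) by ring.
apply: (le_trans (ler_normD _ _)); rewrite !normrM.
have hu : `|f u| <= C1 by apply: h1; rewrite au (le_trans uv).
have hv : `|g v| <= C2 by apply: h2; rewrite vb (le_trans au).
have h3 : `|f v - f u| * `|g v| <= `|f v - f u| * C2 by rewrite ler_wpM2l.
have h4 : `|f u| * `|g v - g u| <= C1 * `|g v - g u| by rewrite ler_wpM2r.
have h5 : 0 <= C1 * `|f v - f u| by rewrite mulr_ge0// ltW.
have h6 : 0 <= C2 * `|g v - g u| by rewrite mulr_ge0// ltW.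
lra.
Qed.

Lemma ac_expR f : ac a b f -> ac a b (fun x => expR (f x)).
Proof.
move=> acf; have [C1 C10 h1] := ac_bounded acf.
apply: (@ac_dominated f f _ (expR C1)) => //; first exact: expR_gt0.
suff H s t : `|s| <= C1 -> s <= t -> `|t| <= C1 -> `|expR t - expR s| <= expR C1 * `|t - s|.
  move=> u v au uv vb.
  have hu : `|f u| <= C1 by apply: h1; rewrite au (le_trans uv).
  have hv : `|f v| <= C1 by apply: h1; rewrite vb (le_trans au).
  apply: (@le_trans _ _ (expR C1 * `|f v - f u|)).
    have [le|/ltW le] := leP (f u) (f v); first exact: H.
    by rewrite distrC [X in _ * X]distrC; exact: H.
  by rewrite ler_wpM2l ?expR_ge0// lerDl.
move=> sC st tC.
rewrite !ger0_norm ?subr_ge0 ?ler_expR//.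
have -> : expR t - expR s = expR t * (1 - expR (s - t)).
  by rewrite mulrBr mulr1 -expRD [t + _]addrC subrK.
have h : 1 - expR (s - t) <= t - s by have := expR_ge1Dx (s - t); lra.
apply: (le_trans (ler_wpM2l (expR_ge0 _) h)).
by rewrite ler_wpM2r ?subr_ge0// ler_expR (le_trans (ler_norm _)).
Qed.

Local Notation prim := (prim a b).

Lemma prim_ac f g : prim f g -> ac a b f. Proof. by case. Qed.

Lemma prim_ext f g g' : (forall x, J x -> g x = g' x) -> prim f g -> prim f g'.
Proof. by move=> gg' [acf h]; split => //; apply: ae_onS h => x Jx; rewrite gg'. Qed.

Lemma prim_cst k : prim (fun=> k) (fun=> 0).
Proof. by split; [exact: ac_cst|apply: ae_onW => x _; exact: is_derive_cst]. Qed.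

Lemma primD f f' g g' : prim f f' -> prim g g' ->
  prim (fun x => f x + g x) (fun x => f' x + g' x).
Proof.
move=> [acf df] [acg dg]; split; first exact: acD.
by apply: ae_onS (ae_onI df dg) => x Jx [? ?]; exact: is_deriveD.
Qed.

Lemma primM f f' g g' : prim f f' -> prim g g' ->
  prim (fun x => f x * g x) (fun x => f' x * g x + f x * g' x).
Proof.
move=> [acf df] [acg dg]; split; first exact: acM.
apply: ae_onS (ae_onI df dg) => x Jx [hf hg].
apply: is_derive_eq (is_deriveM hf hg) _.
by rewrite /GRing.scale /= addrC mulrC; congr (_ + _); rewrite mulrC.
Qed.

Lemma primZ k f f' : prim f f' -> prim (fun x => k * f x) (fun x => k * f' x).
Proof.
move=> h; apply: prim_ext (primM (prim_cst k) h) => x _.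
by rewrite mul0r add0r.
Qed.

Lemma primB f f' g g' : prim f f' -> prim g g' ->
  prim (fun x => f x - g x) (fun x => f' x - g' x).
Proof.
move=> hf hg.
have := primD hf (primZ (-1) hg).
have -> : (fun x => f x + -1 * g x) = (fun x => f x - g x).
  by apply/funext => x; rewrite mulN1r.
by apply: prim_ext => x _; rewrite mulN1r.
Qed.

Lemma prim_expR f f' : prim f f' ->
  prim (fun x => expR (f x)) (fun x => f' x * expR (f x)).
Proof.
move=> [acf df]; split; first exact: ac_expR.
apply: ae_onS df => x Jx h.
have := is_derive1_comp (is_derive_expR (f x)) h.
by rewrite mulrC.
Qed.

Lemma prim_mono f f' : prim f f' -> ae_on a b (fun x => 0 <= f' x) ->
  forall x y, a <= x -> x <= y -> y <= b -> f x <= f y.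
Proof.
move=> [acf df] f'0 x y ax xy yb.
apply: (ac_derive_ge0_le xy (ac_sub ax yb acf)).
apply: (@filterS _ _ (ae_filter_ringOfSetsType mu)) (ae_onI df f'0) => t ht.
rewrite /= in_itv /= => /andP[xt ty]; have [] := ht.
  by rewrite /= in_itv /= (le_lt_trans ax xt) (lt_le_trans ty yb).
by move=> h1 h2; exists (f' t).
Qed.

Lemma prim_le f f' g g' : prim f f' -> prim g g' ->
  ae_on a b (fun x => f' x <= g' x) ->
  forall x y, a <= x -> x <= y -> y <= b -> f y - f x <= g y - g x.
Proof.
move=> hf hg fg x y ax xy yb.
have := prim_mono (primB hg hf) _ ax xy yb.
have h : ae_on a b (fun x => 0 <= g' x - f' x).
  by apply: ae_onS fg => z _; rewrite subr_ge0.
by move=> /(_ h); lra.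
Qed.

Lemma prim_norm_le f f' g g' : prim f f' -> prim g g' ->
  ae_on a b (fun x => `|f' x| <= g' x) ->
  forall x y, a <= x -> x <= y -> y <= b -> `|f y - f x| <= g y - g x.
Proof.
move=> hf hg fg x y ax xy yb; rewrite ler_norml; apply/andP; split.
  have := @prim_le _ _ _ _ (primZ (-1) hf) hg _ _ _ ax xy yb.
  have h : ae_on a b (fun x => -1 * f' x <= g' x).
    by apply: ae_onS fg => z _; rewrite ler_norml mulN1r; lra.
  by move=> /(_ h); lra.
apply: (prim_le hf hg _ ax xy yb).
by apply: ae_onS fg => z _; exact/le_trans/ler_norm.
Qed.

Lemma prim0_cst f f' : prim f f' -> ae_on a b (fun x => f' x = 0) ->
  forall x, a <= x <= b -> f x = f a.
Proof.
move=> hf f0 x /andP[ax xb]; apply/eqP; rewrite -subr_eq0 -normr_le0.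
have := prim_norm_le hf (prim_cst 0) _ (lexx a) ax xb.
rewrite subrr; apply.
by apply: ae_onS f0 => z _ ->; rewrite normr0.
Qed.

Lemma prim_unique f g f' : prim f f' -> prim g f' -> f a = g a ->
  forall x, a <= x <= b -> f x = g x.
Proof.
move=> hf hg fg x xab.
have := prim0_cst (primB hf hg) _ xab.
have h : ae_on a b (fun x => f' x - f' x = 0).
  by apply: ae_onW => z _; rewrite subrr.
by move=> /(_ h); rewrite fg subrr => /eqP; rewrite subr_eq0 => /eqP.
Qed.

(** The product of [Z] and the exponential of [- H] has a nonpositive derivative a.e. *)
Lemma gronwall Z Z' H G : prim Z Z' -> prim H G ->
  ae_on a b (fun x => Z' x <= G x * Z x) ->
  forall x, a <= x <= b -> Z x <= Z a * expR (H x - H a).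
Proof.
move=> hZ hH hle x /andP[ax xb].
have hE := prim_expR (primZ (-1) hH).
have := prim_le (primM hZ hE) (prim_cst 0) _ (lexx a) ax xb.
have h : ae_on a b (fun x => Z' x * expR (-1 * H x) + Z x * (-1 * G x * expR (-1 * H x)) <= 0).
  apply: ae_onS hle => z _ le.
  have -> : Z' z * expR (-1 * H z) + Z z * (-1 * G z * expR (-1 * H z)) =
     - (expR (-1 * H z) * (G z * Z z - Z' z)) by ring.
  by rewrite oppr_le0 mulr_ge0 ?expR_ge0// subr_ge0.
move=> /(_ h); rewrite subrr subr_le0 => {}h.
have -> : Z x = (Z x * expR (-1 * H x)) * expR (H x).
  by rewrite -mulrA -expRD mulN1r addNr expR0 mulr1.
apply: (le_trans (ler_wpM2r (expR_ge0 _) h)).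
by rewrite -mulrA -expRD mulN1r [- _ + _]addrC.
Qed.

End ACtheory.

(** * The first order system *)

Section LinearSystem.
Context {R : realType} (a b : R) (ab : a < b).
Local Notation prim := (prim a b).
Local Notation in_L1 := (in_L1 a b).
Local Notation P := (primitive a b).
Implicit Types (w s Q y z : R -> R).

Definition sol w s Q y y1 : Prop :=
  prim y (fun x => w x * y1 x - s x * y x) /\
  prim y1 (fun x => s x * y1 x + Q x * y x).

Lemma sol_lin w s Q y y1 z z1 c d : sol w s Q y y1 -> sol w s Q z z1 ->
  sol w s Q (fun x => c * y x + d * z x) (fun x => c * y1 x + d * z1 x).
Proof.
move=> [hy hy1] [hz hz1]; split.
- by apply: prim_ext (primD (primZ ab c hy) (primZ ab d hz)) => x _ /=; ring.
- by apply: prim_ext (primD (primZ ab c hy1) (primZ ab d hz1)) => x _ /=; ring.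
Qed.

Definition coef_norm w s Q x := `|w x| + `|s x| + `|Q x|.

Lemma in_L1_coef_norm w s Q : in_L1 w -> in_L1 s -> in_L1 Q ->
  in_L1 (coef_norm w s Q).
Proof.
by move=> hw hs hQ; apply: in_L1D; [apply: in_L1D|]; apply: in_L1_norm.
Qed.

Lemma norm_mul_le_half (x y : R) : `|x * y| <= (x ^+ 2 + y ^+ 2) / 2.
Proof.
rewrite normrM -(real_normK (num_real x)) -(real_normK (num_real y)).
have : 0 <= (`|x| - `|y|) ^+ 2 by exact: sqr_ge0.
move: `|x| `|y| => u v; rewrite !expr2; lra.
Qed.

(** The left-hand side is half the derivative of [d ^+ 2 + d1 ^+ 2] along a solution of the system;
    the estimate prepares Gronwall's inequality. *)
Lemma energy_le (w s Q d d1 : R) :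
  d * (w * d1 - s * d) + d1 * (s * d1 + Q * d) <=
  (`|w| + `|s| + `|Q|) * (d ^+ 2 + d1 ^+ 2).
Proof.
have -> : d * (w * d1 - s * d) + d1 * (s * d1 + Q * d) =
  w * (d * d1) + Q * (d * d1) + s * (d1 ^+ 2 - d ^+ 2) by ring.
have h := norm_mul_le_half d d1.
have hd : 0 <= d ^+ 2 by exact: sqr_ge0.
have hd1 : 0 <= d1 ^+ 2 by exact: sqr_ge0.
have h1 : w * (d * d1) <= `|w| * (d ^+ 2 + d1 ^+ 2).
  by rewrite (le_trans (ler_norm _))// normrM ler_wpM2l// (le_trans h)//; lra.
have h2 : Q * (d * d1) <= `|Q| * (d ^+ 2 + d1 ^+ 2).
  by rewrite (le_trans (ler_norm _))// normrM ler_wpM2l// (le_trans h)//; lra.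
have h3 : s * (d1 ^+ 2 - d ^+ 2) <= `|s| * (d ^+ 2 + d1 ^+ 2).
  rewrite (le_trans (ler_norm _))// normrM ler_wpM2l//.
  by rewrite ler_norml; apply/andP; split; lra.
lra.
Qed.

Lemma sol_eq0 w s Q y y1 : in_L1 w -> in_L1 s -> in_L1 Q -> sol w s Q y y1 ->
  y a = 0 -> y1 a = 0 -> forall x, a <= x <= b -> y x = 0 /\ y1 x = 0.
Proof.
move=> hw hs hQ [hy hy1] ya y1a x xab.
have hg := in_L1_coef_norm hw hs hQ.
have := gronwall ab (primD (primM ab hy hy) (primM ab hy1 hy1))
  (primZ ab 2 (prim_primitive hg)) _ xab.
set A := ae_on _ _ _; have hA : A.
  apply: ae_onW => t _; have := energy_le (w t) (s t) (Q t) (y t) (y1 t).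
  by rewrite /coef_norm -!expr2; lra.
move=> /(_ hA); rewrite ya y1a !mulr0 addr0 mul0r => h.
have h1 : 0 <= y x * y x by rewrite -expr2 sqr_ge0.
have h2 : 0 <= y1 x * y1 x by rewrite -expr2 sqr_ge0.
by split; apply/eqP; rewrite -[_ == _]orbb -mulf_eq0; apply/eqP; lra.
Qed.

Lemma sol_unique w s Q y y1 z z1 : in_L1 w -> in_L1 s -> in_L1 Q ->
  sol w s Q y y1 -> sol w s Q z z1 -> y a = z a -> y1 a = z1 a ->
  forall x, a <= x <= b -> y x = z x /\ y1 x = z1 x.
Proof.
move=> hw hs hQ hy hz e0 e1 x xab.
have := sol_eq0 hw hs hQ (sol_lin 1 (-1) hy hz).
rewrite e0 e1 !mul1r !mulN1r !subrr => /(_ erefl erefl _ xab) [h1 h2].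
by split; [move: h1|move: h2]; lra.
Qed.

(* The auxiliary [delta ^+ 2] makes the perturbation terms, which are linear in
   the difference of the solutions, amenable to Gronwall's inequality. *)
Lemma sol_perturb w s Q w' s' Q' y y1 z z1 K delta :
  in_L1 w -> in_L1 s -> in_L1 Q -> in_L1 w' -> in_L1 s' -> in_L1 Q' ->
  sol w s Q y y1 -> sol w' s' Q' z z1 -> z a = y a -> z1 a = y1 a ->
  (forall x, a <= x <= b -> `|y x| <= K /\ `|y1 x| <= K) -> 0 < delta ->
  P (coef_norm (fun x => w' x - w x) (fun x => s' x - s x) (fun x => Q' x - Q x)) b
    <= delta ->
  forall x, a <= x <= b ->
   (z x - y x) ^+ 2 + (z1 x - y1 x) ^+ 2 <=
   delta ^+ 2 * expR (2 * P (coef_norm w' s' Q') b + 2 * K).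
Proof.
move=> hw hs hQ hw' hs' hQ' [hy hy1] [hz hz1] e0 e1 hK d0 hd x xab.
set g := coef_norm w' s' Q'; set k := coef_norm _ _ _ in hd.
have K0 : 0 <= K by have /hK[+ _] : a <= a <= b; [rewrite lexx ltW|exact: le_trans].
have hg : in_L1 g by exact: in_L1_coef_norm.
have hk : in_L1 k by apply: in_L1_coef_norm; exact: in_L1B.
have hd0 := primB ab hz hy; have hd1 := primB ab hz1 hy1.
pose Z x := (z x - y x) * (z x - y x) + (z1 x - y1 x) * (z1 x - y1 x) + delta ^+ 2.
have hZ := primD (primD (primM ab hd0 hd0) (primM ab hd1 hd1))
             (prim_cst a b (delta ^+ 2)).
(* The second summand absorbs the perturbation: [|d| + |d1|] is at most
   [(d ^+ 2 + d1 ^+ 2 + delta ^+ 2) / delta], and since the integral of [k] is at most [delta], only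
   [2 * K] is added to the exponent. *)
have hH := primD (primZ ab 2 (prim_primitive hg)) (primZ ab (2 * K / delta) (prim_primitive hk)).
have := gronwall ab hZ hH _ xab.
set A := ae_on _ _ _; have hA : A.
  apply: ae_onW => t; rewrite /= in_itv /= => /andP[at_ tb].
  have [Ky Ky1] : `|y t| <= K /\ `|y1 t| <= K by apply: hK; rewrite !ltW.
  rewrite -/(Z t).
  have -> : Z t = (z t - y t) ^+ 2 + (z1 t - y1 t) ^+ 2 + delta ^+ 2.
    by rewrite /Z -!expr2.
  set d := z t - y t; set d1 := z1 t - y1 t.
  set Y := y t in Ky *; set Y1 := y1 t in Ky1 *.
  have zE : z t = Y + d by rewrite /d /Y; ring.
  have z1E : z1 t = Y1 + d1 by rewrite /d1 /Y1; ring.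
  rewrite zE z1E.
  have h1 := energy_le (w' t) (s' t) (Q' t) d d1.
  set dw := w' t - w t; set ds := s' t - s t; set dQ := Q' t - Q t.
  have kE : k t = `|dw| + `|ds| + `|dQ| by [].
  have h2 : d * (dw * Y1 - ds * Y) <= `|d| * (K * k t).
    apply: (le_trans (ler_norm _)); rewrite normrM ler_wpM2l//.
    apply: (le_trans (ler_normB _ _)); rewrite !normrM kE.
    have := ler_wpM2l (normr_ge0 dw) Ky1; have := ler_wpM2l (normr_ge0 ds) Ky.
    have : 0 <= K * `|dQ| by rewrite mulr_ge0.
    lra.
  have h3 : d1 * (ds * Y1 + dQ * Y) <= `|d1| * (K * k t).
    apply: (le_trans (ler_norm _)); rewrite normrM ler_wpM2l//.
    apply: (le_trans (ler_normD _ _)); rewrite !normrM kE.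
    have := ler_wpM2l (normr_ge0 ds) Ky1; have := ler_wpM2l (normr_ge0 dQ) Ky.
    have : 0 <= K * `|dw| by rewrite mulr_ge0.
    lra.
  have h4 : `|d| + `|d1| <= (d ^+ 2 + d1 ^+ 2 + delta ^+ 2) / delta.
    rewrite ler_pdivlMr//.
    have := norm_mul_le_half d delta; have := norm_mul_le_half d1 delta.
    have := sqr_ge0 d; have := sqr_ge0 d1.
    by rewrite !normrM (ger0_norm (ltW d0)); lra.
  have Kk0 : 0 <= K * k t by rewrite mulr_ge0// kE !addr_ge0.
  have h5 : (`|d| + `|d1|) * (K * k t) <= (d ^+ 2 + d1 ^+ 2 + delta ^+ 2) / delta * (K * k t).
    exact: ler_wpM2r.
  have h6 : 0 <= g t * delta ^+ 2 by rewrite mulr_ge0 ?sqr_ge0// /g /coef_norm !addr_ge0.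
  have gE : g t = `|w' t| + `|s' t| + `|Q' t| by [].
  rewrite -gE in h1.
  have eqw : w' t = w t + dw by rewrite /dw; ring.
  have eqs : s' t = s t + ds by rewrite /ds; ring.
  have eqQ : Q' t = Q t + dQ by rewrite /dQ; ring.
  have -> : (2 * g t + 2 * K / delta * k t) * (d ^+ 2 + d1 ^+ 2 + delta ^+ 2) =
     2 * (g t * (d ^+ 2 + d1 ^+ 2)) + 2 * (g t * delta ^+ 2)
     + 2 * ((d ^+ 2 + d1 ^+ 2 + delta ^+ 2) / delta * (K * k t)) by ring.
  rewrite [X in X <= _](_ : _ = 2 * (d * (w' t * d1 - s' t * d) + d1 * (s' t * d1 + Q' t * d))
     + 2 * (d * (dw * Y1 - ds * Y)) + 2 * (d1 * (ds * Y1 + dQ * Y))); last first.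
    by rewrite /dw /ds /dQ; ring.
  lra.
move=> /(_ hA); rewrite e0 e1 !subrr !mul0r add0r !(primitive_a _ _ (lexx a)) !mulr0 addr0 subr0.
have d2 : 0 <= delta ^+ 2 by exact: sqr_ge0.
rewrite add0r -!expr2 => h.
apply: (@le_trans _ _ (delta ^+ 2 * expR (2 * P g x + 2 * K / delta * P k x))).
  by apply: le_trans h; rewrite lerDl.
rewrite ler_wpM2l// ler_expR.
case/andP: xab => ax xb.
have Pmono f : in_L1 f -> (forall t, 0 <= f t) -> P f x <= P f b.
  by move=> hf f0; apply: (prim_mono (prim_primitive hf)) => //; apply: ae_onW.
have h1 : P g x <= P g b by apply: Pmono => // t; rewrite /g /coef_norm !addr_ge0.
have h2 : P k x <= delta.
  by apply: le_trans hd; apply: Pmono => // t; rewrite /k /coef_norm !addr_ge0.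
have h3 : 2 * K / delta * P k x <= 2 * K / delta * delta.
  by rewrite ler_wpM2l// divr_ge0 ?mulr_ge0// ltW.
rewrite divfK ?gt_eqF// in h3; lra.
Qed.

End LinearSystem.

(** * Existence of solutions *)

Section Existence.
Context {R : realType} (a b : R) (ab : a < b).
Local Notation J := (`]a, b[%classic : set R).
Local Notation prim := (prim a b).
Local Notation in_L1 := (in_L1 a b).
Local Notation P := (primitive a b).
Implicit Types (w s Q y z : R -> R).

Lemma geometric_cauchy_lim (u : nat -> R) (M : R) :
  (forall n, `|u n.+1 - u n| <= M / 2 ^+ n) ->
  forall n, `|u n - lim (u @ \oo)| <= 2 * M / 2 ^+ n.
Proof.
move=> hu.
have M0 : 0 <= M by have := le_trans (normr_ge0 _) (hu 0%N); rewrite expr0 divr1.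
have tail n k : `|u (n + k)%N - u n| <= 2 * M / 2 ^+ n.
  suff H : `|u (n + k)%N - u n| <= 2 * M / 2 ^+ n - 2 * M / 2 ^+ (n + k).
    by apply: (le_trans H); rewrite lerBlDr lerDl divr_ge0 ?mulr_ge0 ?exprn_ge0.
  elim: k => [|k IH]; first by rewrite addn0 !subrr normr0.
  have -> : u (n + k.+1)%N - u n = (u (n + k).+1 - u (n + k)%N) + (u (n + k)%N - u n).
    by rewrite addnS; ring.
  apply: (le_trans (ler_normD _ _)).
  have h := hu (n + k)%N.
  have -> : 2 * M / 2 ^+ (n + k.+1) = M / 2 ^+ (n + k).
    by rewrite addnS exprS invfM mulrACA divff// mul1r.
  have -> : 2 * M / 2 ^+ n - M / 2 ^+ (n + k) = M / 2 ^+ (n + k) + (2 * M / 2 ^+ n - 2 * M / 2 ^+ (n + k)).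
    by rewrite -mulrA; ring.
  exact: lerD.
have geo : 2 * M / 2 ^+ n @[n --> \oo] --> (0 : R).
  rewrite [X in _ --> X](_ : 0 = 2 * M * 0); last by rewrite mulr0.
  apply: cvgM; first exact: cvg_cst.
  rewrite (_ : (fun n => (2 ^+ n)^-1) = (fun n => (2^-1) ^+ n)); last first.
    by apply/funext => n; rewrite exprVn.
  by apply: cvg_expr; rewrite ger0_norm// invf_lt1// ltr1n.
have cu : cvg (u @ \oo).
  apply: cauchy_cvg; apply: cauchy_exP => e e0.
  have /cvgrPdist_lt /(_ _ e0) [N _ /(_ N (leqnn N))] := geo.
  rewrite /= sub0r normrN => hN; exists (u N).
  exists N => // n /= Nn; rewrite /ball /= distrC -(subnKC Nn).
  apply: le_lt_trans (tail _ _) _; exact: le_lt_trans (ler_norm _) hN.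
move=> n; rewrite distrC.
have : `|u m - u n| @[m --> \oo] --> `|lim (u @ \oo) - u n|.
  by apply: cvg_norm; apply: cvgB => //; exact: cvg_cst.
move=> /cvg_lim <- //; apply: limr_le.
  apply: is_cvg_norm; apply: is_cvgB => //; exact: is_cvg_cst.
by exists n => // m /= nm; rewrite -(subnKC nm).
Qed.

Section Picard.
Variables (w s Q : R -> R) (hw : in_L1 w) (hs : in_L1 s) (hQ : in_L1 Q).
Variables (c0 c1 : R).

Fixpoint picard (n : nat) : (R -> R) * (R -> R) :=
  if n is n'.+1 then let u := picard n' in
    (fun x => c0 + P (fun t => w t * u.2 t - s t * u.1 t) x,
     fun x => c1 + P (fun t => s t * u.2 t + Q t * u.1 t) x)
  else (fun=> c0, fun=> c1).

Lemma in_L1_mul (f g : R -> R) : in_L1 f -> measurable_fun J g ->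
  (exists C, forall x, J x -> `|g x| <= C) -> in_L1 (fun x => f x * g x).
Proof.
move=> hf mg [C hC].
have := in_L1M mg hC hf; congr in_L1; apply/funext => x; exact: mulrC.
Qed.

Lemma in_L1_mul_ac (f g : R -> R) : in_L1 f -> ac a b g -> in_L1 (fun x => f x * g x).
Proof.
move=> hf acg; apply: in_L1_mul => //; first exact: ac_measurable.
have [C C0 hC] := ac_bounded ab acg; exists C => x.
by rewrite /= in_itv /= => /andP[h1 h2]; apply: hC; rewrite !ltW.
Qed.

Lemma picard_ac n : ac a b (picard n).1 /\ ac a b (picard n).2.
Proof.
elim: n => [|n [h1 h2]] /=; first by split; exact: ac_cst.
split; apply: acD; try exact: ac_cst; apply: ac_primitive.
  by apply: in_L1B; exact: in_L1_mul_ac.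
by apply: in_L1D; exact: in_L1_mul_ac.
Qed.

Lemma picard_L1 n : in_L1 (fun t => w t * (picard n).2 t - s t * (picard n).1 t) /\
  in_L1 (fun t => s t * (picard n).2 t + Q t * (picard n).1 t).
Proof.
have [h1 h2] := picard_ac n.
by split; [apply: in_L1B|apply: in_L1D]; exact: in_L1_mul_ac.
Qed.

Lemma picard_prim n :
  prim (picard n.+1).1 (fun t => w t * (picard n).2 t - s t * (picard n).1 t) /\
  prim (picard n.+1).2 (fun t => s t * (picard n).2 t + Q t * (picard n).1 t).
Proof.
have [h1 h2] := picard_L1 n.
split.
  by apply: prim_ext (primD (prim_cst a b c0) (prim_primitive h1)) => x _; rewrite add0r.
by apply: prim_ext (primD (prim_cst a b c1) (prim_primitive h2)) => x _; rewrite add0r.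
Qed.

Lemma picard_a n : (picard n).1 a = c0 /\ (picard n).2 a = c1.
Proof. by case: n => [|n] //=; rewrite !(primitive_a _ _ (lexx a)) !addr0. Qed.

Let g := coef_norm w s Q.
Let hg : in_L1 g := in_L1_coef_norm hw hs hQ.
Let C := `|c0| + `|c1|.

(* The exponential weight makes the Picard iteration halve the increments. *)
Lemma picard_le n x : a <= x <= b ->
  `|(picard n.+1).1 x - (picard n).1 x| <= C / 2 ^+ n * expR (2 * P g x) /\
  `|(picard n.+1).2 x - (picard n).2 x| <= C / 2 ^+ n * expR (2 * P g x).
Proof.
elim: n x => [|n IH] x /[dup] xab /andP[ax xb].
  rewrite expr0 divr1.
  have hP : C * P g x <= C * expR (2 * P g x).
    rewrite ler_wpM2l ?addr_ge0//.
    have h := expR_ge1Dx (2 * P g x).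
    have : 0 <= P g x.
      have := prim_mono (prim_primitive hg) _ (lexx a) ax xb; rewrite (primitive_a _ _ (lexx a)); apply.
      by apply: ae_onW => t _; rewrite /g /coef_norm !addr_ge0.
    lra.
  have [p1 p2] := picard_prim 0; have [i1 i2] := picard_a 1.
  have E : C * P g x = C * P g x - C * P g a by rewrite (primitive_a _ _ (lexx a)) mulr0 subr0.
  split; apply: le_trans hP.
    rewrite [(picard 0).1 x]/= -[X in _ - X]i1 E.
    apply: (prim_norm_le ab p1 (primZ ab C (prim_primitive hg)) _ (lexx a) ax xb).
    apply: ae_onW => t _ /=; rewrite (le_trans (ler_normB _ _))// !normrM /C /g /coef_norm.
    have := mulr_ge0 (normr_ge0 (w t)) (normr_ge0 c0).
    have := mulr_ge0 (normr_ge0 (s t)) (normr_ge0 c1).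
    have := mulr_ge0 (normr_ge0 (Q t)) (normr_ge0 c1).
    have := mulr_ge0 (normr_ge0 (Q t)) (normr_ge0 c0).
    lra.
  rewrite [(picard 0).2 x]/= -[X in _ - X]i2 E.
  apply: (prim_norm_le ab p2 (primZ ab C (prim_primitive hg)) _ (lexx a) ax xb).
  apply: ae_onW => t _ /=; rewrite (le_trans (ler_normD _ _))// !normrM /C /g /coef_norm.
  have := mulr_ge0 (normr_ge0 (w t)) (normr_ge0 c0).
  have := mulr_ge0 (normr_ge0 (w t)) (normr_ge0 c1).
  have := mulr_ge0 (normr_ge0 (s t)) (normr_ge0 c0).
  have := mulr_ge0 (normr_ge0 (Q t)) (normr_ge0 c1).
  lra.
set K := C / 2 ^+ n.+1.
have KE : C / 2 ^+ n = 2 * K by rewrite /K exprS; field; rewrite expf_neq0.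
have K0 : 0 <= K by rewrite divr_ge0 ?addr_ge0 ?exprn_ge0.
(* The derivative of K e^(2 P g) is 2 K g e^(2 P g): the factor 2 in the exponent is what turns the
   bound [2 * K] of the previous increment into [K]. *)
have hE := primZ ab K (prim_expR ab (primZ ab 2 (prim_primitive hg))).
have [p1 p2] := picard_prim n; have [q1 q2] := picard_prim n.+1.
have [i1 i2] := picard_a n.+1; have [j1 j2] := picard_a n.+2.
have E0 : K * expR (2 * P g x) - K * expR (2 * P g a) <= K * expR (2 * P g x).
  by rewrite gerBl mulr_ge0 ?expR_ge0.
have bnd t : J t -> forall A B : R,
    `|A| + `|B| <= g t -> `|A * ((picard n.+1).2 t - (picard n).2 t)
     + B * ((picard n.+1).1 t - (picard n).1 t)|
     <= K * (2 * g t * expR (2 * P g t)).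
  rewrite /= in_itv /= => /andP[/ltW at_ /ltW tb] A B hAB.
  have [|I1 I2] := IH t; first by rewrite at_.
  apply: (le_trans (ler_normD _ _)); rewrite !normrM.
  rewrite KE in I1 I2.
  apply: (le_trans (lerD (ler_wpM2l (normr_ge0 A) I2) (ler_wpM2l (normr_ge0 B) I1))).
  have := ler_wpM2r (mulr_ge0 K0 (expR_ge0 (2 * P g t))) hAB.
  clear; move: K (g t) (expR _) `|A| `|B| => k h x u v; lra.
split; apply: le_trans E0.
  have := prim_norm_le ab (primB ab q1 p1) hE _ (lexx a) ax xb.
  rewrite i1 j1 subrr subr0; apply.
  apply: ae_onW => t Jt.
  rewrite (_ : _ - _ = w t * ((picard n.+1).2 t - (picard n).2 t)
     + (- s t) * ((picard n.+1).1 t - (picard n).1 t)); last by ring.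
  by apply: bnd => //; rewrite normrN /g /coef_norm lerDl.
have := prim_norm_le ab (primB ab q2 p2) hE _ (lexx a) ax xb.
rewrite i2 j2 subrr subr0; apply.
apply: ae_onW => t Jt.
rewrite (_ : _ - _ = s t * ((picard n.+1).2 t - (picard n).2 t)
     + Q t * ((picard n.+1).1 t - (picard n).1 t)); last by ring.
by apply: bnd => //; rewrite /g /coef_norm -addrA lerDr.
Qed.

End Picard.

(** The Picard iterates converge uniformly at a geometric rate. Their limit [(v1, v2)] is at first
    just a pair of functions; the pair [(y1, y2)] obtained by integrating the right-hand side at
    this limit is absolutely continuous and turns out to agree with it on [a, b]. *)
Lemma sol_exists w s Q c0 c1 : in_L1 w -> in_L1 s -> in_L1 Q ->
  exists yy : (R -> R) * (R -> R),
    [/\ sol a b w s Q yy.1 yy.2, yy.1 a = c0 & yy.2 a = c1].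
Proof.
move=> hw hs hQ.
pose u := picard w s Q c0 c1; pose g := coef_norm w s Q.
pose M := (`|c0| + `|c1|) * expR (2 * P g b).
have hg : in_L1 g by exact: in_L1_coef_norm.
have g0 t : 0 <= g t by rewrite /g /coef_norm !addr_ge0.
have uM x : a <= x <= b -> (forall n, `|(u n.+1).1 x - (u n).1 x| <= M / 2 ^+ n) /\
   (forall n, `|(u n.+1).2 x - (u n).2 x| <= M / 2 ^+ n).
  move=> /[dup] xab /andP[ax xb].
  have h n : (`|c0| + `|c1|) / 2 ^+ n * expR (2 * P g x) <= M / 2 ^+ n.
    rewrite /M mulrAC; apply: ler_wpM2r; first by rewrite invr_ge0 exprn_ge0.
    apply: ler_wpM2l; first by rewrite addr_ge0.
    rewrite ler_expR; apply: ler_wpM2l; first by [].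
    by apply: (prim_mono (prim_primitive hg)) => //; apply: ae_onW.
  by split=> n; have [h1 h2] := picard_le hw hs hQ c0 c1 n xab;
     apply: le_trans (h n).
pose v1 x := lim ((u n).1 x @[n --> \oo]); pose v2 x := lim ((u n).2 x @[n --> \oo]).
have v1E x : a <= x <= b -> forall n, `|(u n).1 x - v1 x| <= 2 * M / 2 ^+ n.
  by move=> xab; apply: (@geometric_cauchy_lim (fun n => (u n).1 x)); case: (uM x xab).
have v2E x : a <= x <= b -> forall n, `|(u n).2 x - v2 x| <= 2 * M / 2 ^+ n.
  by move=> xab; apply: (@geometric_cauchy_lim (fun n => (u n).2 x)); case: (uM x xab).
have geo : 2 * M / 2 ^+ n @[n --> \oo] --> (0 : R).
  rewrite [X in _ --> X](_ : 0 = 2 * M * 0); last by rewrite mulr0.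
  apply: cvgM; first exact: cvg_cst.
  rewrite (_ : (fun n => (2 ^+ n)^-1) = (fun n => (2^-1) ^+ n)); last first.
    by apply/funext => n; rewrite exprVn.
  by apply: cvg_expr; rewrite ger0_norm// invf_lt1// ltr1n.
have Jab x : J x -> a <= x <= b.
  by rewrite /= in_itv /= => /andP[h1 h2]; rewrite !ltW.
have lim0 (f : nat -> R) l : (forall n, `|f n - l| <= 2 * M / 2 ^+ n) ->
    f n @[n --> \oo] --> l.
  move=> hf; apply/cvgrPdist_le => e e0; move/cvgrPdist_le : geo => /(_ _ e0).
  apply: filterS => n; rewrite sub0r normrN distrC => h.
  exact: le_trans (hf n) (le_trans (ler_norm _) h).
(* The limits are measurable and bounded on J, so their products with the coefficients are
   integrable. *)
have L1v (v : R -> R) (p : nat -> R -> R) (f : R -> R) : in_L1 f ->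
    (forall n, ac a b (p n)) ->
    (forall x, a <= x <= b -> forall n, `|p n x - v x| <= 2 * M / 2 ^+ n) ->
    in_L1 (fun x => f x * v x).
  move=> hf hp pv; apply: in_L1_mul => //.
    apply: (@measurable_fun_cvg _ _ _ _ p).
      by move=> n; exact: ac_measurable.
    by move=> x /Jab xab; apply: lim0; exact: pv.
  have [C C0 hC] := ac_bounded ab (hp 0%N).
  exists (C + 2 * M) => x /Jab xab.
  have := pv _ xab 0%N; rewrite expr0 divr1 distrC => h.
  rewrite -[v x](subrK (p 0%N x)) (le_trans (ler_normD _ _))// addrC.
  by rewrite lerD// hC.
have ac1 n : ac a b (u n).1 by case: (picard_ac hw hs hQ c0 c1 n).
have ac2 n : ac a b (u n).2 by case: (picard_ac hw hs hQ c0 c1 n).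
have L1 : in_L1 (fun t => w t * v2 t - s t * v1 t).
  by apply: in_L1B; [exact: L1v ac2 v2E|exact: L1v ac1 v1E].
have L2 : in_L1 (fun t => s t * v2 t + Q t * v1 t).
  by apply: in_L1D; [exact: L1v ac2 v2E|exact: L1v ac1 v1E].
pose y1 x := c0 + P (fun t => w t * v2 t - s t * v1 t) x.
pose y2 x := c1 + P (fun t => s t * v2 t + Q t * v1 t) x.
have p1 := primD (prim_cst a b c0) (prim_primitive L1).
have p2 := primD (prim_cst a b c1) (prim_primitive L2).
have geoP : 2 * M / 2 ^+ n * P g b @[n --> \oo] --> (0 : R).
  rewrite [X in _ --> X](_ : 0 = 0 * P g b); last by rewrite mul0r.
  by apply: cvgM => //; exact: cvg_cst.
have close (y v : R -> R) (p : nat -> R -> R) x : a <= x <= b ->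
    (forall n, `|p n x - v x| <= 2 * M / 2 ^+ n) ->
    (forall n, `|p n.+1 x - y x| <= 2 * M / 2 ^+ n * P g b) -> y x = v x.
  move=> xab hv hy.
  have h1 : p n.+1 x @[n --> \oo] --> v x.
    by have /lim0 := hv; rewrite -cvg_shiftS.
  have h2 : p n.+1 x @[n --> \oo] --> y x.
    apply/cvgrPdist_le => e e0; move/cvgrPdist_le : geoP => /(_ _ e0).
    apply: filterS => n; rewrite sub0r normrN distrC => h.
    exact: le_trans (hy n) (le_trans (ler_norm _) h).
  exact: (cvg_unique _ h2 h1).
have bnd n t : J t -> forall A B : R,
    `|A| + `|B| <= g t -> `|A * ((u n).2 t - v2 t) + B * ((u n).1 t - v1 t)|
     <= 2 * M / 2 ^+ n * g t.
  move=> /Jab tab A B hAB.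
  apply: (le_trans (ler_normD _ _)); rewrite !normrM.
  have I2 := v2E _ tab n; have I1 := v1E _ tab n.
  apply: (le_trans (lerD (ler_wpM2l (normr_ge0 A) I2) (ler_wpM2l (normr_ge0 B) I1))).
  have K0 := le_trans (normr_ge0 _) I1.
  have := ler_wpM2r K0 hAB; lra.
have Pmono x : a <= x <= b -> P g x <= P g b.
  by move=> /andP[ax xb]; apply: (prim_mono (prim_primitive hg)) => //; apply: ae_onW.
have e1 x : a <= x <= b -> y1 x = v1 x.
  move=> /[dup] xab /andP[ax xb].
  apply: (close y1 v1 (fun n => (u n).1)) (v1E x xab) _ => // n.
  have K0 := le_trans (normr_ge0 _) (v1E _ xab n).
  have [q _] := picard_prim hw hs hQ c0 c1 n.
  have [i1 _] := picard_a w s Q c0 c1 n.+1.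
  have := prim_norm_le ab (primB ab q p1) (primZ ab (2 * M / 2 ^+ n) (prim_primitive hg)) _ (lexx a) ax xb.
  rewrite i1 !(primitive_a _ _ (lexx a)) addr0 subrr subr0 mulr0 subr0 => H.
  apply: le_trans (ler_wpM2l K0 (Pmono _ xab)); apply: H.
  apply: ae_onW => t Jt.
  rewrite (_ : _ - _ = w t * ((u n).2 t - v2 t) + (- s t) * ((u n).1 t - v1 t)); last by rewrite /u; ring.
  by apply: bnd => //; rewrite normrN /g /coef_norm lerDl.
have e2 x : a <= x <= b -> y2 x = v2 x.
  move=> /[dup] xab /andP[ax xb].
  apply: (close y2 v2 (fun n => (u n).2)) (v2E x xab) _ => // n.
  have K0 := le_trans (normr_ge0 _) (v1E _ xab n).
  have [_ q] := picard_prim hw hs hQ c0 c1 n.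
  have [_ i1] := picard_a w s Q c0 c1 n.+1.
  have := prim_norm_le ab (primB ab q p2) (primZ ab (2 * M / 2 ^+ n) (prim_primitive hg)) _ (lexx a) ax xb.
  rewrite i1 !(primitive_a _ _ (lexx a)) addr0 subrr subr0 mulr0 subr0 => H.
  apply: le_trans (ler_wpM2l K0 (Pmono _ xab)); apply: H.
  apply: ae_onW => t Jt.
  rewrite (_ : _ - _ = s t * ((u n).2 t - v2 t) + Q t * ((u n).1 t - v1 t)); last by rewrite /u; ring.
  by apply: bnd => //; rewrite /g /coef_norm -addrA lerDr.
exists (y1, y2); split => /=; last 2 first.
- by rewrite /y1 (primitive_a _ _ (lexx a)) addr0.
- by rewrite /y2 (primitive_a _ _ (lexx a)) addr0.
split.
  by apply: prim_ext p1 => x /Jab xab; rewrite add0r e1// e2.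
by apply: prim_ext p2 => x /Jab xab; rewrite add0r e1// e2.
Qed.

End Existence.

(** * Zeros of the characteristic function *)

Section LocalCount.
Context {R : realType}.

(** The index tends to infinity jointly with three spectral parameters tending to [l0]; three,
    because three zeros near a double eigenvalue have to be excluded. As a filter it makes limits of
    polynomials in the data available through [cvgD] and [cvgM]. *)
Definition near_pt l0 : set_system (nat * (R * R * R)) :=
  [set S | exists2 d : R, 0 < d & exists N, forall m l1 l2 l3, (N <= m)%N ->
     `|l1 - l0| < d -> `|l2 - l0| < d -> `|l3 - l0| < d -> S (m, (l1, l2, l3))].

#[local] Instance near_pt_filter l0 : Filter (near_pt l0).
Proof.
split.
- by exists 1 => //; exists 0%N.
- move=> A B [d1 d10 [N1 h1]] [d2 d20 [N2 h2]].
  exists (Num.min d1 d2); first by rewrite lt_min d10.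
  exists (maxn N1 N2) => m l1 l2 l3; rewrite geq_max => /andP[m1 m2].
  rewrite !lt_min => /andP[a1 a2] /andP[b1 b2] /andP[c1 c2].
  by split; [apply: h1|apply: h2].
- move=> A B AB [d d0 [N h1]]; exists d => //; exists N => m l1 l2 l3 mN a1 a2 a3.
  exact/AB/h1.
Qed.

Definition tends l0 (h : nat -> R -> R -> R) (c : R) : Prop :=
  forall e, 0 < e -> exists2 d : R, 0 < d & exists N, forall m l1 l2, (N <= m)%N ->
     `|l1 - l0| < d -> `|l2 - l0| < d -> `|h m l1 l2 - c| < e.

Lemma tends12 l0 h c : tends l0 h c ->
  h z.1 z.2.1.1 z.2.1.2 @[z --> near_pt l0] --> c.
Proof.
move=> H; apply/cvgrPdist_lt => e /H[d d0 [N hN]]; exists d => //; exists N => m l1 l2 l3 *.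
by rewrite distrC; apply: hN.
Qed.

Lemma tends13 l0 h c : tends l0 h c ->
  h z.1 z.2.1.1 z.2.2 @[z --> near_pt l0] --> c.
Proof.
move=> H; apply/cvgrPdist_lt => e /H[d d0 [N hN]]; exists d => //; exists N => m l1 l2 l3 *.
by rewrite distrC; apply: hN.
Qed.

Lemma tends23 l0 h c : tends l0 h c ->
  h z.1 z.2.1.2 z.2.2 @[z --> near_pt l0] --> c.
Proof.
move=> H; apply/cvgrPdist_lt => e /H[d d0 [N hN]]; exists d => //; exists N => m l1 l2 l3 *.
by rewrite distrC; apply: hN.
Qed.

(* [f] is the fundamental matrix at the right end point as a function of the
   spectral parameter, [g l' l] the Gram matrix of its columns. *)
Record fund_data := FundData {
  f11 : R -> R; f12 : R -> R; f21 : R -> R; f22 : R -> R;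
  g11 : R -> R -> R; g12 : R -> R -> R; g21 : R -> R -> R; g22 : R -> R -> R }.

(* The second part is Lagrange's identity in the form
   F(l) = F(k) (1 - (l - k) E G(k, l)). *)
Definition lagrange (D : fund_data) : Prop :=
  (forall l, f11 D l * f22 D l - f12 D l * f21 D l = 1) /\
  forall k l, [/\ f11 D l = f11 D k + (l - k) * (f11 D k * g21 D k l - f12 D k * g11 D k l),
    f12 D l = f12 D k + (l - k) * (f11 D k * g22 D k l - f12 D k * g12 D k l),
    f21 D l = f21 D k + (l - k) * (f21 D k * g21 D k l - f22 D k * g11 D k l) &
    f22 D l = f22 D k + (l - k) * (f21 D k * g22 D k l - f22 D k * g12 D k l)].

Definition fund_data_cvg (D : nat -> fund_data) (L : fund_data) l0 : Prop :=
  [/\ tends l0 (fun m l _ => f11 (D m) l) (f11 L l0),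
    tends l0 (fun m l _ => f12 (D m) l) (f12 L l0),
    tends l0 (fun m l _ => f21 (D m) l) (f21 L l0) &
    tends l0 (fun m l _ => f22 (D m) l) (f22 L l0)] /\
  [/\ tends l0 (fun m => g11 (D m)) (g11 L l0 l0),
    tends l0 (fun m => g12 (D m)) (g12 L l0 l0),
    tends l0 (fun m => g21 (D m)) (g21 L l0 l0) &
    tends l0 (fun m => g22 (D m)) (g22 L l0 l0)].

Definition gram_pos (L : fund_data) l0 : Prop :=
  [/\ g12 L l0 l0 = g21 L l0 l0, 0 < g11 L l0 l0, 0 < g22 L l0 l0 &
      0 < g11 L l0 l0 * g22 L l0 l0 - g12 L l0 l0 ^+ 2].

Definition fund_data_continuous (D : fund_data) : Prop :=
  [/\ continuous (f11 D), continuous (f12 D), continuous (f21 D) & continuous (f22 D)].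

Section Boundary.
Variables (d0 p11 p12 p21 p22 : R).

(* [x11 .. x22] are the entries of X = P F for a real matrix P. For a suitable
   choice of P and [d0], [charfun] = d0 + tr X is det (A + B F) up to a nonzero
   constant, and X is scalar at the eigenvalues of multiplicity two. *)
Definition x11 D l := p11 * f11 D l + p12 * f21 D l.
Definition x12 D l := p11 * f12 D l + p12 * f22 D l.
Definition x21 D l := p21 * f11 D l + p22 * f21 D l.
Definition x22 D l := p21 * f12 D l + p22 * f22 D l.
Definition charfun D l := d0 + x11 D l + x22 D l.
Definition scalarx D l := [/\ x12 D l = 0, x21 D l = 0 & x11 D l = x22 D l].
(** The trace of - X(k) E G(k, l), which by Lagrange's identity is the difference quotient of
    [charfun] between [k] and [l]. *)
Definition slope D k l :=
  x11 D k * g21 D k l - x12 D k * g11 D k l + x21 D k * g22 D k l - x22 D k * g12 D k l.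

Lemma charfun_diff D k l : lagrange D -> charfun D l - charfun D k = (l - k) * slope D k l.
Proof.
move=> [_ /(_ k l)[e1 e2 e3 e4]].
rewrite /charfun /slope /x11 /x12 /x21 /x22 e1 e2 e3 e4; ring.
Qed.

Lemma x_rel D k l : lagrange D ->
  [/\ x11 D l = x11 D k + (l - k) * (x11 D k * g21 D k l - x12 D k * g11 D k l),
      x12 D l = x12 D k + (l - k) * (x11 D k * g22 D k l - x12 D k * g12 D k l),
      x21 D l = x21 D k + (l - k) * (x21 D k * g21 D k l - x22 D k * g11 D k l) &
      x22 D l = x22 D k + (l - k) * (x21 D k * g22 D k l - x22 D k * g12 D k l)].
Proof.
move=> [_ /(_ k l)[e1 e2 e3 e4]].
by split; rewrite /x11 /x12 /x21 /x22 ?e1 ?e2 ?e3 ?e4; ring.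
Qed.

Lemma x_det D l : lagrange D ->
  x11 D l * x22 D l - x12 D l * x21 D l = p11 * p22 - p12 * p21.
Proof.
move=> [/(_ l) e _]; rewrite -[RHS]mulr1 -e /x11 /x12 /x21 /x22; ring.
Qed.

Lemma x_cvg (D : nat -> fund_data) L l0 : fund_data_cvg D L l0 ->
  [/\ x11 (D z.1) z.2.1.1 @[z --> near_pt l0] --> x11 L l0,
   x12 (D z.1) z.2.1.1 @[z --> near_pt l0] --> x12 L l0,
   x21 (D z.1) z.2.1.1 @[z --> near_pt l0] --> x21 L l0 &
   x22 (D z.1) z.2.1.1 @[z --> near_pt l0] --> x22 L l0].
Proof.
move=> [[/tends12 h1 /tends12 h2 /tends12 h3 /tends12 h4] _].
by split; apply: cvgD; apply: cvgM => //; exact: cvg_cst.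
Qed.

Lemma charfun_cvg D L l0 : fund_data_cvg D L l0 ->
  charfun (D z.1) z.2.1.1 @[z --> near_pt l0] --> charfun L l0.
Proof.
move=> /x_cvg[h1 h2 h3 h4]; apply: cvgD => //; apply: cvgD => //; exact: cvg_cst.
Qed.

Lemma slope_cvg D L l0 : fund_data_cvg D L l0 ->
  slope (D z.1) z.2.1.1 z.2.1.2 @[z --> near_pt l0] --> slope L l0 l0.
Proof.
move=> /[dup] /x_cvg[h1 h2 h3 h4] [_ [/tends12 i1 /tends12 i2 /tends12 i3 /tends12 i4]].
by apply: cvgB; [apply: cvgD; [apply: cvgB|]|]; apply: cvgM.
Qed.

Lemma charfun_continuous D : fund_data_continuous D -> continuous (charfun D).
Proof.
move=> [h1 h2 h3 h4] l; apply: cvgD; [apply: cvgD; [exact: cvg_cst|]|];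
  by apply: cvgD; apply: cvgM; first [exact: cvg_cst|exact: h1|exact: h2|exact: h3|exact: h4].
Qed.

(** For coupled boundary conditions this reads 4 (Re ka)^2 <= 4 with |ka| = 1; for separated ones
    both sides are 0. As det X = det P, it says at a zero of [charfun] that the discriminant of X is
    nonpositive. *)
Hypothesis hdet : d0 ^+ 2 <= 4 * (p11 * p22 - p12 * p21).

(* The symmetric part of [X E] is semidefinite by [hdet], so its pairing with a
   positive definite matrix vanishes only if it is zero. *)
Lemma slope_neq0 L l0 : lagrange L -> gram_pos L l0 -> charfun L l0 = 0 ->
  ~ scalarx L l0 -> slope L l0 l0 != 0.
Proof.
move=> hL [gs ga gb gd] dz ns; apply/eqP => kz; apply: ns.
have hdx := x_det l0 hL.
move: dz kz; rewrite /charfun /slope /scalarx -gs.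
move: hdet; rewrite -hdx.
set a := x11 L l0; set b := x12 L l0; set c := x21 L l0; set d := x22 L l0.
move: ga gb gd; set A := g11 L l0 l0; set B := g22 L l0 l0; set C := g12 L l0 l0.
move=> A0 B0 D0 h1 h2 h3.
have h4 : (a - d) ^+ 2 + 4 * (b * c) <= 0.
  have -> : (a - d) ^+ 2 + 4 * (b * c) = d0 ^+ 2 - 4 * (a * d - b * c)
    + (a + d - d0) * (d0 + a + d) by ring.
  by rewrite h2 mulr0 addr0 subr_le0.
have bc0 : b * c <= 0 by have := sqr_ge0 (a - d); lra.
have e : c * B - b * A = (d - a) * C by lra.
(* Both terms on the left are nonnegative, because [b * c <= 0], while the right-hand side is
   nonpositive by [h4]; so everything vanishes. *)
have h5 : (c * B + b * A) ^+ 2 - 4 * (b * c) * (A * B - C ^+ 2)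
   = C ^+ 2 * ((a - d) ^+ 2 + 4 * (b * c)).
  have -> : (c * B + b * A) ^+ 2 = (c * B - b * A) ^+ 2 + 4 * (b * c) * (A * B) by ring.
  by rewrite e; ring.
have h6 : 0 <= - (4 * (b * c)) * (A * B - C ^+ 2).
  by apply: mulr_ge0; [lra|exact: ltW].
have h7 : C ^+ 2 * ((a - d) ^+ 2 + 4 * (b * c)) <= 0.
  by rewrite mulr_ge0_le0// sqr_ge0.
have h8 := sqr_ge0 (c * B + b * A).
have h9 : b * c = 0.
  have : - (4 * (b * c)) * (A * B - C ^+ 2) = 0 by lra.
  by move=> /eqP; rewrite mulf_eq0 (gt_eqF D0) orbF => /eqP; lra.
have h10 : a = d.
  have : (a - d) ^+ 2 = 0 by have := sqr_ge0 (a - d); lra.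
  by move=> /eqP; rewrite sqrf_eq0 subr_eq0 => /eqP.
have h11 : c * B = b * A by move: e; rewrite h10 subrr mul0r; lra.
have b0 : b = 0.
  have : b ^+ 2 * A = 0 by rewrite expr2 -mulrA -h11 mulrA h9 mul0r.
  by move=> /eqP; rewrite mulf_eq0 sqrf_eq0 (gt_eqF A0) orbF => /eqP.
split => //; move: h11; rewrite b0 mul0r => /eqP.
by rewrite mulf_eq0 (gt_eqF B0) orbF => /eqP.
Qed.

(** * Upper bounds for the number of zeros near a point *)

Lemma charfun_neq0_near D L l0 : fund_data_cvg D L l0 -> charfun L l0 != 0 ->
  exists2 e, 0 < e & \forall m \near \oo, forall l, `|l - l0| < e -> charfun (D m) l != 0.
Proof.
move=> /charfun_cvg h /(cvgr_neq0 _ h)[e e0 [N hN]]; exists e => //.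
by exists N => // m /= Nm l le; apply: (hN m l l l).
Qed.

(** Two distinct zeros would make the difference quotient [slope] vanish, but near [l0] it is close
    to the nonzero [slope L l0 l0]. Not being scalar is an open condition. *)
Lemma charfun_simple_zero_unique D L l0 : (forall m, lagrange (D m)) -> lagrange L -> gram_pos L l0 ->
  fund_data_cvg D L l0 -> charfun L l0 = 0 -> ~ scalarx L l0 ->
  exists2 e, 0 < e & \forall m \near \oo,
   (forall l l', `|l - l0| < e -> `|l' - l0| < e ->
     charfun (D m) l = 0 -> charfun (D m) l' = 0 -> l = l') /\
   (forall l, `|l - l0| < e -> ~ scalarx (D m) l).
Proof.
move=> hD hL gL cD dz ns.
have [e1 e10 [N1 h1]] := cvgr_neq0 _ (slope_cvg cD) (slope_neq0 hL gL dz ns).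
have [c1 c2 c3 c4] := x_cvg cD.
have [e2 e20 [N2 h2]] : near_pt l0 [set z | ~ scalarx (D z.1) z.2.1.1].
  have [x120|/eqP x12n] := eqVneq (x12 L l0) 0; last first.
    by apply: filterS (cvgr_neq0 _ c2 (introN eqP x12n)) => z /eqP z0 [].
  have [x210|/eqP x21n] := eqVneq (x21 L l0) 0; last first.
    by apply: filterS (cvgr_neq0 _ c3 (introN eqP x21n)) => z /eqP z0 [].
  have xx : x11 L l0 - x22 L l0 != 0.
    by rewrite subr_eq0; apply/eqP => xx; apply: ns.
  apply: filterS (cvgr_neq0 _ (cvgB c1 c4) xx) => z /eqP z0 [_ _ z1].
  by apply: z0; apply/eqP; rewrite subr_eq0; apply/eqP.
exists (Num.min e1 e2); first by rewrite lt_min e10.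
exists (maxn N1 N2) => // m /=; rewrite geq_max => /andP[m1 m2]; split.
  move=> l l'; rewrite !lt_min => /andP[l1 l2] /andP[l1' l2'] dl dl'.
  have := charfun_diff l l' (hD m); rewrite dl dl' subrr => /esym/eqP.
  rewrite mulf_eq0 (negbTE (h1 m l l' l m1 l1 l1' l1)) orbF subr_eq0.
  by move=> /eqP.
by move=> l; rewrite lt_min => /andP[_ l2]; exact: (h2 m l l l m2 l2 l2 l2).
Qed.

(** Here X(l) = x (1 - h E G) with h = l - k. Equality of det X(l) and det X(k) forces [g21 - g12]
    to be - h det G, which makes the a priori linear expression for [charfun] quadratic in h, with a
    fixed sign on both sides of [k]. *)
Lemma charfun_scalar D k l : lagrange D -> charfun D k = 0 -> scalarx D k ->
  x11 D k != 0 -> 0 < g11 D k l * g22 D k l - g12 D k l * g21 D k l -> k != l ->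
  charfun D l = - x11 D k * (l - k) ^+ 2 * (g11 D k l * g22 D k l - g12 D k l * g21 D k l).
Proof.
move=> hD dk [s1 s2 s3] x0 gd kl.
have := x_det l hD; rewrite -(x_det k hD); have [e1 e2 e3 e4] := x_rel k l hD.
rewrite e1 e2 e3 e4 s1 s2 -s3 !mul0r !subr0 !add0r.
have := charfun_diff k l hD; rewrite dk subr0 /slope s1 s2 -s3 => ->.
set x := x11 D k in x0 *; set h := l - k.
have h0 : h != 0 by rewrite subr_eq0 eq_sym.
move=> H.
have H' : h * (x * x) * (g21 D k l - g12 D k l +
   h * (g11 D k l * g22 D k l - g12 D k l * g21 D k l)) = 0.
  by rewrite -(subrr (x * x)) -[X in _ = X - _]H; ring.
move: H' => /eqP; rewrite !mulf_eq0 (negbTE h0) (negbTE x0) /= => /eqP H'.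
set T := g11 D k l * g22 D k l - g12 D k l * g21 D k l in H' *.
transitivity (x * h * ((g21 D k l - g12 D k l + h * T) - h * T)); first by ring.
by rewrite H'; ring.
Qed.

(** Trace and determinant make [x] a double eigenvalue of the matrix, so it has an eigenvector. *)
Lemma kernel_vector (a b c d x : R) : a * d - b * c = x ^+ 2 -> a + d = 2 * x ->
  exists u v : R, [/\ (u, v) != (0, 0), a * u + b * v = x * u & c * u + d * v = x * v].
Proof.
move=> hdet' tr.
have [b0|bn] := eqVneq b 0.
  have aE : a = x.
    have : (a - x) ^+ 2 = 0.
      have -> : (a - x) ^+ 2 = x ^+ 2 - (a * d - b * c) - a * (2 * x - (a + d)) - b * c by ring.
      by rewrite hdet' tr b0 !subrr mulr0 mul0r !subr0.
    by move=> /eqP; rewrite sqrf_eq0 subr_eq0 => /eqP.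
  have dE : d = x by lra.
  have [c0|cn] := eqVneq c 0.
    exists 1, 0; rewrite aE dE b0 c0; split; try ring.
    by rewrite xpair_eqE oner_eq0.
  exists 0, 1; rewrite aE dE b0; split; try ring.
  by rewrite xpair_eqE oner_eq0 andbF.
exists b, (x - a); split; try ring.
  by rewrite xpair_eqE (negbTE bn).
have -> : c * b = a * d - x ^+ 2 by rewrite -hdet'; ring.
by have -> : d = 2 * x - a by [lra]; ring.
Qed.

(** Eigenfunctions for distinct eigenvalues are orthogonal in L^2_r, expressed through initial
    values and the Gram matrix. By Lagrange's identity, x times the second vector is X(k) (1 - h E
    G) applied to it; taking the determinant with X(k) applied to the first vector and cancelling
    det X(k) = x^2 leaves h times the pairing. *)
Lemma kernel_orthogonal D k l x u v u' v' : lagrange D -> x != 0 ->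
  p11 * p22 - p12 * p21 = x ^+ 2 -> k != l ->
  x11 D k * u + x12 D k * v = x * u -> x21 D k * u + x22 D k * v = x * v ->
  x11 D l * u' + x12 D l * v' = x * u' -> x21 D l * u' + x22 D l * v' = x * v' ->
  u * (g11 D k l * u' + g12 D k l * v') + v * (g21 D k l * u' + g22 D k l * v') = 0.
Proof.
move=> hD x0 hP kl h1 h2 h3 h4.
have := x_det k hD; rewrite hP => hx.
have [e1 e2 e3 e4] := x_rel k l hD; rewrite e1 e2 in h3; rewrite e3 e4 in h4.
set h := l - k in h3 h4 e1 e2 e3 e4.
have h0 : h != 0 by rewrite subr_eq0 eq_sym.
apply/eqP; rewrite -(mulrI_eq0 _ (lregP h0)) -(mulrI_eq0 _ (lregP (expf_neq0 2 x0))).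
apply/eqP.
set q := u * _ + _.
have E : x ^+ 2 * (u * v' - v * u') = (x11 D k * u + x12 D k * v) * (x * v')
   - (x21 D k * u + x22 D k * v) * (x * u') by rewrite h1 h2; ring.
rewrite -{}h3 -{}h4 in E.
have : x ^+ 2 * (u * v' - v * u') - (x11 D k * x22 D k - x12 D k * x21 D k) *
  (u * v' - v * u') = - (x11 D k * x22 D k - x12 D k * x21 D k) * (h * q).
  by rewrite E /q; ring.
by rewrite hx subrr mulNr => /esym/eqP; rewrite oppr_eq0 => /eqP; rewrite mulrCA => <-; ring.
Qed.

Lemma scalar_x L l0 : lagrange L -> charfun L l0 = 0 -> scalarx L l0 ->
  p11 * p22 - p12 * p21 = x11 L l0 ^+ 2 /\ d0 = - (2 * x11 L l0).
Proof.
move=> hL dz [s1 s2 s3]; split.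
  by rewrite -(x_det l0 hL) s1 -s3 mul0r subr0 expr2.
by move: dz; rewrite /charfun -s3; lra.
Qed.

Lemma posdef_form_neq0 (al be ga u v : R) : 0 < al -> 0 < 4 * al * ga - be ^+ 2 ->
  (u, v) != (0, 0) -> al * u ^+ 2 + be * (u * v) + ga * v ^+ 2 != 0.
Proof.
move=> al0 disc uv; apply/eqP => h; move/negP: uv; apply.
have : (2 * al * u + be * v) ^+ 2 + (4 * al * ga - be ^+ 2) * v ^+ 2 = 0.
  by rewrite -[RHS](mulr0 (4 * al)) -h; ring.
have h1 := sqr_ge0 (2 * al * u + be * v).
have h2 : 0 <= (4 * al * ga - be ^+ 2) * v ^+ 2 by rewrite mulr_ge0 ?sqr_ge0// ltW.
move=> h3.
have : (4 * al * ga - be ^+ 2) * v ^+ 2 = 0 by lra.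
move=> /eqP; rewrite mulf_eq0 sqrf_eq0 (gt_eqF disc) /= => /eqP v0.
move: h; rewrite v0 mulr0 expr0n /= !mulr0 !addr0 => /eqP.
by rewrite mulf_eq0 sqrf_eq0 (gt_eqF al0) /= => /eqP ->.
Qed.

Lemma orthogonal_multiple (s t u v : R) : (s, t) != (0, 0) -> s * u + t * v = 0 ->
  exists m, u = m * - t /\ v = m * s.
Proof.
rewrite xpair_eqE negb_and => /orP[s0|t0] h.
  exists (v / s); split; last by rewrite divfK.
  apply: (mulfI s0); have -> : s * (v / s * - t) = - (t * v) by field.
  lra.
exists (- u / t); split; first by field.
apply: (mulfI t0); have -> : t * (- u / t * s) = - (s * u) by field.
lra.
Qed.

(* Three zeros of [charfun] would provide three vectors of the plane that are
   pairwise orthogonal for nearly the same positive definite form. *)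
Lemma charfun_double_zero_le2 D L l0 : (forall m, lagrange (D m)) -> lagrange L -> gram_pos L l0 ->
  fund_data_cvg D L l0 -> charfun L l0 = 0 -> scalarx L l0 -> x11 L l0 != 0 ->
  exists2 e, 0 < e & \forall m \near \oo,
   (forall l1 l2 l3, `|l1 - l0| < e -> `|l2 - l0| < e -> `|l3 - l0| < e ->
     l1 != l2 -> l1 != l3 -> l2 != l3 ->
     charfun (D m) l1 = 0 -> charfun (D m) l2 = 0 -> charfun (D m) l3 = 0 -> False) /\
   (forall l l', `|l - l0| < e -> `|l' - l0| < e -> l != l' ->
     charfun (D m) l = 0 -> scalarx (D m) l -> charfun (D m) l' != 0).
Proof.
move=> hD hL [gs ga gb gd] cD dz sc x0.
have [hP hd0] := scalar_x hL dz sc.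
have [_ [t11 t12 t21 t22]] := cD.
pose G f (z : nat * (R * R * R)) : R := f (D z.1) z.2.1.1 z.2.1.2.
pose G' f (z : nat * (R * R * R)) : R := f (D z.1) z.2.1.1 z.2.2.
pose H f (z : nat * (R * R * R)) : R := f (D z.1) z.2.1.2 z.2.2.
(* The second and third vectors are multiples of the first one after the transposes of G(l1, l2) and
   G(l1, l3) and a rotation by a right angle. Inserted into their own orthogonality relation, this
   gives a quadratic form in [(u1, v1)] with coefficients [al], [be], [gam]. Its limit is det G(l0,
   l0) times the form of G(l0, l0), hence positive definite. *)
pose al z := G g12 z * G' g12 z * H g11 z - G g12 z * G' g11 z * H g12 z
  - G g11 z * G' g12 z * H g21 z + G g11 z * G' g11 z * H g22 z.
pose gam z := G g22 z * G' g22 z * H g11 z - G g22 z * G' g21 z * H g12 z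
  - G g21 z * G' g22 z * H g21 z + G g21 z * G' g21 z * H g22 z.
pose be z := (G g12 z * G' g22 z + G g22 z * G' g12 z) * H g11 z
  - (G g12 z * G' g21 z + G g22 z * G' g11 z) * H g12 z
  - (G g11 z * G' g22 z + G g21 z * G' g12 z) * H g21 z
  + (G g11 z * G' g21 z + G g21 z * G' g11 z) * H g22 z.
set A := g11 L l0 l0 in ga gd t11; set B := g22 L l0 l0 in gb gd t22.
set C := g12 L l0 l0 in gs gd t12; rewrite -gs in t21.
have a1 : G g11 z @[z --> near_pt l0] --> A := tends12 t11.
have a2 : G g12 z @[z --> near_pt l0] --> C := tends12 t12.
have a3 : G g21 z @[z --> near_pt l0] --> C := tends12 t21.
have a4 : G g22 z @[z --> near_pt l0] --> B := tends12 t22.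
have b1 : G' g11 z @[z --> near_pt l0] --> A := tends13 t11.
have b2 : G' g12 z @[z --> near_pt l0] --> C := tends13 t12.
have b3 : G' g21 z @[z --> near_pt l0] --> C := tends13 t21.
have b4 : G' g22 z @[z --> near_pt l0] --> B := tends13 t22.
have c1 : H g11 z @[z --> near_pt l0] --> A := tends23 t11.
have c2 : H g12 z @[z --> near_pt l0] --> C := tends23 t12.
have c3 : H g21 z @[z --> near_pt l0] --> C := tends23 t21.
have c4 : H g22 z @[z --> near_pt l0] --> B := tends23 t22.
have cal : al z @[z --> near_pt l0] --> A * (A * B - C ^+ 2).
  rewrite (_ : A * _ = C * C * A - C * A * C - A * C * C + A * A * B); last by ring.
  by apply: cvgD; [apply: cvgB; [apply: cvgB|]|]; (apply: cvgM; [apply: cvgM|]).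
have cgam : gam z @[z --> near_pt l0] --> B * (A * B - C ^+ 2).
  rewrite (_ : B * _ = B * B * A - B * C * C - C * B * C + C * C * B); last by ring.
  by apply: cvgD; [apply: cvgB; [apply: cvgB|]|]; (apply: cvgM; [apply: cvgM|]).
have cbe : be z @[z --> near_pt l0] --> 2 * C * (A * B - C ^+ 2).
  rewrite (_ : 2 * C * _ = (C * B + B * C) * A - (C * C + B * A) * C - (A * B + C * C) * C + (A * C + C * A) * B); last by ring.
  apply: cvgD; [apply: cvgB; [apply: cvgB|]|].
  - by apply: cvgM => //; apply: cvgD; apply: cvgM.
  - by apply: cvgM => //; apply: cvgD; apply: cvgM.
  - by apply: cvgM => //; apply: cvgD; apply: cvgM.
  - by apply: cvgM => //; apply: cvgD; apply: cvgM.
have cdisc : 4 * al z * gam z - be z ^+ 2 @[z --> near_pt l0] --> 4 * (A * B - C ^+ 2) ^+ 3.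
  rewrite (_ : 4 * _ = 4 * (A * (A * B - C ^+ 2)) * (B * (A * B - C ^+ 2)) - (2 * C * (A * B - C ^+ 2)) ^+ 2); last by ring.
  apply: cvgB; last exact: (cvgM cbe cbe).
  by apply: cvgM => //; apply: cvgM => //; exact: cvg_cst.
have cdet12 : G g11 z * G g22 z - G g12 z * G g21 z @[z --> near_pt l0] --> A * B - C ^+ 2.
  by rewrite expr2; apply: cvgB; apply: cvgM.
have cdet13 : G' g11 z * G' g22 z - G' g12 z * G' g21 z @[z --> near_pt l0] --> A * B - C ^+ 2.
  by rewrite expr2; apply: cvgB; apply: cvgM.
have [e e0 [N hN]] : near_pt l0 [set z | [/\ 0 < al z, 0 < 4 * al z * gam z - be z ^+ 2,
   0 < G g11 z * G g22 z - G g12 z * G g21 z & 0 < G' g11 z * G' g22 z - G' g12 z * G' g21 z]].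
  have n1 : near_pt l0 [set z | 0 < al z] by apply: cvgr_gt cal _ _; rewrite mulr_gt0.
  have n2 : near_pt l0 [set z | 0 < 4 * al z * gam z - be z ^+ 2].
    by apply: cvgr_gt cdisc _ _; rewrite mulr_gt0// exprn_gt0.
  have n3 : near_pt l0 [set z | 0 < G g11 z * G g22 z - G g12 z * G g21 z].
    exact: (cvgr_gt _ cdet12 _ gd).
  have n4 : near_pt l0 [set z | 0 < G' g11 z * G' g22 z - G' g12 z * G' g21 z].
    exact: (cvgr_gt _ cdet13 _ gd).
  have n12 := @filterI _ _ (near_pt_filter l0) _ _ n1 n2.
  have n34 := @filterI _ _ (near_pt_filter l0) _ _ n3 n4.
  by have := @filterI _ _ (near_pt_filter l0) _ _ n12 n34; apply: filterS => z [[? ?] [? ?]].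
exists e => //; exists N => // m /= Nm; split; last first.
  move=> l l' le le' ll' dl sl.
  have [_ _ gd12 _] := hN m l l' l Nm le le' le.
  have xl : x11 (D m) l != 0.
    have [] := scalar_x (hD m) dl sl; rewrite hP => /eqP + _; apply: contraTN => /eqP ->.
    by rewrite expr0n /= sqrf_eq0.
  rewrite (charfun_scalar (hD m) dl sl xl gd12 ll').
  apply: mulf_neq0; last by rewrite gt_eqF.
  by apply: mulf_neq0; rewrite ?oppr_eq0// sqrf_eq0 subr_eq0 eq_sym.
move=> l1 l2 l3 le1 le2 le3 l12 l13 l23 dz1 dz2 dz3.
have [al0 disc gd12 gd13] := hN m l1 l2 l3 Nm le1 le2 le3.
have ker l : charfun (D m) l = 0 -> exists u v : R, [/\ (u, v) != (0, 0),
   x11 (D m) l * u + x12 (D m) l * v = x11 L l0 * u &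
   x21 (D m) l * u + x22 (D m) l * v = x11 L l0 * v].
  move=> dl; apply: kernel_vector; first by rewrite (x_det l (hD m)).
  by move: dl; rewrite /charfun hd0; lra.
clear a1 a2 a3 a4 b1 b2 b3 b4 c1 c2 c3 c4.
have [u1 [v1 [n1 a1 b1]]] := ker _ dz1.
have [u2 [v2 [n2 a2 b2]]] := ker _ dz2.
have [u3 [v3 [n3 a3 b3]]] := ker _ dz3.
have o12 := kernel_orthogonal (hD m) x0 hP l12 a1 b1 a2 b2.
have o13 := kernel_orthogonal (hD m) x0 hP l13 a1 b1 a3 b3.
have o23 := kernel_orthogonal (hD m) x0 hP l23 a2 b2 a3 b3.
have gn (A' B' C' E' : R) : 0 < A' * B' - C' * E' ->
  (A' * u1 + E' * v1, C' * u1 + B' * v1) != (0, 0).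
  move=> dt; apply: contra n1; rewrite !xpair_eqE => /andP[/eqP q1 /eqP q2].
  have e1 : (A' * B' - C' * E') * u1 = 0.
    rewrite (_ : _ * u1 = B' * (A' * u1 + E' * v1) - E' * (C' * u1 + B' * v1)); last by ring.
    by rewrite q1 q2 !mulr0 subrr.
  have e2 : (A' * B' - C' * E') * v1 = 0.
    rewrite (_ : _ * v1 = A' * (C' * u1 + B' * v1) - C' * (A' * u1 + E' * v1)); last by ring.
    by rewrite q1 q2 !mulr0 subrr.
  by move/eqP: e1; move/eqP: e2; rewrite !mulf_eq0 (gt_eqF dt) /= => -> ->.
have := @orthogonal_multiple (g11 (D m) l1 l2 * u1 + g21 (D m) l1 l2 * v1)
  (g12 (D m) l1 l2 * u1 + g22 (D m) l1 l2 * v1) u2 v2 (gn _ _ _ _ gd12).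
case; first by rewrite -[RHS]o12; ring.
move=> m2 [u2E v2E].
have := @orthogonal_multiple (g11 (D m) l1 l3 * u1 + g21 (D m) l1 l3 * v1)
  (g12 (D m) l1 l3 * u1 + g22 (D m) l1 l3 * v1) u3 v3 (gn _ _ _ _ gd13).
case; first by rewrite -[RHS]o13; ring.
move=> m3 [u3E v3E].
have m20 : m2 != 0 by apply: contraNneq n2 => m20; rewrite u2E v2E m20 !mul0r.
have m30 : m3 != 0 by apply: contraNneq n3 => m30; rewrite u3E v3E m30 !mul0r.
have /negP := posdef_form_neq0 al0 disc n1; apply.
have : m2 * m3 * (al (m, (l1, l2, l3)) * u1 ^+ 2 + be (m, (l1, l2, l3)) * (u1 * v1)
  + gam (m, (l1, l2, l3)) * v1 ^+ 2) = 0.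
  by rewrite -o23 u2E v2E u3E v3E /al /be /gam /G /G' /H /=; ring.
by move=> /eqP; rewrite !mulf_eq0 (negbTE m20) (negbTE m30).
Qed.

(** * Existence of zeros near a zero of the limit *)

Lemma ivt_root (f : R -> R) (x y : R) : continuous f -> x <= y -> f x * f y <= 0 ->
  exists2 z, x <= z <= y & f z = 0.
Proof.
move=> cf xy fxy; suff H : Num.min (f x) (f y) <= 0 <= Num.max (f x) (f y).
  have [|z] := IVT xy _ H; first exact: continuous_subspaceT.
  by rewrite in_itv; exists z.
have [fx|fx] := leP 0 (f x); have [fy|fy] := leP 0 (f y).
- have : f x * f y == 0 by rewrite eq_le fxy mulr_ge0.
  by rewrite mulf_eq0 ge_min le_max fx => /orP[]/eqP ->; rewrite lexx ?orbT.
- by rewrite ge_min le_max fx (ltW fy) orbT.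
- by rewrite ge_min le_max (ltW fx) fy !orbT.
- by have := lt_le_trans (mulr_gt0 (_ : 0 < - f x) (_ : 0 < - f y)) _;
      rewrite mulrNN !oppr_gt0 => /(_ 0 fx fy fxy); rewrite ltxx.
Qed.

Lemma tends_diag (D : nat -> fund_data) (f : fund_data -> R -> R) L l :
  tends l (fun m l' _ => f (D m) l') (f L l) -> f (D m) l @[m --> \oo] --> f L l.
Proof.
move=> H; apply/cvgrPdist_lt => e /H[d d0' [N hN]]; exists N => // m /= Nm.
by rewrite distrC; apply: (hN m l l); rewrite ?subrr ?normr0.
Qed.

Lemma x_cvg_pt (D : nat -> fund_data) L l : fund_data_cvg D L l ->
  [/\ x11 (D m) l @[m --> \oo] --> x11 L l, x12 (D m) l @[m --> \oo] --> x12 L l,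
      x21 (D m) l @[m --> \oo] --> x21 L l & x22 (D m) l @[m --> \oo] --> x22 L l].
Proof.
move=> [[/tends_diag h1 /tends_diag h2 /tends_diag h3 /tends_diag h4] _].
by split; apply: cvgD; apply: cvgM => //; exact: cvg_cst.
Qed.

Lemma charfun_cvg_pt (D : nat -> fund_data) L l : fund_data_cvg D L l ->
  charfun (D m) l @[m --> \oo] --> charfun L l.
Proof.
move=> /x_cvg_pt[h1 h2 h3 h4]; apply: cvgD => //; apply: cvgD => //; exact: cvg_cst.
Qed.

(** At the two points at distance t from [l0], [charfun L] is t and - t times slopes close to
    [slope L l0 l0]. The resulting change of sign passes to [D m], and the intermediate value
    theorem applies. *)
Lemma charfun_simple_zero_near D L l0 : (forall m, fund_data_continuous (D m)) -> lagrange L -> gram_pos L l0 ->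
  (forall l, fund_data_cvg D L l) -> fund_data_cvg (fun=> L) L l0 ->
  charfun L l0 = 0 -> ~ scalarx L l0 ->
  forall e, 0 < e -> \forall m \near \oo, exists2 l, `|l - l0| < e & charfun (D m) l = 0.
Proof.
move=> cD hL gL hD cL dz ns e e0.
have k0 := slope_neq0 hL gL dz ns; have ck := slope_cvg cL.
(* Multiplication by the nonzero limit spares a distinction of its sign; [x] serves the same purpose
   in the case of a double zero. *)
have kk : slope L z.2.1.1 z.2.1.2 * slope L l0 l0 @[z --> near_pt l0] --> slope L l0 l0 * slope L l0 l0.
  by apply: cvgM => //; exact: cvg_cst.
have kk0 : 0 < slope L l0 l0 * slope L l0 l0 by rewrite -expr2 lt_neqAle sqr_ge0 eq_sym sqrf_eq0 k0.
have [d d0' [N hN]] := cvgr_gt _ kk _ kk0.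
pose t := Num.min (e / 2) (d / 2).
have t0 : 0 < t by rewrite lt_min !divr_gt0.
have td : t < d by rewrite gt_min; apply/orP; right; rewrite ltr_pdivrMr// ltr_pMr// ltr1n.
have te : t < e by rewrite gt_min; apply/orP; left; rewrite ltr_pdivrMr// ltr_pMr// ltr1n.
have kp : 0 < slope L l0 (l0 + t) * slope L l0 l0.
  by apply: (hN N l0 (l0 + t) l0); rewrite // ?subrr ?normr0// addrAC subrr add0r gtr0_norm.
have km : 0 < slope L l0 (l0 - t) * slope L l0 l0.
  by apply: (hN N l0 (l0 - t) l0); rewrite // ?subrr ?normr0// addrAC subrr add0r normrN gtr0_norm.
have dp : charfun L (l0 + t) = t * slope L l0 (l0 + t).
  by have := charfun_diff l0 (l0 + t) hL; rewrite dz subr0 addrAC subrr add0r.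
have dm : charfun L (l0 - t) = - t * slope L l0 (l0 - t).
  by have := charfun_diff l0 (l0 - t) hL; rewrite dz subr0 addrAC subrr add0r.
have dd : charfun L (l0 - t) * charfun L (l0 + t) < 0.
  rewrite dp dm -(pmulr_llt0 _ kk0).
  have -> : - t * slope L l0 (l0 - t) * (t * slope L l0 (l0 + t)) * (slope L l0 l0 * slope L l0 l0) =
   - (t ^+ 2 * ((slope L l0 (l0 + t) * slope L l0 l0) * (slope L l0 (l0 - t) * slope L l0 l0))) by ring.
  by rewrite oppr_lt0; apply: mulr_gt0; [exact: exprn_gt0|exact: mulr_gt0].
have cdd : charfun (D m) (l0 - t) * charfun (D m) (l0 + t) @[m --> \oo] -->
   charfun L (l0 - t) * charfun L (l0 + t) by apply: cvgM; exact: charfun_cvg_pt.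
have E := cvgr_lt _ cdd _ dd; near=> m.
have hm : charfun (D m) (l0 - t) * charfun (D m) (l0 + t) <= 0.
  by apply: ltW; near: m; exact: E.
have [|z /andP[z1 z2] zE] := ivt_root (charfun_continuous (cD m)) _ hm; first lra.
exists z => //; apply: le_lt_trans te; rewrite ler_norml; apply/andP; split; lra.
Unshelve. all: by end_near. Qed.

(* At a zero of x12 or of x21 the discriminant of X forces [charfun] to vanish or to
   have the sign opposite to the one it has at l0 - t and l0 + t. Such zeros exist
   in between; if [charfun] vanishes at the same zero of x12 and x21, X is scalar. *)
Lemma charfun_double_zero_near D L l0 : (forall m, lagrange (D m)) -> (forall m, fund_data_continuous (D m)) ->
  lagrange L -> gram_pos L l0 ->
  (forall l, fund_data_cvg D L l) -> fund_data_cvg (fun=> L) L l0 ->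
  charfun L l0 = 0 -> scalarx L l0 -> x11 L l0 != 0 ->
  forall e, 0 < e -> \forall m \near \oo,
   (exists2 l, `|l - l0| < e & charfun (D m) l = 0 /\ scalarx (D m) l) \/
   (exists l l', [/\ l != l', `|l - l0| < e, `|l' - l0| < e, charfun (D m) l = 0 &
     charfun (D m) l' = 0]).
Proof.
move=> lD cD hL [gs ga gb gd] hD cL dz sc x0 e e0.
have [hP hd0] := scalar_x hL dz sc.
set x := x11 L l0 in x0 hP hd0.
have [_ [t11 t12 t21 t22]] := cL.
have c1 := tends12 t11; have c2 := tends12 t12; have c3 := tends12 t21; have c4 := tends12 t22.
have cdet : g11 L z.2.1.1 z.2.1.2 * g22 L z.2.1.1 z.2.1.2 -
  g12 L z.2.1.1 z.2.1.2 * g21 L z.2.1.1 z.2.1.2 @[z --> near_pt l0] -->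
  g11 L l0 l0 * g22 L l0 l0 - g12 L l0 l0 ^+ 2.
  by rewrite expr2 [X in _ * _ - _ * X]gs; apply: cvgB; apply: cvgM.
have [da da0 [Na hNa]] := cvgr_gt _ c1 _ ga.
have [db db0 [Nb hNb]] := cvgr_gt _ c4 _ gb.
have [dd dd0 [Nd hNd]] := cvgr_gt _ cdet _ gd.
have [X1 _ _ X4] := x_cvg (hD l0).
have xx0 : 0 < x * x by rewrite -expr2 lt_neqAle sqr_ge0 eq_sym sqrf_eq0 x0.
have cX : x11 (D z.1) z.2.1.1 * x @[z --> near_pt l0] --> x * x.
  by apply: cvgM => //; exact: cvg_cst.
have [dx dx0 [Nx hNx]] := cvgr_gt _ cX _ xx0.
have [t [t0 [te ta tb [td tx]]]] : exists t, 0 < t /\ [/\ t < e, t < da, t < db & t < dd /\ t < dx].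
  exists (Num.min (Num.min e (Num.min da db)) (Num.min dd dx) / 2); split.
    by rewrite divr_gt0// !lt_min e0 da0 db0 dd0 dx0.
  have h (y : R) : Num.min (Num.min e (Num.min da db)) (Num.min dd dx) <= y -> 0 < y ->
    Num.min (Num.min e (Num.min da db)) (Num.min dd dx) / 2 < y.
    by move=> h1 h2; rewrite ltr_pdivrMr// (le_lt_trans h1)// ltr_pMr// ltr1n.
  by split; [| | |split]; apply: h => //; rewrite !ge_min lexx ?orbT.
have lt1 : `|l0 + t - l0| = t by rewrite addrAC subrr add0r gtr0_norm.
have lt2 : `|l0 - t - l0| = t by rewrite addrAC subrr add0r normrN gtr0_norm.
have ll : `|l0 - l0| = 0 by rewrite subrr normr0.
have end_ l : `|l - l0| = t -> [/\ 0 < g11 L l0 l, 0 < g22 L l0 l & charfun L l * x < 0].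
  move=> lt.
  have G1 : 0 < g11 L l0 l by apply: (hNa Na l0 l l0); rewrite ?ll ?lt.
  have G2 : 0 < g22 L l0 l by apply: (hNb Nb l0 l l0); rewrite ?ll ?lt.
  have G3 : 0 < g11 L l0 l * g22 L l0 l - g12 L l0 l * g21 L l0 l.
    by apply: (hNd Nd l0 l l0); rewrite ?ll ?lt.
  have l0l : l0 != l by apply: contraTneq t0 => l0l; rewrite -lt -l0l ll ltxx.
  split=> //; rewrite (charfun_scalar hL dz sc x0 G3 l0l) -/x.
  set T := (X in _ * X * x < 0) in G3 *.
  have -> : - x * (l - l0) ^+ 2 * T * x = - ((x * x) * ((l - l0) ^+ 2 * T)) by ring.
  by rewrite oppr_lt0 mulr_gt0// mulr_gt0// lt_neqAle sqr_ge0 eq_sym sqrf_eq0 subr_eq0 eq_sym l0l.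
have [ga1 gb1 dp] := end_ _ lt1; have [ga2 gb2 dm] := end_ _ lt2.
have [_ x12p x21p _] := x_rel l0 (l0 + t) hL.
have [_ x12m x21m _] := x_rel l0 (l0 - t) hL.
have [s1 s2 s3] := sc.
rewrite s1 s2 -s3 -/x !mul0r ?subr0 ?sub0r !add0r addrAC subrr add0r in x12p x21p x12m x21m.
(* Since X(l0) is scalar, Lagrange's identity reduces to x12 = h x g22 and x21 = - h x g11 at l0 +
   h, with positive g11 and g22. *)
have x12s : x12 L (l0 - t) * x12 L (l0 + t) < 0.
  rewrite x12m x12p (_ : _ * _ = - ((x * x) * (t ^+ 2 * (g22 L l0 (l0 - t) * g22 L l0 (l0 + t))))); last by ring.
  rewrite oppr_lt0; apply: mulr_gt0 => //.
  by apply: mulr_gt0; [exact: exprn_gt0|exact: mulr_gt0].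
have x21s : x21 L (l0 - t) * x21 L (l0 + t) < 0.
  rewrite x21m x21p (_ : _ * _ = - ((x * x) * (t ^+ 2 * (g11 L l0 (l0 - t) * g11 L l0 (l0 + t))))); last by ring.
  rewrite oppr_lt0; apply: mulr_gt0 => //.
  by apply: mulr_gt0; [exact: exprn_gt0|exact: mulr_gt0].
have [_ y12p y21p _] := x_cvg_pt (hD (l0 + t)).
have [_ y12m y21m _] := x_cvg_pt (hD (l0 - t)).
have yp := charfun_cvg_pt (hD (l0 + t)); have ym := charfun_cvg_pt (hD (l0 - t)).
have E1 := cvgr_lt _ (cvgM y12m y12p) _ x12s.
have E2 := cvgr_lt _ (cvgM y21m y21p) _ x21s.
have E3 := cvgr_lt _ (cvgM yp (cvg_cst x)) _ dp.
have E4 := cvgr_lt _ (cvgM ym (cvg_cst x)) _ dm.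
near=> m.
have m12 : x12 (D m) (l0 - t) * x12 (D m) (l0 + t) <= 0.
  by apply: ltW; near: m; exact: E1.
have m21 : x21 (D m) (l0 - t) * x21 (D m) (l0 + t) <= 0.
  by apply: ltW; near: m; exact: E2.
have mp : charfun (D m) (l0 + t) * x < 0 by near: m; exact: E3.
have mm : charfun (D m) (l0 - t) * x < 0 by near: m; exact: E4.
have mN : (Nx <= m)%N by near: m; exists Nx.
have [h1 h2 h3 h4] := cD m.
have cx12 : continuous (x12 (D m)).
  by move=> l; apply: cvgD; apply: cvgM; first [exact: cvg_cst|exact: h2|exact: h4].
have cx21 : continuous (x21 (D m)).
  by move=> l; apply: cvgD; apply: cvgM; first [exact: cvg_cst|exact: h1|exact: h3].
have cd := charfun_continuous (cD m).
have tt : l0 - t <= l0 + t by rewrite lerD2l ge0_cp// ltW.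
have [la /andP[la1 la2] laE] := ivt_root cx12 tt m12.
have [lb /andP[lb1 lb2] lbE] := ivt_root cx21 tt m21.
have near_ l : l0 - t <= l -> l <= l0 + t -> `|l - l0| <= t.
  by move=> h h'; rewrite ler_distl h h'.
have posd l : l0 - t <= l -> l <= l0 + t -> x12 (D m) l * x21 (D m) l = 0 ->
    0 <= charfun (D m) l * x.
  move=> l1 l2 z0; have := x_det l (lD m); rewrite z0 subr0 hP => xdet.
  have xpos : 0 < x11 (D m) l * x.
    by apply: (hNx m l l l mN); apply: le_lt_trans tx; exact: near_.
  rewrite /charfun hd0.
  (* As x11 x22 = x^2 at such a point, the product equals a square; the sign of its first factor is
     known from [xpos]. *)
  have : 0 <= (x11 (D m) l * x) * ((- (2 * x) + x11 (D m) l + x22 (D m) l) * x).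
    have -> : (x11 (D m) l * x) * ((- (2 * x) + x11 (D m) l + x22 (D m) l) * x) =
      (x11 (D m) l * x - x * x) ^+ 2 + (x * x) * (x11 (D m) l * x22 (D m) l - x ^+ 2) by ring.
    by rewrite xdet subrr mulr0 addr0 sqr_ge0.
  by rewrite pmulr_rge0.
have pa : 0 <= charfun (D m) la * x by apply: posd => //; rewrite laE mul0r.
have pb : 0 <= charfun (D m) lb * x by apply: posd => //; rewrite lbE mulr0.
have two l : l0 - t <= l -> l <= l0 + t -> 0 < charfun (D m) l * x ->
   exists l l', [/\ l != l', `|l - l0| < e, `|l' - l0| < e, charfun (D m) l = 0 &
     charfun (D m) l' = 0].
  move=> l1 l2 dl.
  have sgn (u v : R) : u * x < 0 -> 0 < v * x -> u * v <= 0.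
    move=> ux vx; rewrite -(pmulr_lle0 _ xx0).
    have -> : u * v * (x * x) = (u * x) * (v * x) by ring.
    by rewrite mulr_le0_ge0// ltW.
  have [|ka /andP[ka1 ka2] kaE] := ivt_root cd l1 _; first exact: sgn.
  have [|kb /andP[kb1 kb2] kbE] := ivt_root cd l2 _; first by rewrite mulrC; exact: sgn.
  exists ka, kb; split => //.
  - apply: contraTneq dl => kab.
    have -> : l = ka by apply/eqP; rewrite eq_le ka2 andbT kab kb1.
    by rewrite kaE mul0r ltxx.
  - by apply: le_lt_trans te; apply: near_ => //; exact: le_trans l2.
  - by apply: le_lt_trans te; apply: near_ => //; exact: le_trans kb1.
have [da_|da_] := ltP 0 (charfun (D m) la * x); first by right; exact: two da_.
have [db_|db_] := ltP 0 (charfun (D m) lb * x); first by right; exact: two db_.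
have dz_ l : charfun (D m) l * x <= 0 -> 0 <= charfun (D m) l * x -> charfun (D m) l = 0.
  move=> u v; have : charfun (D m) l * x == 0 by rewrite eq_le u v.
  by rewrite mulf_eq0 (negbTE x0) orbF => /eqP.
have dla := dz_ _ da_ pa; have dlb := dz_ _ db_ pb.
have lae : `|la - l0| < e by apply: le_lt_trans te; exact: near_.
have lbe : `|lb - l0| < e by apply: le_lt_trans te; exact: near_.
have [lab|lab] := eqVneq la lb; last by right; exists la, lb.
left; exists la => //; split => //; split => //; first by rewrite lab.
have := x_det la (lD m); rewrite laE mul0r subr0 hP.
move: dla; rewrite /charfun hd0 => tr dt.
have : (x11 (D m) la - x22 (D m) la) ^+ 2 = 0.
  have -> : (x11 (D m) la - x22 (D m) la) ^+ 2 = (x11 (D m) la + x22 (D m) la) ^+ 2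
    - 4 * (x11 (D m) la * x22 (D m) la) by ring.
  have -> : x11 (D m) la + x22 (D m) la = 2 * x.
    by apply/eqP; rewrite -subr_eq0 -tr; apply/eqP; ring.
  by rewrite dt; ring.
by move=> /eqP; rewrite sqrf_eq0 subr_eq0 => /eqP.
Unshelve. all: by end_near. Qed.

End Boundary.
End LocalCount.

(** * The fundamental matrix *)

Section FundamentalData.
Context {R : realType} (a b : R) (ab : a < b).
Local Notation mu := (@lebesgue_measure R).
Local Notation prim := (prim a b).
Local Notation in_L1 := (in_L1 a b).
Local Notation P := (primitive a b).
Local Notation sol := (sol a b).
Implicit Types (w s q r y z : R -> R).

(** A choice among solutions, total in its arguments; the default pair of zero functions does not
    occur for integrable coefficients. *)
Definition solf w s (Q : R -> R) (c0 c1 : R) : (R -> R) * (R -> R) :=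
  if pselect (exists yy : (R -> R) * (R -> R),
    [/\ sol w s Q yy.1 yy.2, yy.1 a = c0 & yy.2 a = c1]) is left h
  then projT1 (cid h) else (fun=> 0, fun=> 0).

Lemma solfP w s Q c0 c1 : in_L1 w -> in_L1 s -> in_L1 Q ->
  [/\ sol w s Q (solf w s Q c0 c1).1 (solf w s Q c0 c1).2,
      (solf w s Q c0 c1).1 a = c0 & (solf w s Q c0 c1).2 a = c1].
Proof.
move=> hw hs hQ; rewrite /solf; case: pselect => [h|nh]; first by case: (cid h).
by exfalso; apply: nh; exact: sol_exists.
Qed.

Definition pot q r (l : R) := fun x => q x - l * r x.

Lemma in_L1_pot q r l : in_L1 q -> in_L1 r -> in_L1 (pot q r l).
Proof. by move=> hq hr; apply: in_L1B => //; exact: in_L1Z. Qed.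

Lemma prim_primitiveE f f' x : prim f f' -> in_L1 f' -> a <= x <= b -> P f' x = f x - f a.
Proof.
move=> hf hf' xab; rewrite -[P f' x]subr0 -(primitive_a b f' (lexx a)).
have := prim0_cst ab (primB ab hf (prim_primitive hf')) _ xab.
set A := ae_on _ _ _; have hA : A by apply: ae_onW => t _; rewrite subrr.
by move=> /(_ hA); lra.
Qed.

Lemma in_L1_rzy r y z : in_L1 r -> ac a b y -> ac a b z -> in_L1 (fun x => r x * (z x * y x)).
Proof. by move=> hr hy hz; apply: in_L1_mul_ac => //; apply: acM. Qed.

(** In the derivative of z1 y - z y1 the terms with [w] and [s] cancel and (l - k) r z y remains. *)
Lemma lagrange_identity w s q r k l y y1 z z1 :
  in_L1 r -> sol w s (pot q r l) y y1 -> sol w s (pot q r k) z z1 ->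
  (z1 b * y b - z b * y1 b) - (z1 a * y a - z a * y1 a) =
  (l - k) * P (fun x => r x * (z x * y x)) b.
Proof.
move=> hr [hy hy1] [hz hz1].
have h := primB ab (primM ab hz1 hy) (primM ab hz hy1).
have hrzy : in_L1 (fun x => r x * (z x * y x)).
  by apply: in_L1_rzy => //; [case: hy|case: hz].
have h' := primZ ab (l - k) (prim_primitive hrzy).
have := prim_unique ab (primB ab h (prim_cst a b (z1 a * y a - z a * y1 a))) (prim_ext _ h') _ _.
rewrite (primitive_a _ _ (lexx a)) mulr0 subrr => H.
rewrite -(H _ erefl b) ?lexx ?ltW//.
by move=> x _; rewrite /pot; ring.
Qed.

Section Data.
Variables (w s q r : R -> R).

Definition theta l := solf w s (pot q r l) 1 0.
Definition phi l := solf w s (pot q r l) 0 1.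

Definition gram (y z : R -> R) := P (fun x => r x * (y x * z x)) b.

Definition fundamental : fund_data := FundData
  (fun l => (theta l).1 b) (fun l => (phi l).1 b)
  (fun l => (theta l).2 b) (fun l => (phi l).2 b)
  (fun k l => gram (theta k).1 (theta l).1) (fun k l => gram (theta k).1 (phi l).1)
  (fun k l => gram (phi k).1 (theta l).1) (fun k l => gram (phi k).1 (phi l).1).

Hypotheses (hw : in_L1 w) (hs : in_L1 s) (hq : in_L1 q) (hr : in_L1 r).

Lemma thetaP l : [/\ sol w s (pot q r l) (theta l).1 (theta l).2,
  (theta l).1 a = 1 & (theta l).2 a = 0].
Proof. by apply: solfP => //; exact: in_L1_pot. Qed.

Lemma phiP l : [/\ sol w s (pot q r l) (phi l).1 (phi l).2,
  (phi l).1 a = 0 & (phi l).2 a = 1].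
Proof. by apply: solfP => //; exact: in_L1_pot. Qed.

Lemma sol_theta_phi l y y1 : sol w s (pot q r l) y y1 -> forall x, a <= x <= b ->
  y x = y a * (theta l).1 x + y1 a * (phi l).1 x /\
  y1 x = y a * (theta l).2 x + y1 a * (phi l).2 x.
Proof.
move=> hy x xab.
have [ht t0 t1] := thetaP l; have [hp p0 p1] := phiP l.
have hQ := in_L1_pot l hq hr.
apply: (sol_unique ab hw hs hQ hy (sol_lin ab (y a) (y1 a) ht hp)) => //.
  by rewrite t0 p0; ring.
by rewrite t1 p1; ring.
Qed.

Lemma fundamental_lagrange : lagrange fundamental.
Proof.
have D l : (theta l).1 b * (phi l).2 b - (phi l).1 b * (theta l).2 b = 1.
  have [ht t0 t1] := thetaP l; have [hp p0 p1] := phiP l.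
  have := lagrange_identity hr hp ht; rewrite subrr mul0r t0 t1 p0 p1; lra.
split => [//|k l].
have [ht t0 t1] := thetaP k; have [hp p0 p1] := phiP k.
have [ht' t0' t1'] := thetaP l; have [hp' p0' p1'] := phiP l.
have e1 := lagrange_identity hr ht' ht; have e2 := lagrange_identity hr hp' ht.
have e3 := lagrange_identity hr ht' hp; have e4 := lagrange_identity hr hp' hp.
rewrite ?(t0, t1, p0, p1, t0', t1', p0', p1') in e1 e2 e3 e4.
have Dk := D k.
rewrite /= /gram.
move: e1 e2 e3 e4 Dk.
set A := P _ b; set B := P _ b; set C := P _ b; set E := P _ b => e1 e2 e3 e4 Dk.
(* The four instances of Lagrange's identity are linear in F(l); inserting the factor 1 = det F(k)
   solves them. *)
split; rewrite mulrBr !(mulrCA (l - k)) -?e1 -?e2 -?e3 -?e4.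
- by rewrite -[LHS]mulr1 -[X in _ * X = _]Dk; ring.
- by rewrite -[LHS]mulr1 -[X in _ * X = _]Dk; ring.
- by rewrite -[LHS]mulr1 -[X in _ * X = _]Dk; ring.
- by rewrite -[LHS]mulr1 -[X in _ * X = _]Dk; ring.
Qed.

Hypotheses (hr0 : ae_on a b (fun x => 0 < r x)) (hw0 : ae_on a b (fun x => 0 < w x)).

(** A null set contains no nondegenerate interval, so points of [A] lie arbitrarily close to [x],
    even at an end point. *)
Lemma ac_ae_exists (A : R -> Prop) x : ae_on a b A -> a <= x <= b ->
  forall d : R, 0 < d -> exists t : R, [/\ a <= t <= b, `|t - x| < d & A t].
Proof.
move=> hA /andP[ax xb] d d0; apply/not_existsP => h.
pose u := Num.max a (x - d); pose v := Num.min b (x + d).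
have uv : u < v.
  by rewrite lt_min !gt_max ab /=; apply/and3P; split; lra.
case: hA => N [mN N0 hN].
have sub : `]u, v[ `<=` N.
  clear N0; move=> t; rewrite /= in_itv /= gt_max lt_min => /andP[/andP[y1 y2] /andP[y3 y4]].
  apply: hN => /= Ay; apply: (h t); split.
  - by rewrite !ltW.
  - by rewrite ltr_norml; apply/andP; split; lra.
  - by apply: Ay; rewrite /= in_itv /= y1.
have : mu `]u, v[ = 0%E by apply: (subset_measure0 _ mN sub N0); exact: measurable_itv.
rewrite [LHS]lebesgue_measure_itv /= lte_fin uv -EFinB => /eqP.
by rewrite eqe subr_eq0 gt_eqF.
Qed.

Lemma ac_ae_eq0 y : ac a b y -> ae_on a b (fun x => y x = 0) ->
  forall x, a <= x <= b -> y x = 0.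
Proof.
move=> acy y0 x xab; apply/eqP; rewrite -normr_le0; apply/ler_addgt0Pr => e e0.
have [d d0 hd] := ac_unif acy e0.
have [z [zab zx yz]] := ac_ae_exists y0 xab d0.
by have := hd z x zab xab; rewrite distrC yz subr0 add0r => /(_ zx) /ltW.
Qed.

(** If the integral were zero, so would be its nondecreasing primitive, hence r y^2 a.e. and, by
    continuity, y itself. Then 0 = y' = w y1 with w > 0 gives y1 = 0, contrary to the initial
    values. *)
Lemma gram_gt0 l y y1 : sol w s (pot q r l) y y1 -> y a != 0 \/ y1 a != 0 -> 0 < gram y y.
Proof.
move=> [hy hy1] hnz.
have acy := prim_ac hy; have acy1 := prim_ac hy1.
have ir : in_L1 (fun x => r x * (y x * y x)) by apply: in_L1_rzy.
have hP := prim_primitive ir.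
have ry0 : ae_on a b (fun x => 0 <= r x * (y x * y x)).
  by apply: ae_onS hr0 => x _ rx; rewrite mulr_ge0 ?(ltW rx)// -expr2 sqr_ge0.
have Pge0 x : a <= x <= b -> 0 <= P (fun x => r x * (y x * y x)) x <= gram y y.
  move=> /andP[ax xb]; apply/andP; split.
    by rewrite -[X in X <= _](primitive_a b (fun x => r x * (y x * y x)) (lexx a)); apply: (prim_mono hP).
  exact: (prim_mono hP).
rewrite lt_neqAle; apply/andP; split; last first.
  by have /Pge0/andP[/le_trans] : a <= b <= b; [rewrite lexx ltW|apply].
apply/eqP => g0.
have y0 : ae_on a b (fun x => y x = 0).
  have [_ dP] := hP.
  apply: ae_onS (ae_onI dP hr0) => x Jx [dx rx].
  have cst0 : \forall t \near x, P (fun x => r x * (y x * y x)) t = cst 0 t.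
    near=> t.
    have tab : a <= t <= b.
      have : t \in `]a, b[ by near: t; exact: near_in_itvoo.
      by rewrite in_itv /= => /andP[? ?]; rewrite !ltW.
    by apply/eqP; rewrite eq_le; have := Pge0 t tab; rewrite -g0 andbC.
  have d0 : is_derive x (1 : R) (P (fun x => r x * (y x * y x))) 0.
    apply: near_eq_is_derive (is_derive_cst (0 : R) x (1 : R)).
    by apply: filterS cst0.
  have := @derive_val _ _ _ _ _ _ _ dx; rewrite (@derive_val _ _ _ _ _ _ _ d0) => /esym/eqP.
  by rewrite !mulf_eq0 (gt_eqF rx) /= orbb => /eqP.
have yz := ac_ae_eq0 acy y0.
have y10 : ae_on a b (fun x => y1 x = 0).
  have [_ dy] := hy.
  apply: ae_onS (ae_onI dy hw0) => x Jx [dx wx].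
  have cst0 : \forall t \near x, y t = cst 0 t.
    near=> t; apply: yz.
    have : t \in `]a, b[ by near: t; exact: near_in_itvoo.
    by rewrite in_itv /= => /andP[? ?]; rewrite !ltW.
  have d0 : is_derive x (1 : R) y 0.
    apply: near_eq_is_derive (is_derive_cst (0 : R) x (1 : R)).
    by apply: filterS cst0.
  have := @derive_val _ _ _ _ _ _ _ dx; rewrite (@derive_val _ _ _ _ _ _ _ d0) => /esym/eqP.
  have -> : y x = 0 by apply: yz; move: Jx; rewrite /= in_itv /= => /andP[? ?]; rewrite !ltW.
  by rewrite mulr0 subr0 mulf_eq0 (gt_eqF wx) /= => /eqP.
have aab : a <= a <= b by rewrite lexx ltW.
by case: hnz => /eqP; apply; [exact: yz|exact: (ac_ae_eq0 acy1)].
Unshelve. all: by end_near. Qed.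

Lemma gram_lin c d l :
  gram (fun x => c * (theta l).1 x + d * (phi l).1 x) (fun x => c * (theta l).1 x + d * (phi l).1 x)
  = c ^+ 2 * gram (theta l).1 (theta l).1 + 2 * (c * d) * gram (theta l).1 (phi l).1
    + d ^+ 2 * gram (phi l).1 (phi l).1.
Proof.
have [[/prim_ac ht _] _ _] := thetaP l; have [[/prim_ac hp _] _ _] := phiP l.
have i1 := in_L1_rzy hr ht ht; have i2 := in_L1_rzy hr hp ht; have i3 := in_L1_rzy hr hp hp.
have h := primD (primD (primZ ab (c ^+ 2) (prim_primitive i1)) (primZ ab (2 * (c * d)) (prim_primitive i2)))
   (primZ ab (d ^+ 2) (prim_primitive i3)).
have hL : in_L1 (fun x => c ^+ 2 * (r x * ((theta l).1 x * (theta l).1 x)) +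
  2 * (c * d) * (r x * ((theta l).1 x * (phi l).1 x)) +
  d ^+ 2 * (r x * ((phi l).1 x * (phi l).1 x))).
  by apply: in_L1D; [apply: in_L1D|]; exact: in_L1Z.
have bab : a <= b <= b by rewrite lexx ltW.
have := prim_primitiveE h hL bab; rewrite !(primitive_a _ _ (lexx a)) !mulr0 !addr0 subr0 => <-.
by congr (P _ b); apply/funext => x; ring.
Qed.

Lemma fundamental_gram_pos l : gram_pos fundamental l.
Proof.
have [ht t0 t1] := thetaP l; have [hp p0 p1] := phiP l.
have g c d : c != 0 \/ d != 0 -> 0 < c ^+ 2 * g11 fundamental l l + 2 * (c * d) * g12 fundamental l l + d ^+ 2 * g22 fundamental l l.
  move=> cd; rewrite /= -gram_lin.
  apply: (gram_gt0 (sol_lin ab c d ht hp)).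
  by rewrite t0 t1 p0 p1 !mulr1 !mulr0 addr0 add0r.
have h11 : 0 < g11 fundamental l l by have := g 1 0 (or_introl (oner_neq0 _)); lra.
have h22 : 0 < g22 fundamental l l by have := g 0 1 (or_intror (oner_neq0 _)); lra.
split => //.
  by rewrite /= /gram; congr (P _ b); apply/funext => x; rewrite (mulrC ((theta l).1 x)).
(* At the vector (- g12, g11) the form takes the value g11 times the determinant. *)
have := g (- g12 fundamental l l) (g11 fundamental l l) (or_intror (lt0r_neq0 h11)).
set A := g11 fundamental l l in h11 *; set B := g22 fundamental l l; set C := g12 fundamental l l => h.
rewrite -(pmulr_rgt0 _ h11); move: h; congr (0 < _); ring.
Qed.

End Data.

(** * Continuous dependence on the coefficients and on the spectral parameter *)

Lemma fundamental_stable w s q r l0 : in_L1 w -> in_L1 s -> in_L1 q -> in_L1 r ->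
  exists2 K, 0 < K & forall eta, 0 < eta -> exists2 d, 0 < d &
  forall w' s' l, in_L1 w' -> in_L1 s' ->
    P (coef_norm (fun x => w' x - w x) (fun x => s' x - s x) (fun=> 0)) b <= d ->
    `|l - l0| <= d -> forall x, a <= x <= b ->
    [/\ `|(theta w' s' q r l).1 x - (theta w s q r l0).1 x| <= eta,
       `|(theta w' s' q r l).2 x - (theta w s q r l0).2 x| <= eta,
       `|(phi w' s' q r l).1 x - (phi w s q r l0).1 x| <= eta,
       `|(phi w' s' q r l).2 x - (phi w s q r l0).2 x| <= eta &
       `|(theta w s q r l0).1 x| <= K /\ `|(phi w s q r l0).1 x| <= K].
Proof.
move=> hw hs hq hr.
have [ht t0 t1] := thetaP hw hs hq hr l0; have [hp p0 p1] := phiP hw hs hq hr l0.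
have [K1 K10 k1] := ac_bounded ab (prim_ac ht.1).
have [K2 K20 k2] := ac_bounded ab (prim_ac ht.2).
have [K3 K30 k3] := ac_bounded ab (prim_ac hp.1).
have [K4 K40 k4] := ac_bounded ab (prim_ac hp.2).
pose K := K1 + K2 + K3 + K4.
exists K; first by rewrite !addr_gt0.
move=> eta eta0.
have hQ0 := in_L1_pot l0 hq hr.
pose g := coef_norm w s (pot q r l0).
have ig : in_L1 g := in_L1_coef_norm hw hs hQ0.
have inr := in_L1_norm hr.
pose M := P (fun x => `|r x|) b.
have Pge0 f : in_L1 f -> (forall t, 0 <= f t) -> 0 <= P f b.
  by move=> hf f0; rewrite -(primitive_a b f (lexx a)); apply: (prim_mono (prim_primitive hf)); rewrite ?lexx ?ltW//; exact: ae_onW.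
have M0 : 0 <= M by apply: Pge0.
pose E := expR (2 * (P g b + 1) + 2 * K).
have E0 : 0 < E := expR_gt0 _.
(* The bound 1 keeps the exponent of [sol_perturb] below that of [E]; the other bound gives
   [dl ^+ 2 * E <= eta ^+ 2]. *)
pose dl := Num.min 1 (eta / (E + 1)).
have dl0 : 0 < dl by rewrite lt_min ltr01 divr_gt0// addr_gt0.
(* The change of [l] alters the potential by at most [M] times [|l - l0|] in norm; together with the
   change of [w] and [s] this stays within [dl]. *)
exists (dl / (1 + M)); first by rewrite divr_gt0// ltr_wpDr.
move=> w' s' l hw' hs' hk hl x xab.
have hQ := in_L1_pot l hq hr.
pose k := coef_norm (fun x => w' x - w x) (fun x => s' x - s x) (fun=> 0).
have ik : in_L1 k.
  apply: in_L1_coef_norm; try exact: in_L1B.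
  by have := in_L1B hw hw; congr in_L1; apply/funext => t; rewrite subrr.
have kdl : P (coef_norm (fun x => w' x - w x) (fun x => s' x - s x)
    (fun x => pot q r l x - pot q r l0 x)) b <= dl.
  have -> : coef_norm (fun x => w' x - w x) (fun x => s' x - s x)
    (fun x => pot q r l x - pot q r l0 x) = (fun x => k x + `|l - l0| * `|r x|).
    apply/funext => t; rewrite /k /coef_norm normr0 addr0; congr (_ + _).
    by rewrite /pot -normrM -normrN; congr (`|_|); ring.
  have h := primD (prim_primitive ik) (primZ ab (`|l - l0|) (prim_primitive inr)).
  rewrite (prim_primitiveE h); [|by apply: in_L1D => //; exact: in_L1Z|by rewrite lexx ltW].
  rewrite !(primitive_a _ _ (lexx a)) mulr0 addr0 subr0 -/M.
  have := ler_wpM2r M0 hl; move: hk; rewrite -/k.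
  have : dl = dl / (1 + M) + dl / (1 + M) * M by field; rewrite gt_eqF// ltr_wpDr.
  by move: (dl / (1 + M)) => t; lra.
have g'le : P (coef_norm w' s' (pot q r l)) b <= P g b + 1.
  have hdQ := in_L1B hQ hQ0; have hdw := in_L1B hw' hw; have hds := in_L1B hs' hs.
  have ik' := in_L1_coef_norm hdw hds hdQ.
  apply: (@le_trans _ _ (P g b + dl)); last by rewrite lerD2l ge_min lexx.
  have ig' := in_L1_coef_norm hw' hs' hQ.
  have := prim_le ab (prim_primitive ig') (primD (prim_primitive ig) (prim_primitive ik')) _ (lexx a) (ltW ab) (lexx b).
  rewrite !(primitive_a _ _ (lexx a)) addr0 !subr0 => H.
  apply: (@le_trans _ _ (P g b + P (coef_norm (fun x => w' x - w x) (fun x => s' x - s x)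
    (fun x => pot q r l x - pot q r l0 x)) b)); last by rewrite lerD2l.
  apply: H; apply: ae_onW => t _; rewrite /g /coef_norm.
  have tri (u v : R) : `|u| <= `|v| + `|u - v| by rewrite -[X in `|X| <= _](subrKC v) ler_normD.
  have := tri (w' t) (w t); have := tri (s' t) (s t); have := tri (pot q r l t) (pot q r l0 t).
  lra.
have fin (u v : R) : u ^+ 2 + v ^+ 2 <= dl ^+ 2 * expR (2 * P (coef_norm w' s' (pot q r l)) b + 2 * K) ->
    `|u| <= eta /\ `|v| <= eta.
  move=> h.
  have h' : u ^+ 2 + v ^+ 2 <= eta ^+ 2.
    apply: (le_trans h); apply: (@le_trans _ _ (dl ^+ 2 * E)).
      by rewrite ler_wpM2l ?sqr_ge0// ler_expR lerD2r ler_wpM2l.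
    apply: (@le_trans _ _ (eta / (E + 1) * (eta / (E + 1)) * ((E + 1) * (E + 1)))).
      have dle : dl <= eta / (E + 1) by rewrite ge_min lexx orbT.
      have dlge0 := ltW dl0.
      apply: ler_pM; [exact: sqr_ge0|exact: ltW|by rewrite expr2; exact: ler_pM|].
      by have := sqr_ge0 E; rewrite expr2; lra.
    by rewrite le_eqVlt; apply/orP; left; apply/eqP; field; rewrite gt_eqF// addr_gt0.
  have hu := sqr_ge0 u; have hv := sqr_ge0 v.
  by split; rewrite -(ler_pXn2r (ltn0Sn 1)) ?nnegrE ?(ltW eta0)// real_normK ?num_real//; lra.
have [ht' t0' t1'] := thetaP hw' hs' hq hr l; have [hp' p0' p1'] := phiP hw' hs' hq hr l.
have [|||f1 f2] := fin _ _ (sol_perturb ab hw hs hQ0 hw' hs' hQ ht ht' _ _ _ dl0 kdl xab).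
- by rewrite t0 t0'.
- by rewrite t1 t1'.
- by move=> t tab; split; [have := k1 _ tab|have := k2 _ tab]; rewrite /K; lra.
have [|||f3 f4] := fin _ _ (sol_perturb ab hw hs hQ0 hw' hs' hQ hp hp' _ _ _ dl0 kdl xab).
- by rewrite p0 p0'.
- by rewrite p1 p1'.
- by move=> t tab; split; [have := k3 _ tab|have := k4 _ tab]; rewrite /K; lra.
by split => //; split; [have := k1 _ xab|have := k3 _ xab]; rewrite /K; lra.
Qed.

Lemma gram_stable r (y z y' z' : R -> R) (K eta : R) : in_L1 r ->
  ac a b y -> ac a b z -> ac a b y' -> ac a b z' -> 0 < eta -> eta <= 1 ->
  (forall x, a <= x <= b -> [/\ `|y x| <= K, `|z x| <= K, `|y' x - y x| <= eta & `|z' x - z x| <= eta]) ->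
  `|gram r y' z' - gram r y z| <= eta * (2 * K + 1) * P (fun x => `|r x|) b.
Proof.
move=> hr hy hz hy' hz' eta0 eta1 H.
have i1 := in_L1_rzy hr hz hy; have i2 := in_L1_rzy hr hz' hy'.
have := prim_norm_le ab (primB ab (prim_primitive i2) (prim_primitive i1))
  (primZ ab (eta * (2 * K + 1)) (prim_primitive (in_L1_norm hr))) _ (lexx a) (ltW ab) (lexx b).
rewrite !(primitive_a _ _ (lexx a)) mulr0 !subr0; apply.
apply: ae_onW => x; rewrite /= in_itv /= => /andP[ax xb].
have [|h1 h2 h3 h4] := H x; first by rewrite !ltW.
have -> : r x * (y' x * z' x) - r x * (y x * z x) =
  ((y' x - y x) * z x + (z' x - z x) * y x + (y' x - y x) * (z' x - z x)) * r x by ring.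
rewrite normrM ler_wpM2r//.
apply: (le_trans (ler_normD _ _)); apply: (le_trans (lerD (ler_normD _ _) (lexx _))).
rewrite !normrM.
have := ler_pM (normr_ge0 _) (normr_ge0 _) h3 h2.
have := ler_pM (normr_ge0 _) (normr_ge0 _) h4 h1.
have := ler_pM (normr_ge0 _) (normr_ge0 _) h3 (le_trans h4 eta1).
lra.
Qed.

Lemma fundamental_cvg (w_ s_ : nat -> R -> R) w s q r l0 :
  (forall m, in_L1 (w_ m)) -> (forall m, in_L1 (s_ m)) ->
  in_L1 w -> in_L1 s -> in_L1 q -> in_L1 r ->
  P (coef_norm (fun x => w_ m x - w x) (fun x => s_ m x - s x) (fun=> 0)) b @[m --> \oo] --> 0 ->
  fund_data_cvg (fun m => fundamental (w_ m) (s_ m) q r) (fundamental w s q r) l0.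
Proof.
move=> hw_ hs_ hw hs hq hr cv.
have [K K0 H] := fundamental_stable l0 hw hs hq hr.
have bab : a <= b <= b by rewrite lexx ltW.
have ex eta : 0 < eta -> exists2 d, 0 < d & exists N, forall m l, (N <= m)%N -> `|l - l0| < d ->
    forall x, a <= x <= b ->
    [/\ `|(theta (w_ m) (s_ m) q r l).1 x - (theta w s q r l0).1 x| <= eta,
       `|(theta (w_ m) (s_ m) q r l).2 x - (theta w s q r l0).2 x| <= eta,
       `|(phi (w_ m) (s_ m) q r l).1 x - (phi w s q r l0).1 x| <= eta,
       `|(phi (w_ m) (s_ m) q r l).2 x - (phi w s q r l0).2 x| <= eta &
       `|(theta w s q r l0).1 x| <= K /\ `|(phi w s q r l0).1 x| <= K].
  move=> /H[d d0 hd]; exists d => //.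
  move/cvgrPdist_le : cv => /(_ _ d0)[N _ hN]; exists N => m l Nm ld x xab.
  apply: hd => //; last exact: ltW.
  by have := hN m Nm; rewrite /= sub0r normrN => /(le_trans (ler_norm _)).
have acs m l : [/\ ac a b (theta (w_ m) (s_ m) q r l).1, ac a b (phi (w_ m) (s_ m) q r l).1,
    ac a b (theta w s q r l0).1 & ac a b (phi w s q r l0).1].
  have [[h1 _] _ _] := thetaP (hw_ m) (hs_ m) hq hr l.
  have [[h2 _] _ _] := phiP (hw_ m) (hs_ m) hq hr l.
  have [[h3 _] _ _] := thetaP hw hs hq hr l0; have [[h4 _] _ _] := phiP hw hs hq hr l0.
  by split; apply: prim_ac; eassumption.
split.
  split=> e e0; have e20 : 0 < e / 2 by rewrite divr_gt0.
  - have [d d0 [N h]] := ex _ e20; exists d => //; exists N => m l1 l2 Nm ld _ /=.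
    have [h1 _ _ _ _] := h m l1 Nm ld b bab; lra.
  - have [d d0 [N h]] := ex _ e20; exists d => //; exists N => m l1 l2 Nm ld _ /=.
    have [_ _ h1 _ _] := h m l1 Nm ld b bab; lra.
  - have [d d0 [N h]] := ex _ e20; exists d => //; exists N => m l1 l2 Nm ld _ /=.
    have [_ h1 _ _ _] := h m l1 Nm ld b bab; lra.
  - have [d d0 [N h]] := ex _ e20; exists d => //; exists N => m l1 l2 Nm ld _ /=.
    have [_ _ _ h1 _] := h m l1 Nm ld b bab; lra.
pose M := P (fun x => `|r x|) b.
have M0 : 0 <= M.
  rewrite -(primitive_a b (fun x => `|r x|) (lexx a)).
  by apply: (prim_mono (prim_primitive (in_L1_norm hr))); rewrite ?lexx ?ltW//; exact: ae_onW.
have ex2 e : 0 < e -> exists2 eta, 0 < eta <= 1 & eta * (2 * K + 1) * M < e.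
  move=> e0; have D0 : 0 < (2 * K + 1) * M + 1 by rewrite ltr_wpDl// mulr_ge0// addr_ge0// mulr_ge0// ltW.
  exists (Num.min 1 (e / ((2 * K + 1) * M + 1))).
    by rewrite lt_min ltr01 divr_gt0//= ge_min lexx.
  rewrite -mulrA.
  apply: (@le_lt_trans _ _ (e / ((2 * K + 1) * M + 1) * ((2 * K + 1) * M))).
    by rewrite ler_wpM2r ?ge_min ?lexx ?orbT// mulr_ge0// addr_ge0// mulr_ge0// ltW.
  by rewrite mulrAC ltr_pdivrMr// ltr_pM2l// ltrDl.
split=> e e0; have [eta /andP[eta0 eta1] he] := ex2 _ e0;
  have [d d0 [N h]] := ex _ eta0; exists d => //; exists N => m l1 l2 Nm ld1 ld2 /=;
  apply: le_lt_trans he; have [? ? ? ?] := acs m l1; have [? ? ? ?] := acs m l2;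
  apply: gram_stable => // x xab;
  have [? ? ? ? [? ?]] := h m l1 Nm ld1 x xab; have [? ? ? ? [? ?]] := h m l2 Nm ld2 x xab; by split.
Qed.

(** With constant coefficients, convergence of the data is their continuity in the spectral
    parameters at [l0]. *)
Lemma fundamental_cvg_cst w s q r l0 : in_L1 w -> in_L1 s -> in_L1 q -> in_L1 r ->
  fund_data_cvg (fun=> fundamental w s q r) (fundamental w s q r) l0.
Proof.
move=> hw hs hq hr; apply: fundamental_cvg => //.
have -> : coef_norm (fun x => w x - w x) (fun x => s x - s x) (fun=> 0) = (fun=> 0).
  by apply/funext => x; rewrite /coef_norm !subrr !normr0 !addr0.
rewrite [X in _ --> X](_ : 0 = P (fun=> 0) b); first exact: cvg_cst.
have z1 : in_L1 (fun=> 0).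
  by have := in_L1B hw hw; congr in_L1; apply/funext => t; rewrite subrr.
by rewrite (prim_primitiveE (prim_cst a b 0) z1) ?subrr// lexx ltW.
Qed.

Lemma fundamental_continuous w s q r : in_L1 w -> in_L1 s -> in_L1 q -> in_L1 r ->
  fund_data_continuous (fundamental w s q r).
Proof.
move=> hw hs hq hr.
suff H (f : fund_data -> R -> R) : (forall l0, tends l0 (fun _ l _ => f (fundamental w s q r) l) (f (fundamental w s q r) l0)) ->
    continuous (f (fundamental w s q r)).
  by split; [apply: (H (@f11 R))|apply: (H (@f12 R))|apply: (H (@f21 R))|apply: (H (@f22 R))];
    move=> l0; have [[? ? ? ?] _] := fundamental_cvg_cst l0 hw hs hq hr.
move=> hf l0; apply/cvgrPdist_lt => e /(hf l0)[d d0 [N h]].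
near=> l; rewrite distrC; apply: (h N l l) => //;
 (rewrite distrC; near: l; apply: (@cvgr_dist_lt _ _ _ _ _ id)) => //.
Unshelve. all: by end_near. Qed.

End FundamentalData.

Local Open Scope complex_scope.

(** * Self-adjoint boundary conditions *)

Section BoundaryCondition.
Context {R : realType}.
Local Notation C := R[i].
Implicit Types (A B : 'M[C]_2).

Lemma conjc_real (z : C) : conjc z = z -> z = (complex.Re z)%:C.
Proof.
case: z => x y [] /eqP; rewrite eq_sym -addr_eq0 -mulr2n mulrn_eq0 /= => /eqP ->.
by [].
Qed.

Definition mx2 {T : Type} (x y z t : T) : 'M[T]_2 :=
  \matrix_(i < 2, j < 2) if i == 0 then (if j == 0 then x else y)
                                else (if j == 0 then z else t).

Lemma mx2E {T : Type} (M : 'M[T]_2) : M = mx2 (M 0 0) (M 0 1) (M 1 0) (M 1 1).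
Proof.
apply/matrixP => i j; rewrite mxE; case: i => [[|[|//]] hi]; case: j => [[|[|//]] hj] /=;
  by congr (M _ _); apply: val_inj.
Qed.

Lemma mulmx2 {T : pzRingType} (x y z t x' y' z' t' : T) :
  mx2 x y z t *m mx2 x' y' z' t' =
  mx2 (x * x' + y * z') (x * y' + y * t') (z * x' + t * z') (z * y' + t * t').
Proof.
apply/matrixP => i j; rewrite !mxE big_ord_recl big_ord1 !mxE /=.
by case: (i == 0); case: (j == 0).
Qed.

Lemma mx2_inj {T : Type} (x y z t x' y' z' t' : T) : mx2 x y z t = mx2 x' y' z' t' ->
  [/\ x = x', y = y', z = z' & t = t'].
Proof.
move=> /matrixP h; have := h 0 0; have := h 0 1; have := h 1 0; have := h 1 1.
by rewrite !mxE.
Qed.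

Lemma det_mx2 {T : comPzRingType} (x y z t : T) : \det (mx2 x y z t) = x * t - y * z.
Proof.
rewrite (expand_det_row _ 0) !big_ord_recl big_ord0 /cofactor !det_mx11 !mxE /=.
by rewrite expr0 expr1 mul1r mulN1r addr0 mulrN.
Qed.

Lemma Emx_mx2 : Emx = mx2 (0 : C) (-1) 1 0.
Proof.
apply/matrixP => i j; rewrite !mxE.
by case: i => [[|[|//]] hi]; case: j => [[|[|//]] hj].
Qed.

Lemma adjoint_mx2 (x y z t : C) : adjoint_mx (mx2 x y z t) =
  mx2 (conjc x) (conjc z) (conjc y) (conjc t).
Proof.
apply/matrixP => i j; rewrite !mxE.
by case: (i == 0); case: (j == 0).
Qed.

Lemma adjoint_mxM A B : adjoint_mx (A *m B) = adjoint_mx B *m adjoint_mx A.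
Proof. by rewrite /adjoint_mx trmx_mul map_mxM. Qed.

Lemma conjcM (x y : C) : conjc (x * y) = conjc x * conjc y.
Proof. exact: rmorphM. Qed.

Lemma row2_neq0 (u : 'rV[C]_2) : u != 0 -> (u 0 0 != 0) || (u 0 1 != 0).
Proof.
apply: contra_neqT; rewrite negb_or !negbK => /andP[/eqP u0 /eqP u1].
apply/rowP => i; rewrite mxE; case: i => [[|[|//]] hi].
  by rewrite -[RHS]u0; congr (u _ _); apply: val_inj.
by rewrite -[RHS]u1; congr (u _ _); apply: val_inj.
Qed.

(* A vector of C^2 that is isotropic for [E] is a multiple of a real one. *)
Lemma isotropic_real (x y : C) : y * conjc x = x * conjc y -> (x != 0) || (y != 0) ->
  exists (m : C) (al be : R), [/\ m != 0, (al != 0) || (be != 0), x = m * al%:C & y = m * be%:C].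
Proof.
move=> h; have [->|x0 _] := eqVneq x 0 => /=.
  move=> y0; exists y, 0, 1; split => //; first by rewrite oner_neq0 orbT.
    by rewrite mulr0.
  by rewrite mulr1.
exists x, 1, (complex.Re (y / x)); split => //; first by rewrite oner_neq0.
  by rewrite mulr1.
rewrite -conjc_real ?conjc_real; last first.
  rewrite conjcM conjc_inv; apply: (mulIf x0); rewrite divfK//.
  apply: (mulIf (_ : conjc x != 0)); first by rewrite conjc_eq0.
  by rewrite h mulrAC divfK ?conjc_eq0// mulrC.
by rewrite mulrC divfK.
Qed.

(** The classical dichotomy: coupled conditions Y(b) = ka K Y(a) with |ka| = 1 and K real of
    determinant 1, or one real condition at each end point. The invertible factor [S] changes
    neither the condition nor any rank. *)
Variant bc_normal_form A B : Prop :=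
| BCCoupled (S : 'M[C]_2) (ka : C) (k11 k12 k21 k22 : R) of
    S \in unitmx & ka * conjc ka = 1 & k11 * k22 - k12 * k21 = 1 &
    S *m A = - mx2 (ka * k11%:C) (ka * k12%:C) (ka * k21%:C) (ka * k22%:C) &
    S *m B = 1%:M
| BCSeparated (S : 'M[C]_2) (al1 al2 be1 be2 : R) of
    S \in unitmx & (al1 != 0) || (al2 != 0) & (be1 != 0) || (be2 != 0) &
    S *m A = mx2 al1%:C al2%:C 0 0 & S *m B = mx2 0 0 be1%:C be2%:C.

(** Determinants give |det A| = |det B|. If B is invertible, K = - B^-1 A preserves E, so every
    entry z of K satisfies conj z det K = z, and dividing by a square root [ka] of det K makes K
    real. Otherwise left null vectors of B and of A decouple the end points; the rows they leave are
    isotropic for E and thus proportional to real ones. *)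
Lemma bc_normal A B : selfadjoint_bc A B -> bc_normal_form A B.
Proof.
move=> [rk sa].
have detE : \det (Emx : 'M[C]_2) = 1 by rewrite Emx_mx2 det_mx2 !mul0r mulr1 sub0r opprK.
have detadj (M : 'M[C]_2) : \det (adjoint_mx M) = conjc (\det M).
  by rewrite /adjoint_mx det_map_mx det_tr.
have dd : \det A * conjc (\det A) = \det B * conjc (\det B).
  by have := congr1 determinant sa; rewrite !det_mulmx !detadj detE !mulr1.
have [B0|B0] := eqVneq (\det B) 0; last first.
  have uB : B \in unitmx by rewrite unitmxE unitfE.
  pose K := - (invmx B *m A).
  have hK : K *m Emx *m adjoint_mx K = Emx.
    have aN (M : 'M[C]_2) : adjoint_mx (- M) = - adjoint_mx M.
      by apply/matrixP => i j; rewrite !mxE rmorphN.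
    rewrite /K aN mulmxN !mulNmx opprK adjoint_mxM.
    rewrite -!mulmxA (mulmxA A) (mulmxA (A *m Emx)) sa -!mulmxA.
    rewrite mulKmx// -adjoint_mxM mulVmx//.
    have -> : adjoint_mx 1%:M = (1%:M : 'M[C]_2).
      by rewrite /adjoint_mx trmx1 map_mx1.
    by rewrite mulmx1.
  move: hK; rewrite (mx2E K) Emx_mx2 adjoint_mx2 !mulmx2.
  set a := K 0 0; set b := K 0 1; set c := K 1 0; set d := K 1 1.
  rewrite !mulr0 !mulr1 !mulrN1 !addr0 !add0r => H; have [e1 e2 e3 e4] := mx2_inj H.
  pose dl := a * d - b * c.
  have h1 : conjc a * dl = a.
    have -> : conjc a * dl = a * (d * conjc a + - c * conjc b) - c * (b * conjc a + - a * conjc b) by rewrite /dl; ring.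
    by rewrite e3 e1; ring.
  have h2 : conjc b * dl = b.
    have -> : conjc b * dl = d * - (b * conjc a + - a * conjc b) + b * (d * conjc a + - c * conjc b) by rewrite /dl; ring.
    by rewrite e3 e1; ring.
  have h3 : conjc c * dl = c.
    have -> : conjc c * dl = a * (d * conjc c + - c * conjc d) - c * (b * conjc c + - a * conjc d) by rewrite /dl; ring.
    by rewrite e2 e4; ring.
  have h4 : conjc d * dl = d.
    have -> : conjc d * dl = - d * (b * conjc c + - a * conjc d) + b * (d * conjc c + - c * conjc d) by rewrite /dl; ring.
    by rewrite e2 e4; ring.
  have dl0 : dl != 0.
    apply/eqP => dl0; move: e3; rewrite -h4 -h3 dl0 !mulr0 oppr0 !mul0r addr0 => /esym/eqP.
    by rewrite oner_eq0.
  have dl1 : dl * conjc dl = 1.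
    apply: (mulIf dl0); rewrite mul1r.
    have -> : dl * conjc dl * dl = conjc a * dl * (conjc d * dl) - conjc b * dl * (conjc c * dl).
      by rewrite {2}/dl rmorphB /= !rmorphM /=; ring.
    by rewrite h1 h2 h3 h4.
  pose ka := sqrtc dl.
  have ka2 : ka ^+ 2 = dl by rewrite sqr_sqrtc.
  have ka0 : ka != 0 by apply: contraNneq dl0 => ka0; rewrite -ka2 ka0 expr0n.
  have ka1 : ka * conjc ka = 1.
    have p0 : 0 <= ka * conjc ka := mulcJ_ge0 ka.
    apply/eqP; rewrite -(eqrXn2 (ltn0Sn 1) p0 ler01) expr1n; apply/eqP.
    by rewrite -dl1 -ka2 !expr2 rmorphM /=; ring.
  have real z : conjc z * dl = z -> ka * (complex.Re (z / ka))%:C = z.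
    move=> hz; rewrite -conjc_real; first by rewrite mulrC divfK.
    have cka : conjc ka = ka^-1 by apply: (mulfI ka0); rewrite ka1 divff.
    rewrite conjcM conjc_inv cka invrK; apply: (mulIf ka0); rewrite divfK//.
    by rewrite -mulrA -expr2 ka2.
  apply: (@BCCoupled _ _ (invmx B) ka (complex.Re (a / ka)) (complex.Re (b / ka))
     (complex.Re (c / ka)) (complex.Re (d / ka))).
  - by rewrite unitmx_inv.
  - exact: ka1.
  - suff : (complex.Re (a / ka) * complex.Re (d / ka) -
      complex.Re (b / ka) * complex.Re (c / ka))%:C = 1.
      by move=> /(congr1 (@complex.Re R)).
    rewrite rmorphB !rmorphM /=; apply: (mulfI (expf_neq0 2 ka0)).
    transitivity ((ka * (complex.Re (a / ka))%:C) * (ka * (complex.Re (d / ka))%:C) -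
      (ka * (complex.Re (b / ka))%:C) * (ka * (complex.Re (c / ka))%:C)); first by ring.
    by rewrite !real// mulr1 ka2.
  - by rewrite !real// -mx2E /K opprK.
  - by rewrite mulVmx.
have A0 : \det A = 0.
  by move: dd; rewrite B0 mul0r => /eqP; rewrite mulf_eq0 conjc_eq0 orbb => /eqP.
have /det0P[l l0 lA] := introT eqP A0; have /det0P[k k0 kB] := introT eqP B0.
have frk : row_free (row_mx A B) by rewrite /row_free rk.
have notboth (v : 'rV[C]_2) : v *m A = 0 -> v *m B = 0 -> v = 0.
  move=> vA vB; apply/eqP; rewrite -(mulmx_free_eq0 _ frk) mul_mx_row vA vB.
  by rewrite row_mx0.
have kA0 : k *m A != 0 by apply: contraNneq k0 => kA; rewrite (notboth k).
have lB0 : l *m B != 0 by apply: contraNneq l0 => lB; rewrite (notboth l).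
have iso (v : 'rV[C]_2) (M M' : 'M[C]_2) :
    M *m Emx *m adjoint_mx M = M' *m Emx *m adjoint_mx M' -> v *m M' = 0 ->
    (v *m M) 0 1 * conjc ((v *m M) 0 0) = (v *m M) 0 0 * conjc ((v *m M) 0 1).
  move=> hM vM'.
  have : v *m M *m Emx *m (map_mx conjc (v *m M)^T) = 0.
    have -> : map_mx conjc (v *m M)^T = adjoint_mx M *m map_mx conjc v^T.
      by rewrite trmx_mul map_mxM.
    by rewrite mulmxA -(mulmxA v) -(mulmxA v) hM -!mulmxA (mulmxA v) vM' mul0mx.
  move: (v *m M) => u /matrixP /(_ 0 0); rewrite Emx_mx2 !mxE !big_ord_recl big_ord0.
  rewrite !mxE !big_ord_recl !big_ord0 !mxE /=.
  have -> : lift ord0 ord0 = 1 :> 'I_2 by apply: val_inj.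
  by rewrite !mulr0 !mulr1 !addr0 !add0r mulrN1 mulNr => /eqP; rewrite subr_eq0 => /eqP.
have [m [al1 [al2 [m0 al0 u1 u2]]]] := isotropic_real (iso k A B sa kB) (row2_neq0 kA0).
have [n [be1 [be2 [n0 be0 v1 v2]]]] := isotropic_real (iso l B A (esym sa) lA) (row2_neq0 lB0).
pose S : 'M[C]_2 := \matrix_(i, j) if i == 0 then m^-1 * k 0 j else n^-1 * l 0 j.
have SM (M : 'M[C]_2) : S *m M = mx2 (m^-1 * (k *m M) 0 0) (m^-1 * (k *m M) 0 1)
     (n^-1 * (l *m M) 0 0) (n^-1 * (l *m M) 0 1).
  apply/matrixP => i j; rewrite !mxE !big_ord_recl !big_ord0 !mxE /=.
  by case: i => [[|[|//]] hi]; case: j => [[|[|//]] hj] /=;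
    rewrite !mulrDr !mulrA !mulr0 !addr0; congr (_ * M _ _ + _ * M _ _); apply: val_inj.
have z0 : ((0 : 'rV[C]_2) 0 0 = 0) * ((0 : 'rV[C]_2) 0 1 = 0) by rewrite !mxE.
have SA : S *m A = mx2 al1%:C al2%:C 0 0.
  by rewrite SM lA !z0 u1 u2 !mulKf// !mulr0.
have SB : S *m B = mx2 0 0 be1%:C be2%:C.
  by rewrite SM kB !z0 v1 v2 !mulKf// !mulr0.
apply: (BCSeparated _ al0 be0 SA SB).
rewrite unitmxE unitfE; apply/det0P => -[v v0 vS].
have vSA : v *m (S *m A) = 0 by rewrite mulmxA vS mul0mx.
have vSB : v *m (S *m B) = 0 by rewrite mulmxA vS mul0mx.
have vE j (x y : C) (M : 'M[C]_2) : v *m M = 0 -> M 0 j = x -> M 1 j = y ->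
   v 0 0 * x + v 0 1 * y = 0.
  move=> /matrixP /(_ 0 j); rewrite !mxE !big_ord_recl big_ord0 addr0.
  have -> : lift ord0 ord0 = 1 :> 'I_2 by apply: val_inj.
  by move=> + <- <-.
have rc (x : R) : (x%:C == 0) = (x == 0) by rewrite eq_complex /= eqxx andbT.
have v00 : v 0 0 = 0.
  rewrite SA in vSA.
  have := vE 0 _ _ _ vSA (mxE _ _ _ _) (mxE _ _ _ _).
  have := vE 1 _ _ _ vSA (mxE _ _ _ _) (mxE _ _ _ _).
  rewrite /= !mulr0 !addr0 => /eqP + /eqP; rewrite !mulf_eq0 !rc.
  by move: al0; case: (v 0 0 =P 0) => //= _ /orP[/negPf ->|/negPf ->].
have v01 : v 0 1 = 0.
  rewrite SB in vSB.
  have := vE 0 _ _ _ vSB (mxE _ _ _ _) (mxE _ _ _ _).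
  have := vE 1 _ _ _ vSB (mxE _ _ _ _) (mxE _ _ _ _).
  rewrite /= !mulr0 !add0r => /eqP + /eqP; rewrite !mulf_eq0 !rc.
  by move: be0; case: (v 0 1 =P 0) => //= _ /orP[/negPf ->|/negPf ->].
by have := row2_neq0 v0; rewrite v00 v01 eqxx.
Qed.

Definition Fmx (D : fund_data) (l : R) : 'M[C]_2 :=
  mx2 (f11 D l)%:C (f12 D l)%:C (f21 D l)%:C (f22 D l)%:C.

Definition Tmx A B (D : fund_data) (l : R) : 'M[C]_2 := A + B *m Fmx D l.

Lemma rank_mx2_det (M : 'M[C]_2) : (\det M != 0 -> \rank M = 2%N) /\
  (\det M = 0 -> M != 0 -> \rank M = 1%N).
Proof.
split=> [d|d M0]; first by apply: mxrank_unit; rewrite unitmxE unitfE.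
have : \rank M != 0%N by rewrite mxrank_eq0.
have : \rank M != 2%N.
  apply: contra_eqN d => /eqP rM; rewrite -unitfE -unitmxE -row_free_unit /row_free rM.
  by [].
by have := rank_leq_row M; case: (\rank M) => [|[|[|]]].
Qed.

Lemma addmx2 {T : zmodType} (x y z t x' y' z' t' : T) :
  mx2 x y z t + mx2 x' y' z' t' = mx2 (x + x') (y + y') (z + z') (t + t').
Proof. by apply/matrixP => i j; rewrite !mxE; case: (i == 0); case: (j == 0). Qed.

Lemma oppmx2 {T : zmodType} (x y z t : T) :
  - mx2 x y z t = mx2 (- x) (- y) (- z) (- t).
Proof. by apply/matrixP => i j; rewrite !mxE; case: (i == 0); case: (j == 0). Qed.

Lemma mx2_0 {T : zmodType} : mx2 0 0 0 0 = 0 :> 'M[T]_2.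
Proof. by apply/matrixP => i j; rewrite !mxE; case: (i == 0); case: (j == 0). Qed.

(** In the coupled case P is minus the adjugate of K, and det (F - ka K) = ka (2 Re ka + tr (P F))
    because both determinants are 1 and |ka| = 1; rank 0 means F = ka K, which forces ka to be real.
    In the separated case P is the column (- al2, al1) times the row (be1, be2), of rank one, so X
    is singular and nonzero and cannot be scalar. *)
Lemma bc_rank A B : selfadjoint_bc A B -> exists d0 p11 p12 p21 p22 : R,
  d0 ^+ 2 <= 4 * (p11 * p22 - p12 * p21) /\
  forall D l, lagrange D ->
    [/\ charfun d0 p11 p12 p21 p22 D l != 0 -> \rank (Tmx A B D l) = 2%N,
        charfun d0 p11 p12 p21 p22 D l = 0 -> ~ scalarx p11 p12 p21 p22 D l ->
          \rank (Tmx A B D l) = 1%N &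
        charfun d0 p11 p12 p21 p22 D l = 0 -> scalarx p11 p12 p21 p22 D l ->
          \rank (Tmx A B D l) = 0%N /\ x11 p11 p12 D l != 0].
Proof.
move=> sa.
have rS (S M : 'M[C]_2) : S \in unitmx -> \rank M = \rank (S *m M).
  by move=> uS; rewrite (eqmxMfull M (_ : row_full S))// row_full_unit.
case: (bc_normal sa) => [S ka k11 k12 k21 k22 uS ka1 kd SA SB|S al1 al2 be1 be2 uS al0 be0 SA SB].
  exists (2 * complex.Re ka), (- k22), k12, k21, (- k11); split.
    have -> : - k22 * - k11 - k12 * k21 = 1 by rewrite -kd; ring.
    move: ka1; case: (ka) => x y [] /= h _.
    have := sqr_ge0 y; rewrite exprMn; move: h; rewrite !expr2; lra.
  move=> D l [/(_ l) fdet _].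
  have ST : S *m Tmx A B D l = mx2 ((f11 D l)%:C - ka * k11%:C) ((f12 D l)%:C - ka * k12%:C)
     ((f21 D l)%:C - ka * k21%:C) ((f22 D l)%:C - ka * k22%:C).
    rewrite /Tmx mulmxDr mulmxA SA SB mul1mx oppmx2 /Fmx addmx2.
    by congr mx2; rewrite addrC.
  have detT : \det (S *m Tmx A B D l) =
     ka * (charfun (2 * complex.Re ka) (- k22) k12 k21 (- k11) D l)%:C.
    rewrite ST det_mx2.
    have kdC : k11%:C * k22%:C - k12%:C * k21%:C = 1 :> C by rewrite -!rmorphM -rmorphB /= kd.
    have fdC : (f11 D l)%:C * (f22 D l)%:C - (f12 D l)%:C * (f21 D l)%:C = 1 :> C.
      by rewrite -!rmorphM -rmorphB /= fdet.
    have -> : (charfun (2 * complex.Re ka) (- k22) k12 k21 (- k11) D l)%:C =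
       (ka + conjc ka) - k22%:C * (f11 D l)%:C + k12%:C * (f21 D l)%:C
        + k21%:C * (f12 D l)%:C - k11%:C * (f22 D l)%:C.
      by rewrite addcJ /charfun /x11 /x22 !rmorphD /= !rmorphM /= !rmorphN /= rmorph_nat; ring.
    transitivity ((f11 D l)%:C * (f22 D l)%:C - (f12 D l)%:C * (f21 D l)%:C +
      ka ^+ 2 * (k11%:C * k22%:C - k12%:C * k21%:C) - ka * (k22%:C * (f11 D l)%:C
       - k12%:C * (f21 D l)%:C - k21%:C * (f12 D l)%:C + k11%:C * (f22 D l)%:C)); first by ring.
    by rewrite kdC fdC mulr1 -ka1; ring.
  have ka0 : ka != 0 by apply: contra_eq_neq ka1 => ->; rewrite mul0r eq_sym oner_neq0.
  have rc (x : R) : (x%:C == 0) = (x == 0) by rewrite eq_complex /= eqxx andbT.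
  have [r2 r1] := rank_mx2_det (S *m Tmx A B D l).
  rewrite (rS S (Tmx A B D l))//; split.
  - by move=> d0; apply: r2; rewrite detT mulf_neq0// rc.
  - move=> d0 ns; apply: r1; first by rewrite detT d0 mulr0.
    apply/eqP => T0; apply: ns; move: T0; rewrite ST -mx2_0 => H.
    have [/eqP h1 /eqP h2 /eqP h3 /eqP h4] := mx2_inj H.
    rewrite !subr_eq0 in h1 h2 h3 h4.
    split; rewrite /x11 /x12 /x21 /x22.
    + suff : (- k22 * f12 D l + k12 * f22 D l)%:C = 0 by move=> /eqP; rewrite rc => /eqP.
      by rewrite rmorphD !rmorphM /= (eqP h2) (eqP h4) rmorphN; ring.
    + suff : (k21 * f11 D l + - k11 * f21 D l)%:C = 0 by move=> /eqP; rewrite rc => /eqP.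
      by rewrite rmorphD !rmorphM /= (eqP h1) (eqP h3) rmorphN; ring.
    + suff : ((- k22 * f11 D l + k12 * f21 D l) - (k21 * f12 D l + - k11 * f22 D l))%:C = 0.
        by move=> /eqP; rewrite rc subr_eq0 => /eqP.
      by rewrite rmorphB !rmorphD !rmorphM /= (eqP h1) (eqP h2) (eqP h3) (eqP h4) !rmorphN; ring.
  - move=> d0 [s1 s2 s3].
    set x := x11 (- k22) k12 D l.
    have xx : x ^+ 2 = 1.
      have : x11 (- k22) k12 D l * x22 k21 (- k11) D l - x12 (- k22) k12 D l * x21 k21 (- k11) D l = 1.
        rewrite -[RHS]mulr1 -{1}kd -fdet /x11 /x12 /x21 /x22; ring.
      by rewrite s1 -s3 mul0r subr0 -/x expr2.
    have x0 : x != 0 by rewrite -sqrf_eq0 xx oner_neq0.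
    have re : complex.Re ka = - x by move: d0; rewrite /charfun -s3 -/x; lra.
    have kax : ka = (- x)%:C.
      move: ka1 re; case: (ka) => u v [] /= h _ ux; rewrite ux in h *; congr (_ +i* _).
      have : v ^+ 2 = 0 by rewrite -[RHS](subrr (x ^+ 2)) {1}xx -h; ring.
      by move=> /eqP; rewrite sqrf_eq0 => /eqP.
    split => //; apply/eqP; rewrite mxrank_eq0 ST kax -mx2_0 -!rmorphM -!rmorphB /=; apply/eqP.
    have e (u : R) : u = 0 -> u%:C = 0 by move=> ->.
    have F (u : R) : u = u * (k11 * k22 - k12 * k21) by rewrite kd mulr1.
    congr mx2; apply: e.
    + rewrite [X in X - _]F (_ : _ - _ = - (k11 * (x11 (- k22) k12 D l - x) + k12 * x21 k21 (- k11) D l));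
        last by rewrite /x11 /x21; ring.
      by rewrite s2 /x subrr !mulr0 addr0 oppr0.
    + rewrite [X in X - _]F (_ : _ - _ = - (k11 * x12 (- k22) k12 D l + k12 * (x22 k21 (- k11) D l - x)));
        last by rewrite /x12 /x22; ring.
      by rewrite s1 /x s3 subrr !mulr0 addr0 oppr0.
    + rewrite [X in X - _]F (_ : _ - _ = - (k21 * (x11 (- k22) k12 D l - x) + k22 * x21 k21 (- k11) D l));
        last by rewrite /x11 /x21; ring.
      by rewrite s2 /x subrr !mulr0 addr0 oppr0.
    + rewrite [X in X - _]F (_ : _ - _ = - (k21 * x12 (- k22) k12 D l + k22 * (x22 k21 (- k11) D l - x)));
        last by rewrite /x12 /x22; ring.
      by rewrite s1 /x s3 subrr !mulr0 addr0 oppr0.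
exists 0, (- al2 * be1), (- al2 * be2), (al1 * be1), (al1 * be2); split.
  by rewrite expr0n /= (_ : _ - _ = 0) ?mulr0//; ring.
move=> D l [/(_ l) fdet _].
pose c1 := be1 * f11 D l + be2 * f21 D l; pose c2 := be1 * f12 D l + be2 * f22 D l.
have ST : S *m Tmx A B D l = mx2 al1%:C al2%:C c1%:C c2%:C.
  rewrite /Tmx mulmxDr mulmxA SA SB /Fmx mulmx2 addmx2 !mul0r !add0r !addr0.
  by rewrite /c1 /c2 !rmorphD !rmorphM.
have rc (x : R) : (x%:C == 0) = (x == 0) by rewrite eq_complex /= eqxx andbT.
have detT : \det (S *m Tmx A B D l) =
   (charfun 0 (- al2 * be1) (- al2 * be2) (al1 * be1) (al1 * be2) D l)%:C.
  rewrite ST det_mx2 -!rmorphM -rmorphB; congr (_%:C).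
  by rewrite /charfun /x11 /x22 /c1 /c2; ring.
have [r2 r1] := rank_mx2_det (S *m Tmx A B D l).
rewrite (rS S (Tmx A B D l))//; split.
- by move=> d0; apply: r2; rewrite detT rc.
- move=> d0 _; apply: r1; first by rewrite detT d0.
  apply/eqP; rewrite ST -mx2_0 => H; have [/eqP h1 /eqP h2 _ _] := mx2_inj H.
  by move: al0; rewrite -!rc h1 h2.
- move=> _ [s1 s2 s3]; exfalso.
  have e1 : al2 * c2 = 0 by rewrite -[RHS]oppr0 -s1 /x12 /c2; ring.
  have e2 : al1 * c1 = 0 by rewrite -s2 /x21 /c1; ring.
  have e3 : al2 * c1 + al1 * c2 = 0.
    by move/eqP: s3; rewrite -subr_eq0 => /eqP s3; rewrite -[RHS]oppr0 -s3 /x11 /x22 /c1 /c2; ring.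
  have c0 : c1 = 0 /\ c2 = 0.
    have [a10|a10] := eqVneq al1 0.
      have a20 : al2 != 0 by move: al0; rewrite a10 eqxx.
      move: e1 e3; rewrite a10 mul0r addr0 => /eqP + /eqP.
      by rewrite !mulf_eq0 (negbTE a20) => /eqP -> /eqP ->.
    have c10 : c1 = 0 by move/eqP: e2; rewrite mulf_eq0 (negbTE a10) => /eqP.
    by move: e3; rewrite c10 mulr0 add0r => /eqP; rewrite mulf_eq0 (negbTE a10) => /eqP ->.
  case: c0 => c10 c20.
  have b1 : be1 = 0.
    transitivity (f22 D l * c1 - f21 D l * c2); last by rewrite c10 c20 !mulr0 subrr.
    by rewrite -[LHS]mulr1 -fdet /c1 /c2; ring.
  have b2 : be2 = 0.
    transitivity (f11 D l * c2 - f12 D l * c1); last by rewrite c10 c20 !mulr0 subrr.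
    by rewrite -[LHS]mulr1 -fdet /c1 /c2; ring.
  by move: be0; rewrite b1 b2 eqxx.
Qed.

Definition cv2 (u1 u2 : C) : 'cV[C]_2 := \col_(i < 2) (if i == 0 then u1 else u2).

Lemma mulmx2_cv (x y z t u1 u2 : C) :
  mx2 x y z t *m cv2 u1 u2 = cv2 (x * u1 + y * u2) (z * u1 + t * u2).
Proof.
apply/matrixP => i j; rewrite !mxE big_ord_recl big_ord1 !mxE /=.
by case: (i == 0).
Qed.

Lemma cv2_inj (u1 u2 v1 v2 : C) : cv2 u1 u2 = cv2 v1 v2 -> u1 = v1 /\ u2 = v2.
Proof. by move=> /matrixP h; have := h 0 0; have := h 1 0; rewrite !mxE. Qed.

(** The left-hand side is the boundary term of Re (y1 conj y) under the boundary condition. In the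
    coupled case with k12 != 0, the quasi-derivatives can be expressed by the values at both ends;
    with k12 = 0, the mixed term cancels because k11 k22 = 1. In the separated case, at each end
    either y vanishes or y1 is a fixed multiple of y. *)
Lemma bc_form_bound A B : selfadjoint_bc A B -> exists2 C0 : R, 0 <= C0 &
  forall u1 u2 v1 v2 : C, A *m cv2 u1 u2 + B *m cv2 v1 v2 = 0 ->
   (complex.Re v1 * complex.Re v2 + complex.Im v1 * complex.Im v2) -
   (complex.Re u1 * complex.Re u2 + complex.Im u1 * complex.Im u2) <=
   C0 * (complex.Re u1 ^+ 2 + complex.Im u1 ^+ 2 + complex.Re v1 ^+ 2 + complex.Im v1 ^+ 2).
Proof.
move=> sa.
case: (bc_normal sa) => [S ka k11 k12 k21 k22 uS ka1 kd SA SB|S al1 al2 be1 be2 uS al0 be0 SA SB].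
  have [C0 C00 hC] : exists2 C0 : R, 0 <= C0 & forall u1 u2 : R,
     (k11 * u1 + k12 * u2) * (k21 * u1 + k22 * u2) - u1 * u2 <=
       C0 * (u1 ^+ 2 + (k11 * u1 + k12 * u2) ^+ 2).
    have [k0|k0] := eqVneq k12 0.
      exists `|k11 * k21| => // u1 u2; rewrite k0 !mul0r !addr0.
      have k1 : k11 * k22 = 1 by rewrite -kd k0 mul0r subr0.
      have -> : k11 * u1 * (k21 * u1 + k22 * u2) - u1 * u2 =
        (k11 * k21) * u1 ^+ 2 + (k11 * k22 - 1) * (u1 * u2) by ring.
      rewrite k1 subrr mul0r addr0.
      apply: (@le_trans _ _ (`|k11 * k21| * u1 ^+ 2)).
        by rewrite ler_wpM2r ?sqr_ge0// ler_norm.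
      by rewrite ler_wpM2l// lerDl sqr_ge0.
    exists ((`|k11| + `|k22| + 2) / `|k12|); first by rewrite divr_ge0// !addr_ge0.
    move=> u1 u2; set w1 := k11 * u1 + k12 * u2.
    have -> : w1 * (k21 * u1 + k22 * u2) - u1 * u2 =
      (k22 * w1 ^+ 2 - 2 * (u1 * w1) + k11 * u1 ^+ 2) / k12.
      have -> : k22 * w1 ^+ 2 - 2 * (u1 * w1) + k11 * u1 ^+ 2 =
         k12 * (w1 * (k21 * u1 + k22 * u2) - u1 * u2) + (k11 * k22 - k12 * k21 - 1) * (u1 * w1).
        by rewrite /w1; ring.
      by rewrite kd subrr mul0r addr0 [RHS]mulrC mulKf.
    apply: (le_trans (ler_norm _)); rewrite normf_div [X in _ <= X]mulrAC ler_wpM2r ?invr_ge0//.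
    apply: (le_trans (ler_normD _ _)); apply: (le_trans (lerD (ler_normB _ _) (lexx _))).
    have h := norm_mul_le_half u1 w1.
    rewrite normrM in h.
    have q1 := sqr_ge0 w1; have q2 := sqr_ge0 u1.
    move: (w1 ^+ 2) (u1 ^+ 2) q1 q2 h => W U q1 q2 h.
    rewrite !normrM (ger0_norm q1) (ger0_norm q2) (@ger0_norm _ 2)//.
    have h1 := mulr_ge0 (normr_ge0 k11) q1.
    have h2 := mulr_ge0 (normr_ge0 k22) q2.
    lra.
  exists C0 => // u1 u2 v1 v2 /(congr1 (mulmx S)).
  rewrite mulmxDr !mulmxA SA SB mul1mx mulmx0 mulNmx mulmx2_cv => /eqP.
  rewrite addrC subr_eq0 => /eqP H; have [-> ->] := cv2_inj H.
  move: ka1 {H uS SA SB}; case: (ka) => x y; case: u1 => a1 b1; case: u2 => a2 b2 [] /= hxy _.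
  have ha := hC a1 a2; have hb := hC b1 b2.
  (* Multiplication by [ka] with |ka| = 1 preserves the real inner product, which reduces the
     complex estimate to the real one for real and imaginary parts. *)
  have N (s t s' t' : R) : (x * s - y * t) * (x * s' - y * t') + (x * t + y * s) * (x * t' + y * s') =
     (x * x - y * - y) * (s * s' + t * t') by ring.
  set w1 := k11 * a1 + k12 * a2 in ha; set w2 := k21 * a1 + k22 * a2 in ha.
  set z1 := k11 * b1 + k12 * b2 in hb; set z2 := k21 * b1 + k22 * b2 in hb.
  rewrite (_ : (_ + _) * _ + _ = (x * w1 - y * z1) * (x * w2 - y * z2) + (x * z1 + y * w1) * (x * z2 + y * w2)); last first.
    by rewrite /w1 /w2 /z1 /z2; ring.
  rewrite N hxy mul1r.
  rewrite [X in _ <= C0 * X](_ : _ = a1 ^+ 2 + b1 ^+ 2 + ((x * w1 - y * z1) * (x * w1 - y * z1) + (x * z1 + y * w1) * (x * z1 + y * w1))); last first.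
    by rewrite /w1 /z1; ring.
  by rewrite N hxy mul1r; lra.
have sep (a1 a2 : R) : (a1 != 0) || (a2 != 0) -> exists2 c : R, 0 <= c &
   forall u v : R, a1 * u + a2 * v = 0 -> `|u * v| <= c * u ^+ 2.
  move=> a0; have [a20|a20] := eqVneq a2 0.
    exists 0 => // u v; rewrite a20 mul0r addr0 => /eqP.
    rewrite mulf_eq0; move: a0; rewrite a20 eqxx orbF => /negbTE -> /= /eqP ->.
    by rewrite mul0r normr0 mul0r.
  exists `|a1 / a2| => // u v h.
  have -> : v = - (a1 / a2) * u.
    by apply: (mulfI a20); rewrite mulrA mulrN mulrCA divff// mulr1; lra.
  by rewrite mulrCA normrM normrN -expr2 (ger0_norm (sqr_ge0 u)).
have [c1 c10 h1] := sep _ _ al0; have [c2 c20 h2] := sep _ _ be0.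
exists (c1 + c2); first exact: addr_ge0.
move=> u1 u2 v1 v2 /(congr1 (mulmx S)).
rewrite mulmxDr !mulmxA SA SB mulmx0 !mulmx2_cv => /matrixP H.
have := H 0 0; have := H 1 0; rewrite !mxE /= !mul0r !addr0 !add0r {H SA SB uS}.
case: u1 => a1 b1; case: u2 => a2 b2; case: v1 => a3 b3; case: v2 => a4 b4 [] e1 e2 [] e3 e4.
rewrite !mul0r !subr0 ?addr0 in e1 e2 e3 e4.
have := h1 a1 a2 e3; have := h1 b1 b2; have := h2 a3 a4 e1; have := h2 b3 b4.
move=> /(_ _) H1 H2 /(_ _) H3 H4.
have {}H1 := H1 e2; have {}H3 := H3 e4.
have n1 := ler_norm (a3 * a4); have n2 := ler_norm (b3 * b4).
have n3 : - (a1 * a2) <= `|a1 * a2| by rewrite -normrN ler_norm.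
have n4 : - (b1 * b2) <= `|b1 * b2| by rewrite -normrN ler_norm.
have := mulr_ge0 c20 (sqr_ge0 a1); have := mulr_ge0 c20 (sqr_ge0 b1).
have := mulr_ge0 c10 (sqr_ge0 a3); have := mulr_ge0 c10 (sqr_ge0 b3).
by rewrite /=; lra.
Qed.

End BoundaryCondition.

(** * Eigenspaces *)

Section Eigenspaces.
Context {R : realType} (a b : R) (ab : a < b).
Local Notation J := (`]a, b[%classic : set R).
Local Notation C := R[i].
Local Notation normc := (@ComplexField.Normc.normc R).
Local Notation Re := complex.Re.
Local Notation Im := complex.Im.

Lemma normcE2 (z : C) : normc z ^+ 2 = Re z ^+ 2 + Im z ^+ 2.
Proof. by case: z => x y /=; rewrite sqr_sqrtr// addr_ge0// sqr_ge0. Qed.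

Lemma normc_ge0 (z : C) : 0 <= normc z.
Proof. by case: z => x y /=; exact: sqrtr_ge0. Qed.

Lemma Re_le_normc (z : C) : `|Re z| <= normc z.
Proof.
rewrite -(@ler_pXn2r _ 2)// ?nnegrE ?normc_ge0// normcE2 real_normK ?num_real//.
by rewrite lerDl sqr_ge0.
Qed.

Lemma Im_le_normc (z : C) : `|Im z| <= normc z.
Proof.
rewrite -(@ler_pXn2r _ 2)// ?nnegrE ?normc_ge0// normcE2 real_normK ?num_real//.
by rewrite lerDr sqr_ge0.
Qed.

Lemma normc_le (z : C) : normc z <= `|Re z| + `|Im z|.
Proof.
rewrite -(@ler_pXn2r _ 2)// ?nnegrE ?normc_ge0 ?addr_ge0// normcE2.
rewrite sqrrD !real_normK ?num_real// addrAC lerDl.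
by rewrite mulrn_wge0// mulr_ge0.
Qed.

Lemma abs_continuous_Re (f : R -> C) : abs_continuous_on a b f ->
  ac a b (fun x => Re (f x)) /\ ac a b (fun x => Im (f x)).
Proof.
move=> acf; split=> e e0; have [d d0 h] := acf _ e0; exists d => // n u v uv tI s;
  apply: le_lt_trans (h n u v uv tI s); apply: ler_sum => i _.
  by have := Re_le_normc (f (v i) - f (u i)); case: (f (v i)) => ? ?; case: (f (u i)).
by have := Im_le_normc (f (v i) - f (u i)); case: (f (v i)) => ? ?; case: (f (u i)).
Qed.

Lemma abs_continuous_ReIm (f : R -> C) : ac a b (fun x => Re (f x)) ->
  ac a b (fun x => Im (f x)) -> abs_continuous_on a b f.
Proof.
move=> acr aci e e0; have e2 : 0 < e / 2 by rewrite divr_gt0.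
have [d1 d10 h1] := acr _ e2; have [d2 d20 h2] := aci _ e2.
exists (Num.min d1 d2); first by rewrite lt_min d10.
move=> n u v uv tI; rewrite lt_min => /andP[s1 s2].
rewrite [e]splitr; apply: le_lt_trans (ltrD (h1 n u v uv tI s1) (h2 n u v uv tI s2)).
rewrite -big_split /=; apply: ler_sum => i _.
by have := normc_le (f (v i) - f (u i)); case: (f (v i)) => ? ?; case: (f (u i)).
Qed.

Variables (p q r s : R -> R).
Hypotheses (hp1 : in_L1 a b (fun x => (p x)^-1)) (hq : in_L1 a b q)
  (hr : in_L1 a b r) (hs : in_L1 a b s).
Hypotheses (hp : ae_on a b (fun x => 0 < p x)) (hr0 : ae_on a b (fun x => 0 < r x)).

Local Notation w := (fun x => (p x)^-1).

Lemma w_gt0 : ae_on a b (fun x => 0 < w x).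
Proof. by apply: ae_onS hp => x _; rewrite invr_gt0. Qed.

(** All coefficients and [l] are real, so the real and imaginary parts satisfy the real system
    separately. *)
Lemma sol_of_quasi (l : R) (y y1 f : R -> C) :
  abs_continuous_on a b y -> abs_continuous_on a b y1 ->
  quasi_derivative a b p s y y1 -> SL_expr a b q r s y y1 f ->
  ae_on a b (fun x => f x = l%:C * y x) ->
  sol a b w s (pot q r l) (fun x => Re (y x)) (fun x => Re (y1 x)) /\
  sol a b w s (pot q r l) (fun x => Im (y x)) (fun x => Im (y1 x)).
Proof.
move=> /abs_continuous_Re[ayr ayi] /abs_continuous_Re[ay1r ay1i] qd sl fy.
have Q := ae_onI qd hp; have E := ae_onI sl (ae_onI fy hr0).
split; split; split => //.
- apply: ae_onS Q => x _ [[[dr di] e] px]; split => //; rewrite -derive1E.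
  move: e; rewrite /cderive; case: (y1 x) => u v; case: (y x) => c d [] /= + _.
  rewrite !mul0r !subr0 => ->; field; rewrite gt_eqF//.
- apply: ae_onS E => x _ [[[dr di] e] [fe rx]]; split => //; rewrite -derive1E.
  move: e; rewrite fe /cderive /pot; case: (y1 x) => u v; case: (y x) => c d [] /= + _.
  rewrite !mul0r !subr0 => e.
  by have := congr1 (fun t => r x * t) e; rewrite mulVKf ?gt_eqF//; lra.
- apply: ae_onS Q => x _ [[[dr di] e] px]; split => //; rewrite -derive1E.
  move: e; rewrite /cderive; case: (y1 x) => u v; case: (y x) => c d [] /= _.
  rewrite !mul0r !addr0 => ->; field; rewrite gt_eqF//.
- apply: ae_onS E => x _ [[[dr di] e] [fe rx]]; split => //; rewrite -derive1E.
  move: e; rewrite fe /cderive /pot; case: (y1 x) => u v; case: (y x) => c d [] /= _.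
  rewrite !mul0r !addr0 => e.
  by have := congr1 (fun t => r x * t) e; rewrite mulVKf ?gt_eqF//; lra.
Qed.

Local Notation T A B l := (Tmx A B (fundamental a b w s q r) l).

Definition comb (c1 c2 : C) (u v : R -> R) (x : R) : C := c1 * (u x)%:C + c2 * (v x)%:C.

Lemma Re_comb c1 c2 u v x : Re (comb c1 c2 u v x) = Re c1 * u x + Re c2 * v x.
Proof. by rewrite /comb; case: c1 => ? ?; case: c2 => ? ? /=; rewrite !mulr0 !subr0. Qed.

Lemma Im_comb c1 c2 u v x : Im (comb c1 c2 u v x) = Im c1 * u x + Im c2 * v x.
Proof. by rewrite /comb; case: c1 => ? ?; case: c2 => ? ? /=; rewrite !mulr0 !add0r. Qed.

Lemma complex_eq (z z' : C) : Re z = Re z' -> Im z = Im z' -> z = z'.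
Proof. by case: z => ? ?; case: z' => ? ? /= -> ->. Qed.

Lemma Tmx_cv2 (v : R -> R) A B l c1 c2 : Tmx A B (fundamental a b v s q r) l *m cv2 c1 c2 =
  A *m cv2 c1 c2 + B *m cv2 (comb c1 c2 (theta a b v s q r l).1 (phi a b v s q r l).1 b)
                            (comb c1 c2 (theta a b v s q r l).2 (phi a b v s q r l).2 b).
Proof.
rewrite /Tmx mulmxDl -mulmxA /Fmx mulmx2_cv /comb /=.
by congr (_ + _ *m cv2 _ _); rewrite ![_ * c1]mulrC ![_ * c2]mulrC.
Qed.

(** The coefficients are the initial values of y and y1 at [a]; in these coordinates the boundary
    condition is the kernel equation of A + B F. *)
Lemma eigenspace_kernel A B l y : SL_eigenspace a b p q r s A B l%:C y ->
  exists c1 c2 : C, T A B l *m cv2 c1 c2 = 0 /\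
   forall x, a <= x <= b -> y x = comb c1 c2 (theta a b w s q r l).1 (phi a b w s q r l).1 x.
Proof.
move=> [f [[_ _ [y1 [acy acy1 qd bc sl]]] fy]].
have [sr si] := sol_of_quasi acy acy1 qd sl fy.
have hr_ := sol_theta_phi ab hp1 hs hq hr sr; have hi_ := sol_theta_phi ab hp1 hs hq hr si.
exists (y a), (y1 a).
have E x : a <= x <= b ->
  y x = comb (y a) (y1 a) (theta a b w s q r l).1 (phi a b w s q r l).1 x /\
  y1 x = comb (y a) (y1 a) (theta a b w s q r l).2 (phi a b w s q r l).2 x.
  move=> xab; have [r1 r2] := hr_ x xab; have [i1 i2] := hi_ x xab.
  by split; apply: complex_eq; rewrite ?Re_comb ?Im_comb.
split; last by move=> x /E[].
have bab : a <= b <= b by rewrite lexx ltW.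
rewrite Tmx_cv2 -(E b bab).1 -(E b bab).2.
by move: bc.
Qed.

Lemma in_L2_ac (f : R -> C) : ac a b (fun x => Re (f x)) -> ac a b (fun x => Im (f x)) ->
  in_L2 a b r f.
Proof.
move=> acr aci; split; [exact: ac_measurable|exact: ac_measurable|].
have := in_L1_mul_ac ab hr (acD (acM ab acr acr) (acM ab aci aci)).
rewrite /in_L1; congr (_.-integrable _ _); apply/funext => x /=; congr (_%:E).
by rewrite normcE2 !expr2 mulrC.
Qed.

Lemma kernel_eigenspace A B l c1 c2 : T A B l *m cv2 c1 c2 = 0 ->
  SL_eigenspace a b p q r s A B l%:C
    (comb c1 c2 (theta a b w s q r l).1 (phi a b w s q r l).1).
Proof.
move=> Tc.
have [ht t0 t1] := thetaP ab hp1 hs hq hr l; have [hph p0 p1] := phiP ab hp1 hs hq hr l.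
pose y := comb c1 c2 (theta a b w s q r l).1 (phi a b w s q r l).1.
pose y1 := comb c1 c2 (theta a b w s q r l).2 (phi a b w s q r l).2.
have [yr y1r] := sol_lin ab (Re c1) (Re c2) ht hph.
have [yi y1i] := sol_lin ab (Im c1) (Im c2) ht hph.
have Ey : (fun x => Re (y x)) = (fun x => Re c1 * (theta a b w s q r l).1 x + Re c2 * (phi a b w s q r l).1 x).
  by apply/funext => x; rewrite Re_comb.
have Eyi : (fun x => Im (y x)) = (fun x => Im c1 * (theta a b w s q r l).1 x + Im c2 * (phi a b w s q r l).1 x).
  by apply/funext => x; rewrite Im_comb.
have Ey1 : (fun x => Re (y1 x)) = (fun x => Re c1 * (theta a b w s q r l).2 x + Re c2 * (phi a b w s q r l).2 x).
  by apply/funext => x; rewrite Re_comb.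
have Ey1i : (fun x => Im (y1 x)) = (fun x => Im c1 * (theta a b w s q r l).2 x + Im c2 * (phi a b w s q r l).2 x).
  by apply/funext => x; rewrite Im_comb.
rewrite -Ey -Ey1 in yr y1r; rewrite -Eyi -Ey1i in yi y1i.
rewrite -/y.
have dQ := ae_onI (ae_onI yr.2 yi.2) hp.
have dE := ae_onI (ae_onI y1r.2 y1i.2) hr0.
exists (fun x => l%:C * y x); split; last by apply: ae_onW.
split.
- by apply: in_L2_ac; [case: yr|case: yi].
- have Er : (fun x => Re (l%:C * y x)) = (fun x => l * Re (y x)).
    by apply/funext => x; case: (y x) => ? ? /=; rewrite mul0r subr0.
  have Ei : (fun x => Im (l%:C * y x)) = (fun x => l * Im (y x)).
    by apply/funext => x; case: (y x) => ? ? /=; rewrite mul0r addr0.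
  by apply: in_L2_ac; rewrite ?Er ?Ei; apply: acM => //; try exact: ac_cst; [case: yr|case: yi].
exists y1; split.
- by apply: abs_continuous_ReIm; [case: yr|case: yi].
- by apply: abs_continuous_ReIm; [case: y1r|case: y1i].
- apply: ae_onS dQ => x _ [[dr di] px].
  have [dr1 dr2] := dr; have [di1 di2] := di.
  split; first by split.
  have dr3 : 'D_1 (fun x => Re (y x)) x = w x * Re (y1 x) - s x * Re (y x).
    by rewrite dr2 !Re_comb.
  have di3 : 'D_1 (fun x => Im (y x)) x = w x * Im (y1 x) - s x * Im (y x).
    by rewrite di2 !Im_comb.
  rewrite /cderive !derive1E dr3 di3.
  have pn : p x != 0 by rewrite gt_eqF.
  by apply: complex_eq; case: (y1 x) => u v; case: (y x) => c d /=; field.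
- have -> : Ymx y y1 a = cv2 c1 c2.
    apply/matrixP => i j; rewrite !mxE; case: ifP => _.
      by rewrite /y /comb t0 p0 mulr1 mulr0 addr0.
    by rewrite /y1 /comb t1 p1 mulr1 mulr0 add0r.
  by rewrite -Tc Tmx_cv2.
- apply: ae_onS dE => x _ [[dr di] rx].
  have [dr1 dr2] := dr; have [di1 di2] := di.
  split; first by split.
  have dr3 : 'D_1 (fun x => Re (y1 x)) x = s x * Re (y1 x) + pot q r l x * Re (y x).
    by rewrite dr2 !Re_comb.
  have di3 : 'D_1 (fun x => Im (y1 x)) x = s x * Im (y1 x) + pot q r l x * Im (y x).
    by rewrite di2 !Im_comb.
  rewrite /cderive !derive1E dr3 di3.
  have rn : r x != 0 by rewrite gt_eqF.
  by apply: complex_eq; case: (y1 x) => u v; case: (y x) => c d /=; rewrite /pot; field.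
Qed.

(** A combination vanishing a.e. has norm zero in L^2_r, which [gram_gt0] excludes unless its
    initial values are zero. *)
Lemma comb_ae_eq0 l c1 c2 :
  ae_on a b (fun x => comb c1 c2 (theta a b w s q r l).1 (phi a b w s q r l).1 x = 0) ->
  c1 = 0 /\ c2 = 0.
Proof.
have [ht t0 t1] := thetaP ab hp1 hs hq hr l; have [hph p0 p1] := phiP ab hp1 hs hq hr l.
move=> h.
have real (d1 d2 : R) : ae_on a b (fun x => d1 * (theta a b w s q r l).1 x +
    d2 * (phi a b w s q r l).1 x = 0) -> d1 = 0 /\ d2 = 0.
  move=> y0; have sy := sol_lin ab d1 d2 ht hph.
  apply: contrapT => d12.
  have nz : d1 != 0 \/ d2 != 0.
    have [d10|] := eqVneq d1 0; last by left.
    by right; apply/eqP => d20; apply: d12.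
  have := gram_gt0 ab hr hr0 w_gt0 sy.
  rewrite t0 t1 p0 p1 !mulr1 !mulr0 addr0 add0r => /(_ nz).
  rewrite /gram; have [[acy _] _] := sy.
  have i := in_L1_rzy ab hr acy acy.
  rewrite (prim0_cst ab (prim_primitive i)) ?(primitive_a _ _ (lexx a)) ?ltxx//; last by rewrite lexx ltW.
  by apply: ae_onS y0 => x _ ->; rewrite !mulr0.
have [r1 r2] : Re c1 = 0 /\ Re c2 = 0.
  by apply: real; apply: ae_onS h => x _ /(congr1 (@complex.Re R)); rewrite Re_comb.
have [i1 i2] : Im c1 = 0 /\ Im c2 = 0.
  by apply: real; apply: ae_onS h => x _ /(congr1 (@complex.Im R)); rewrite Im_comb.
by split; apply: complex_eq.
Qed.

Lemma cv2_eta (v : 'cV[C]_2) : v = cv2 (v 0 0) (v 1 0).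
Proof.
apply/matrixP => i j; rewrite !mxE (ord1 j); case: i => [[|[|//]] hi] /=;
  by congr (v _ _); apply: val_inj.
Qed.

Lemma cv2_eq0 (c1 c2 : C) : cv2 c1 c2 = 0 -> c1 = 0 /\ c2 = 0.
Proof. by move=> /matrixP h; have := h 0 0; have := h 1 0; rewrite !mxE. Qed.

Lemma SL_multiplicity_rank A B l :
  SL_multiplicity a b p q r s A B l%:C (2 - \rank (T A B l)).
Proof.
set th := (theta a b w s q r l).1; set ph := (phi a b w s q r l).1.
have Jab x : J x -> a <= x <= b.
  by rewrite /= in_itv /= => /andP[h1 h2]; rewrite !ltW.
have [rk2 rk1] := rank_mx2_det (T A B l).
have [T0|T0] := eqVneq (T A B l) 0.
  rewrite T0 mxrank0 subn0.
  exists (fun i => if i == 0 then comb 1 0 th ph else comb 0 1 th ph); split.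
  - by move=> i; case: ifP => _; apply: kernel_eigenspace; rewrite T0 mul0mx.
  - move=> c h.
    have [] : c 0 = 0 /\ c 1 = 0.
      apply: (@comb_ae_eq0 l); apply: ae_onS h => x _ <-.
      by rewrite !big_ord_recl big_ord0 /= /comb !mul0r !mul1r !addr0 !add0r; congr (_ + c _ * _); apply: val_inj.
    move=> c0 c1 i; case: i => [[|[|//]] hi].
      by rewrite -[RHS]c0; congr c; apply: val_inj.
    by rewrite -[RHS]c1; congr c; apply: val_inj.
  - move=> y /eigenspace_kernel[c1 [c2 [_ yE]]].
    exists (fun i => if i == 0 then c1 else c2); apply: ae_onW => x /Jab xab.
    rewrite !big_ord_recl big_ord0 /= yE// -/th -/ph /comb.
    by rewrite !mul0r !mul1r !addr0 !add0r.
have [d0|d0] := eqVneq (\det (T A B l)) 0; last first.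
  rewrite rk2// subnn; exists (fun=> fun=> 0); split.
  - by move=> [].
  - by move=> c _ [].
  - move=> y /eigenspace_kernel[c1 [c2 [Tc yE]]]; exists (fun=> 0).
    have uT : T A B l \in unitmx by rewrite unitmxE unitfE.
    have [c10 c20] : c1 = 0 /\ c2 = 0.
      by apply: cv2_eq0; rewrite -(mulKmx uT (cv2 c1 c2)) Tc mulmx0.
    apply: ae_onW => x /Jab xab; rewrite big_ord0 yE// c10 c20 /comb.
    by rewrite !mul0r addr0.
rewrite rk1//.
have [v v0 vT] : exists2 v : 'rV[C]_2, v != 0 & v *m (T A B l)^T = 0.
  by apply/det0P; rewrite det_tr d0.
pose e1 := v 0 0; pose e2 := v 0 1.
have Te : T A B l *m cv2 e1 e2 = 0.
  have <- : v^T = cv2 e1 e2 by rewrite [LHS]cv2_eta !mxE.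
  by rewrite -[LHS]trmxK trmx_mul trmxK vT trmx0.
have e12 : (e1 != 0) || (e2 != 0) := row2_neq0 v0.
exists (fun=> comb e1 e2 th ph); split.
- by move=> _; exact: kernel_eigenspace.
- move=> c h i; rewrite (ord1 i).
  have [h1 h2] : c 0 * e1 = 0 /\ c 0 * e2 = 0.
    apply: (@comb_ae_eq0 l); apply: ae_onS h => x _ <-.
    by rewrite big_ord_recl big_ord0 addr0 /comb mulrDr !mulrA.
  move/eqP: h1; move/eqP: h2; rewrite !mulf_eq0.
  by case: (c 0 =P 0) => //= _ /negPn + /negPn; move: e12; case/orP => /negPf ->.
move=> y /eigenspace_kernel[c1 [c2 [Tc yE]]].
have dep : e1 * c2 - e2 * c1 = 0.
  apply/eqP/negPn/negP => nd.
  have uM : mx2 e1 c1 e2 c2 \in unitmx by rewrite unitmxE unitfE det_mx2 [c1 * _]mulrC.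
  have TM : T A B l *m mx2 e1 c1 e2 c2 = 0.
    move: Te Tc; rewrite (mx2E (T A B l)) !mulmx2_cv mulmx2 => /cv2_eq0[-> ->] /cv2_eq0[-> ->].
    exact: mx2_0.
  by move: T0; rewrite -(mulmxK uM (T A B l)) TM mul0mx eqxx.
have [k [k1 k2]] : exists k : C, c1 = k * e1 /\ c2 = k * e2.
  have [e10|e10] := eqVneq e1 0.
    have e20 : e2 != 0 by move: e12; rewrite e10 eqxx.
    exists (c2 / e2); rewrite divfK// e10 mulr0; split => //.
    by move: dep; rewrite e10 mul0r sub0r => /eqP; rewrite oppr_eq0 mulf_eq0 (negbTE e20) => /eqP.
  exists (c1 / e1); rewrite divfK//; split => //.
  by apply: (mulfI e10); move/eqP: dep; rewrite subr_eq0 => /eqP ->; field.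
exists (fun=> k); apply: ae_onW => x /Jab xab.
by rewrite big_ord_recl big_ord0 addr0 yE// k1 k2 -/th -/ph /comb mulrDr !mulrA.
Qed.

End Eigenspaces.

(** * A uniform lower bound *)

Section LowerBound.
Context {R : realType} (a b : R) (ab : a < b).
Local Notation mu := (@lebesgue_measure R).
Local Notation J := (`]a, b[%classic : set R).
Local Notation prim := (prim a b).
Local Notation in_L1 := (in_L1 a b).
Local Notation P := (primitive a b).
Local Notation sol := (sol a b).
Local Notation Re := complex.Re.
Local Notation Im := complex.Im.
Implicit Types (w s q r y : R -> R).

Lemma prim_linear (k : R) : prim (fun x => k * (x - a)) (fun=> k).
Proof.
have aid : ac a b id.
  by move=> e e0; exists e => // n u v uv _; apply: le_lt_trans; apply: ler_sum => i _;
    have [_ h _] := uv i; rewrite ger0_norm// subr_ge0.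
have pid : prim id (fun=> 1) by split => //; apply: ae_onW => x _; exact: is_derive_id.
apply: prim_ext (primZ ab k (primB ab pid (prim_cst a b a))) => x _.
by rewrite subr0 mulr1.
Qed.

Lemma in_L1_cst (k : R) : in_L1 (fun=> k).
Proof.
apply: (@measurable_bounded_integrable _ _ _ mu (fun=> k)) => //.
  by rewrite [X in (X < _)%E]lebesgue_measure_itv /= lte_fin ab -EFinB ltry.
by exists `|k|; split; [exact: num_real|move=> M kM x _; exact: ltW].
Qed.

Lemma primitive_ge0_mono f x : in_L1 f -> (forall t, 0 <= f t) -> a <= x <= b ->
  0 <= P f x <= P f b.
Proof.
move=> hf f0 /andP[ax xb]; rewrite -{1}(primitive_a b f (lexx a)).
by apply/andP; split; apply: (prim_mono (prim_primitive hf)) => //; exact: ae_onW.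
Qed.

(** As r > 0 a.e., the minimum equals G at almost every point once n is large, and it is dominated
    by G. *)
Lemma truncation_small (r G : R -> R) : in_L1 r -> in_L1 G ->
  ae_on a b (fun x => 0 < r x) -> (forall x, 0 <= G x) -> forall e, 0 < e ->
  exists n : nat, in_L1 (fun x => Num.min (n%:R * r x) (G x)) /\
    P (fun x => `|Num.min (n%:R * r x) (G x) - G x|) b < e.
Proof.
move=> hr hG hr0 G0 e e0.
have mr := in_L1_measurable hr; have mG := in_L1_measurable hG.
pose f_ (n : nat) x := (Num.min (n%:R * r x) (G x))%:E.
have mf n : measurable_fun J (fun x => Num.min (n%:R * r x) (G x)).
  by apply: measurable_minr => //; apply: measurable_funM.
have [] := @dominated_convergence _ _ _ mu J (mJ a b) f_ (EFin \o G)
   (EFin \o (fun x => `|G x|)).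
- by move=> n; apply/measurable_EFinP; exact: mf.
- by apply/measurable_EFinP.
- apply: (@filterS _ _ (ae_filter_ringOfSetsType mu)) hr0 => x rx /rx r0.
  apply: cvg_near_cst; have [N _ hN] := nbhs_infty_ger (G x / r x).
  exists N => // n /hN /= h; rewrite /f_ /=; congr (_%:E).
  by apply/min_idPr; rewrite -ler_pdivrMr.
- exact: in_L1_norm.
- apply: (@filterS _ _ (ae_filter_ringOfSetsType mu)) hr0 => x rx n /rx r0.
  rewrite /f_ /= lee_fin ger0_norm; last by rewrite le_min G0 andbT mulr_ge0// ltW.
  by rewrite (ger0_norm (G0 x)) ge_min lexx orbT.
move=> _ /fine_cvgP[_ /cvgrPdist_lt /(_ _ e0)] [N _ /(_ N (leqnn N))] /= h _.
exists N; split.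
  have hm : in_L1 (fun x => N%:R * `|r x| + `|G x|).
    by apply: in_L1D; [apply: in_L1Z|]; exact: in_L1_norm.
  apply: in_L1_le hm => // x _.
  rewrite [X in _ <= X]ger0_norm; last by rewrite addr_ge0// mulr_ge0.
  have h1 : `|N%:R * r x| = N%:R * `|r x| by rewrite normrM normr_nat.
  case: (leP (N%:R * r x) (G x)) => _; first by rewrite h1 lerDl.
  by rewrite lerDr mulr_ge0.
rewrite primitive_b; apply: le_lt_trans h; rewrite sub0r normrN.
exact: ler_norm.
Qed.

(* If [rho] satisfies the Riccati inequality below, then [y y1 - rho y ^ 2] is
   nondecreasing along every solution. *)
Lemma riccati_monotone w s (Q rho rho' y y1 : R -> R) :
  prim rho rho' -> sol w s Q y y1 -> ae_on a b (fun x => 0 < w x) ->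
  ae_on a b (fun x => rho' x <= Q x + 2 * (rho x * s x) - w x * rho x ^+ 2) ->
  (y a * y1 a - rho a * y a ^+ 2 <= y b * y1 b - rho b * y b ^+ 2) /\
  (y a = 0 -> y b = 0 -> y1 a = 0).
Proof.
move=> hrho [hy hy1] w0 ric.
have hM := primB ab (primM ab hy hy1) (primM ab hrho (primM ab hy hy)).
pose M x := y x * y1 x - rho x * (y x * y x).
pose M' x := w x * (y1 x - rho x * y x) ^+ 2
  + (Q x + 2 * (rho x * s x) - w x * rho x ^+ 2 - rho' x) * y x ^+ 2.
have {hM}hM : prim M M' by apply: prim_ext hM => x _; rewrite /M'; ring.
have M0 : ae_on a b (fun x => 0 <= M' x).
  apply: ae_onS (ae_onI w0 ric) => x _ [wx rx].
  by rewrite addr_ge0// mulr_ge0 ?sqr_ge0 ?(ltW wx)// subr_ge0.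
have mono := prim_mono hM M0.
split; first by have := mono a b (lexx a) (ltW ab) (lexx b); rewrite /M !expr2.
move=> ya yb.
(* The function [M] vanishes at both ends, hence everywhere by monotonicity; its zero derivative
   then forces y1 = rho y a.e., and at [a] by continuity. *)
have Mz x : a <= x <= b -> M x = 0.
  move=> /andP[ax xb]; have := mono a x (lexx a) ax xb; have := mono x b ax xb (lexx b).
  rewrite /M ya yb !mul0r !mulr0 !subr0 => h1 h2.
  by apply/eqP; rewrite eq_le h1 h2.
have ac1 : ac a b (fun x => y1 x + -1 * (rho x * y x)).
  apply: acD; first by case: hy1.
  apply: (acM ab (ac_cst a b (-1))); apply: acM => //; [by case: hrho|by case: hy].
have z : ae_on a b (fun x => y1 x + -1 * (rho x * y x) = 0).
  have [_ dM] := hM.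
  apply: ae_onS (ae_onI dM (ae_onI w0 ric)) => x Jx [dx [wx rx]].
  have cst0 : \forall t \near x, M t = cst 0 t.
    near=> t; apply: Mz.
    have : t \in `]a, b[ by near: t; exact: near_in_itvoo.
    by rewrite in_itv /= => /andP[? ?]; rewrite !ltW.
  have d0 : is_derive x (1 : R) M 0.
    apply: near_eq_is_derive (is_derive_cst (0 : R) x (1 : R)).
    by apply: filterS cst0.
  have := @derive_val _ _ _ _ _ _ _ dx; rewrite (@derive_val _ _ _ _ _ _ _ d0).
  have h1 : 0 <= w x * (y1 x - rho x * y x) ^+ 2 by rewrite mulr_ge0 ?sqr_ge0// ltW.
  have h2 : 0 <= (Q x + 2 * (rho x * s x) - w x * rho x ^+ 2 - rho' x) * y x ^+ 2.
    by rewrite mulr_ge0 ?sqr_ge0// subr_ge0.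
  rewrite /M' => /esym h3.
  have : w x * (y1 x - rho x * y x) ^+ 2 = 0 by lra.
  move=> /eqP; rewrite mulf_eq0 (gt_eqF wx) /= sqrf_eq0 => /eqP.
  by rewrite mulN1r.
have := ac_ae_eq0 ab ac1 z (_ : a <= a <= b); rewrite lexx ltW// => /(_ isT).
by rewrite ya !mulr0 addr0.
Unshelve. all: by end_near. Qed.

(* [rho] follows a line from [- K0 - 1] to [K0 + 1] up to an error of at most 1:
   the integrable function [G] that the slope requires is dominated by
   [n%:R * r], hence by [- l * r], up to a truncation of small L^1 norm. *)
Lemma riccati_exists (w_ s_ : nat -> R -> R) w s q r (K0 : R) :
  (forall m, in_L1 (w_ m)) -> (forall m, in_L1 (s_ m)) ->
  in_L1 w -> in_L1 s -> in_L1 q -> in_L1 r -> ae_on a b (fun x => 0 < r x) ->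
  0 <= K0 ->
  P (coef_norm (fun x => w_ m x - w x) (fun x => s_ m x - s x) (fun=> 0)) b @[m --> \oo] --> 0 ->
  exists L : R, \forall m \near \oo, exists rho rho' : R -> R,
   [/\ prim rho rho', rho a <= - K0, K0 <= rho b &
    forall l, l <= L -> ae_on a b (fun x =>
      rho' x <= pot q r l x + 2 * (rho x * s_ m x) - w_ m x * rho x ^+ 2)].
Proof.
move=> hw_ hs_ hw hs hq hr r0 K00 cv.
(* The line stays between - (K0 + 1) and K0 + 1, so with an error of at most 1 the values of [rho]
   are bounded by [K]; [sg] is the slope of the line. *)
pose K := K0 + 2; pose sg := (2 * K0 + 2) / (b - a).
have ba : 0 < b - a by rewrite subr_gt0.
have KK0 : 0 <= K by rewrite addr_ge0.
have sg0 : 0 <= sg by rewrite divr_ge0 ?(ltW ba)// addr_ge0// mulr_ge0.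
(* Bounds the terms of the Riccati inequality other than [- l * r] for any [rho] with values between
   - K and K. *)
pose g (w' s' : R -> R) x := `|q x| + 2 * K * `|s' x| + K ^+ 2 * `|w' x|.
have g0 w' s' x : 0 <= g w' s' x by rewrite !addr_ge0 ?mulr_ge0 ?sqr_ge0.
have ig w' s' : in_L1 w' -> in_L1 s' -> in_L1 (g w' s').
  move=> h1 h2; apply: in_L1D; [apply: in_L1D|]; first exact: in_L1_norm.
    by apply: in_L1Z; exact: in_L1_norm.
  by apply: in_L1Z; exact: in_L1_norm.
pose G x := g w s x + sg.
have iG : in_L1 G by apply: in_L1D; [exact: ig|exact: in_L1_cst].
have G0 x : 0 <= G x by rewrite addr_ge0.
have h2 : 0 < 2^-1 :> R by rewrite invr_gt0.
have [n [imin nsm]] := truncation_small hr iG r0 G0 h2.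
exists (- n%:R).
(* The tolerance 1 is shared equally: one half for the truncation of [G], one half for replacing
   [w], [s] by [w_ m], [s_ m] in [g]. *)
have D0 : 0 < 2 * (2 * K + K ^+ 2 + 1) by rewrite mulr_gt0// ltr_wpDl// addr_ge0 ?sqr_ge0// mulr_ge0.
have cv' : \forall m \near \oo, P (coef_norm (fun x => w_ m x - w x) (fun x => s_ m x - s x) (fun=> 0)) b
    <= (2 * (2 * K + K ^+ 2 + 1))^-1.
  have e0 : 0 < (2 * (2 * K + K ^+ 2 + 1))^-1 by rewrite invr_gt0.
  move/cvgrPdist_le : cv => /(_ _ e0)[N _ hN].
  by exists N => // m /hN /=; rewrite sub0r normrN => /(le_trans (ler_norm _)).
near=> m.
have km : P (coef_norm (fun x => w_ m x - w x) (fun x => s_ m x - s x) (fun=> 0)) b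
    <= (2 * (2 * K + K ^+ 2 + 1))^-1 by near: m.
pose k := coef_norm (fun x => w_ m x - w x) (fun x => s_ m x - s x) (fun=> 0).
have ik : in_L1 k by apply: in_L1_coef_norm; [exact: in_L1B|exact: in_L1B|exact: in_L1_cst].
have k0 x : 0 <= k x by rewrite /k /coef_norm !addr_ge0.
pose h1 x := `|Num.min (n%:R * r x) (G x) - G x|.
have ih1 : in_L1 h1 by apply: in_L1_norm; exact: in_L1B.
pose rho' x := Num.min (n%:R * r x) (G x) - g (w_ m) (s_ m) x.
have irho' : in_L1 rho' by apply: in_L1B => //; exact: ig.
pose rho x := - (K0 + 1) + P rho' x.
have prho : prim rho rho'.
  by apply: prim_ext (primD (prim_cst a b (- (K0 + 1))) (prim_primitive irho')) => x _; rewrite add0r.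
have rho_lin x : a <= x <= b -> `|rho x - (- (K0 + 1) + sg * (x - a))| <= 1.
  move=> /[dup] xab /andP[ax xb].
  have pd := primD (prim_primitive ih1) (primZ ab (2 * K + K ^+ 2) (prim_primitive ik)).
  have := prim_norm_le ab (primB ab (prim_primitive irho') (prim_linear sg)) pd _ (lexx a) ax xb.
  rewrite !(primitive_a _ _ (lexx a)) subrr !mulr0 addr0 !subr0 => H.
  have -> : rho x - (- (K0 + 1) + sg * (x - a)) = P rho' x - sg * (x - a) by rewrite /rho; ring.
  apply: (le_trans (H _)).
    apply: ae_onW => t _.
    have -> : rho' t - sg = (Num.min (n%:R * r t) (G t) - G t) + (g w s t - g (w_ m) (s_ m) t).
      by rewrite /rho' {3}/G; ring.
    apply: (le_trans (ler_normD _ _)); rewrite lerD2l.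
    have -> : g w s t - g (w_ m) (s_ m) t = 2 * K * (`|s t| - `|s_ m t|) + K ^+ 2 * (`|w t| - `|w_ m t|).
      by rewrite /g; ring.
    apply: (le_trans (ler_normD _ _)).
    have e1 : `|2 * K * (`|s t| - `|s_ m t|)| <= 2 * K * k t.
      rewrite normrM ger0_norm ?mulr_ge0// ler_wpM2l ?mulr_ge0//.
      apply: (le_trans (ler_dist_dist _ _)); rewrite distrC /k /coef_norm normr0 addr0.
      by rewrite lerDr.
    have e2 : `|K ^+ 2 * (`|w t| - `|w_ m t|)| <= K ^+ 2 * k t.
      rewrite normrM ger0_norm ?sqr_ge0// ler_wpM2l ?sqr_ge0//.
      apply: (le_trans (ler_dist_dist _ _)); rewrite distrC /k /coef_norm normr0 addr0.
      by rewrite lerDl.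
    by rewrite [X in _ <= X]mulrDl lerD.
  have /andP[_ b1] := primitive_ge0_mono ih1 (fun t => normr_ge0 _) xab.
  have /andP[kx b2] := primitive_ge0_mono ik k0 xab.
  have b3 : P k x <= (2 * (2 * K + K ^+ 2 + 1))^-1 by apply: le_trans km.
  have b4 : (2 * K + K ^+ 2) * P k x <= 2^-1.
    have c0 : 0 <= 2 * K + K ^+ 2 by rewrite addr_ge0 ?sqr_ge0// mulr_ge0.
    apply: (le_trans (ler_wpM2l c0 b3)).
    by rewrite ler_pdivrMr// mulrA mulVf// mul1r lerDl.
  have b5 : P h1 b < 2^-1 by [].
  lra.
have lin_bd x : a <= x <= b -> 0 <= sg * (x - a) <= 2 * K0 + 2.
  move=> /andP[ax xb]; rewrite mulr_ge0 ?subr_ge0//=.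
  rewrite /sg mulrAC ler_pdivrMr// ler_wpM2l ?lerB//.
  by rewrite addr_ge0// mulr_ge0.
exists rho, rho'; split => //.
- by rewrite /rho (primitive_a _ _ (lexx a)) addr0 lerN2 lerDl.
- have := rho_lin b; rewrite lexx ltW// => /(_ isT); rewrite ler_norml => /andP[+ _].
  by rewrite /sg divfK ?gt_eqF//; lra.
move=> l lL; apply: ae_onS r0 => x Jx rx.
have xab : a <= x <= b by move: Jx; rewrite /= in_itv /= => /andP[? ?]; rewrite !ltW.
have rhoK : `|rho x| <= K.
  have := rho_lin x xab; rewrite !ler_norml => /andP[u1 u2].
  have /andP[v1 v2] := lin_bd x xab; rewrite /K; apply/andP; split; lra.
have e1 : - (2 * K * `|s_ m x|) <= 2 * (rho x * s_ m x).
  have : `|rho x * s_ m x| <= K * `|s_ m x| by rewrite normrM ler_wpM2r.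
  by rewrite ler_norml => /andP[+ _]; lra.
have e2 : w_ m x * rho x ^+ 2 <= K ^+ 2 * `|w_ m x|.
  rewrite mulrC (le_trans (ler_wpM2l (sqr_ge0 _) (ler_norm _)))// ler_wpM2r//.
  by rewrite -(real_normK (num_real (rho x))) ler_pXn2r ?nnegrE.
have e3 : Num.min (n%:R * r x) (G x) <= n%:R * r x by rewrite ge_min lexx.
have e4 : - `|q x| <= q x by rewrite lerNl -normrN ler_norm.
have e5 : l * r x <= - n%:R * r x by rewrite ler_wpM2r// ltW.
rewrite /rho' /g /pot; lra.
Unshelve. all: by end_near. Qed.

(** With [C0 + 1] as the size of [rho] at the ends, monotonicity bounds the boundary term from below
    by C0 + 1 times |y(a)|^2 + |y(b)|^2, and the boundary condition bounds it from above by C0 times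
    the same. So y vanishes at both ends, and then y1(a) = 0. *)
Lemma kernel_bounded_below (A B : 'M[R[i]]_2) (w_ s_ : nat -> R -> R) w s q r :
  selfadjoint_bc A B ->
  (forall m, in_L1 (w_ m)) -> (forall m, in_L1 (s_ m)) ->
  (forall m, ae_on a b (fun x => 0 < w_ m x)) ->
  in_L1 w -> in_L1 s -> in_L1 q -> in_L1 r -> ae_on a b (fun x => 0 < r x) ->
  P (coef_norm (fun x => w_ m x - w x) (fun x => s_ m x - s x) (fun=> 0)) b @[m --> \oo] --> 0 ->
  exists L : R, \forall m \near \oo, forall l, l <= L -> forall c1 c2 : R[i],
    Tmx A B (fundamental a b (w_ m) (s_ m) q r) l *m cv2 c1 c2 = 0 -> c1 = 0 /\ c2 = 0.
Proof.
move=> sa hw_ hs_ w0 hw hs hq hr r0 cv.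
have [C0 C00 hC] := bc_form_bound sa.
have [L hL] := riccati_exists hw_ hs_ hw hs hq hr r0 (addr_ge0 C00 ler01) cv.
exists L; apply: filterS hL => m [rho [rho' [hrho ra rb ric]]] l lL c1 c2.
have {}ric := ric l lL.
have [ht t0 t1] := thetaP ab (hw_ m) (hs_ m) hq hr l.
have [hp p0 p1] := phiP ab (hw_ m) (hs_ m) hq hr l.
rewrite Tmx_cv2 => /hC; rewrite !Re_comb !Im_comb.
have [] := riccati_monotone hrho (sol_lin ab (Re c1) (Re c2) ht hp) (w0 m) ric.
have [] := riccati_monotone hrho (sol_lin ab (Im c1) (Im c2) ht hp) (w0 m) ric.
rewrite !t0 !t1 !p0 !p1 !mulr1 !mulr0 !addr0 !add0r.
set yi := Im c1 * _ + Im c2 * _; set y1i := Im c1 * _ + Im c2 * _.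
set yr := Re c1 * _ + Re c2 * _; set y1r := Re c1 * _ + Re c2 * _.
move=> mi zi mr zr F.
have K (y0 u : R) : (C0 + 1) * (y0 ^+ 2 + u ^+ 2) <= rho b * u ^+ 2 - rho a * y0 ^+ 2.
  have h1 := ler_wpM2r (sqr_ge0 u) rb; have h2 := ler_wpM2r (sqr_ge0 y0) ra; lra.
have ki := K (Im c1) yi; have kr := K (Re c1) yr.
have q1 := sqr_ge0 (Re c1); have q2 := sqr_ge0 (Im c1).
have q3 := sqr_ge0 yr; have q4 := sqr_ge0 yi.
have tot : Re c1 ^+ 2 + Im c1 ^+ 2 + yr ^+ 2 + yi ^+ 2 <= 0 by lra.
have sq0 (u : R) : u ^+ 2 = 0 -> u = 0 by move=> /eqP; rewrite sqrf_eq0 => /eqP.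
have r1 : Re c1 = 0 by apply: sq0; lra.
have i1 : Im c1 = 0 by apply: sq0; lra.
have r2 : Re c2 = 0 by apply: zr => //; apply: sq0; lra.
have i2 : Im c2 = 0 by apply: zi => //; apply: sq0; lra.
by split; apply: complex_eq.
Qed.

End LowerBound.

(** * Indices of eigenvalues *)

Section Counting.
Context {R : realType}.

Lemma card_I_seq (A : set nat) k : (A #= `I_k)%card ->
  exists s : seq nat, [/\ uniq s, size s = k & forall j, j \in s <-> A j].
Proof.
move=> Ak; have fA : finite_set A by exists k.
exists (finmap.enum_fset (fset_set A)); split.
- exact: finmap.fset_uniq.
- exact: card_fset_set.
- by move=> j; rewrite (in_fset_set fA); split => [|Aj]; rewrite ?inE // => /set_mem.
Qed.

(* [mult mu] lists the indices [j] with [lam j = mu]; the last two hypotheses say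
   that asymptotically [lam_ m] has as many indices with values near [mu]. *)
Lemma ordered_index_cvg (lam_ : nat -> nat -> R) (lam : nat -> R) (mult : R -> seq nat) :
  (forall m, {homo lam_ m : i j / (i <= j)%N >-> i <= j}) ->
  {homo lam : i j / (i <= j)%N >-> i <= j} ->
  (forall mu, uniq (mult mu) /\ forall j, j \in mult mu <-> lam j = mu) ->
  (exists L, \forall m \near \oo, forall j, L < lam_ m j) ->
  (forall mu, exists2 e, 0 < e & \forall m \near \oo, forall S : seq nat, uniq S ->
     (forall j, j \in S -> `|lam_ m j - mu| < e) -> (size S <= size (mult mu))%N) ->
  (forall mu e, 0 < e -> \forall m \near \oo, exists S : seq nat, [/\ uniq S,
     size S = size (mult mu) & forall j, j \in S -> `|lam_ m j - mu| < e]) ->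
  forall n, lam_ m n @[m --> \oo] --> lam n.
Proof.
move=> mono_ mono hmult [L hL] hU hLo.
move=> n; have [k] := ubnP n; elim: k n => // k IH n nk.
have {}IH j : (j < n)%N -> lam_ m j @[m --> \oo] --> lam j.
  by move=> jn; apply: IH; exact: leq_trans jn nk.
have close j e : (j < n)%N -> 0 < e -> \forall m \near \oo, `|lam_ m j - lam j| < e.
  move=> /IH /cvgrPdist_lt h /h; apply: filterS => m; by rewrite distrC.
have closeall (e : R) : 0 < e -> \forall m \near \oo, forall j, (j < n)%N -> `|lam_ m j - lam j| < e.
  move=> e0; suff H i : (i <= n)%N -> \forall m \near \oo, forall j, (j < i)%N -> `|lam_ m j - lam j| < e.
    exact: H.
  elim: i => [|i IHi] iN; first by near=> m.
  have h1 := IHi (ltnW iN); have h2 := close i e iN e0.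
  near=> m => j; rewrite ltnS leq_eqVlt => /orP[/eqP ->|ji]; first by near: m.
  by move: j ji; near: m.
apply/cvgrPdist_lt => eps eps0.
(* Below [n] there are finitely many indices, so the values smaller than [lam n] keep a distance of
   at least [2 * e] from it. *)
have [e [e0 eeps gap]] : exists e, [/\ 0 < e, e <= eps &
    forall j, (j < n)%N -> lam j < lam n -> lam j <= lam n - 2 * e].
  suff H i : (i <= n)%N -> exists e, [/\ 0 < e, e <= eps &
      forall j, (j < i)%N -> lam j < lam n -> lam j <= lam n - 2 * e] by exact: H.
  elim: i => [|i IHi] iN; first by exists eps.
  have [e [e0 ee h]] := IHi (ltnW iN).
  have [ilt|nlt] := ltP (lam i) (lam n); last first.
    exists e; split => // j; rewrite ltnS leq_eqVlt => /orP[/eqP ->|/h//].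
    by rewrite ltNge nlt.
  exists (Num.min e ((lam n - lam i) / 2)); split.
  - by rewrite lt_min e0 divr_gt0// subr_gt0.
  - by rewrite ge_min ee.
  - have m1 : Num.min e ((lam n - lam i) / 2) <= e by rewrite ge_min lexx.
    have m2 : Num.min e ((lam n - lam i) / 2) <= (lam n - lam i) / 2 by rewrite ge_min lexx orbT.
    move=> j; rewrite ltnS leq_eqVlt => /orP[/eqP -> _|ji /(h j ji)]; lra.
(* If [lam_ m n] were near some x < lam n, then, by induction, the earlier indices with limit x
   would be near x as well; together with [n] they are one too many. Compactness makes this uniform
   in x. *)
have lower : \forall m \near \oo, lam n - eps < lam_ m n.
  have cpt : compact (`[L, lam n - eps]%classic : set R) by exact: segment_compact.
  have H := (compact_near_coveringP _).1 cpt nat \oo (fun m x => lam_ m n != x) _.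
  have nc : \forall m \near \oo, `[L, lam n - eps]%classic `<=` (fun x => lam_ m n != x).
    apply: H => x; rewrite /= in_itv /= => /andP[_ xn].
    have [d d0 hUx] := hU x; have [um mE] := hmult x.
    have ca := closeall _ d0.
    exists ([set y | `|y - x| < d], [set m | forall S : seq nat, uniq S ->
      (forall j, j \in S -> `|lam_ m j - x| < d) -> (size S <= size (mult x))%N] `&`
      [set m | forall j, (j < n)%N -> `|lam_ m j - lam j| < d]) => /=.
      split; last exact: filterI.
      by apply/nbhs_ballP; exists d => // y; rewrite /ball /= distrC.
    move=> [y m] /= [yx [hS hc]]; apply/eqP => lamy.
    pose s0 := [seq j <- iota 0 n | lam j == x].
    have s0E j : j \in s0 = (j < n)%N && (lam j == x).
      by rewrite mem_filter mem_iota /= add0n andbC.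
    have : (size (n :: s0) <= size (mult x))%N.
      apply: hS; first by rewrite /= s0E ltnn /= filter_uniq// iota_uniq.
      move=> j; rewrite inE => /orP[/eqP ->|]; first by rewrite lamy.
      by rewrite s0E => /andP[jn /eqP <-]; exact: hc.
    apply/negP; rewrite -ltnNge ltnS.
    apply: uniq_leq_size => // j /mE lamj; rewrite s0E lamj eqxx andbT.
    rewrite ltnNge; apply/negP => nj; have := mono _ _ nj; rewrite lamj; lra.
  near=> m.
  have h1 : L < lam_ m n by near: m; apply: filterS hL => m; exact.
  have h2 : `[L, lam n - eps]%classic `<=` (fun x => lam_ m n != x) by near: m.
  rewrite ltNge; apply/negP => h3.
  by have := h2 (lam_ m n); rewrite /= in_itv /= (ltW h1) h3 eqxx => /(_ isT).
(* If [lam_ m n] were too large, all indices with values near [lam n] would precede [n], and by the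
   gap they would have [lam j = lam n]; with [n] itself this exceeds the multiplicity by one. *)
have upper : \forall m \near \oo, lam_ m n < lam n + eps.
  have ca := closeall _ e0; have lo := hLo (lam n) _ e0; have [um mE] := hmult (lam n).
  near=> m.
  have hc : forall j, (j < n)%N -> `|lam_ m j - lam j| < e by near: m.
  have [S [uS sS hS]] : exists S : seq nat, [/\ uniq S,
     size S = size (mult (lam n)) & forall j, j \in S -> `|lam_ m j - lam n| < e] by near: m.
  rewrite ltNge; apply/negP => h3.
  have Sn j : j \in S -> (j < n)%N /\ j \in mult (lam n).
    move=> jS; have := hS _ jS; rewrite ltr_norml => /andP[j1 j2].
    have jn : (j < n)%N.
      by rewrite ltnNge; apply/negP => /(mono_ m); lra.
    split => //; apply/mE/eqP; rewrite eq_le mono ?(ltnW jn)//= leNgt; apply/negP => lt.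
    by have := gap _ jn lt; have := hc _ jn; rewrite ltr_norml => /andP[_ j3]; lra.
  have : (size (n :: S) <= size (mult (lam n)))%N.
    apply: uniq_leq_size => /=.
      by rewrite uS andbT; apply/negP => /Sn[]; rewrite ltnn.
    by move=> j; rewrite inE => /orP[/eqP ->|/Sn[]//]; exact/mE.
  by rewrite /= sS ltnn.
near=> m.
have h1 : lam n - eps < lam_ m n by near: m.
have h2 : lam_ m n < lam n + eps by near: m.
by rewrite ltr_norml; apply/andP; split; lra.
Unshelve. all: by end_near. Qed.

End Counting.

(** * From ranks of A + B F to convergence of the ordered eigenvalues *)

Section EigenvalueIndices.
Context {R : realType} (a b : R) (ab : a < b).

Lemma eigenvalue_indices (A B : 'M[R[i]]_2) (p q r s : R -> R) (lam : nat -> R) :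
  in_L1 a b (fun x => (p x)^-1) -> in_L1 a b q -> in_L1 a b r -> in_L1 a b s ->
  ae_on a b (fun x => 0 < p x) -> ae_on a b (fun x => 0 < r x) ->
  SL_eigenvalues a b p q r s A B lam -> forall l, exists S : seq nat,
  [/\ uniq S, size S = (2 - \rank (Tmx A B (fundamental a b (fun x => (p x)^-1) s q r) l))%N &
      forall j, j \in S <-> lam j = l].
Proof.
move=> hp1 hq hr hs hp hr0 [_ _ H] l.
have := SL_multiplicity_rank ab hp1 hq hr hs hp hr0 A B l.
move=> /H /card_I_seq[S [uS sS hS]]; exists S; split => // j.
split; first by move=> /hS /= [].
by move=> lj; apply/hS => /=; rewrite lj.
Qed.

Section Family.
Variables (A B : 'M[R[i]]_2) (D : nat -> @fund_data R) (L : @fund_data R).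
Variables (lam_ : nat -> nat -> R) (lam : nat -> R).
Hypotheses (sa : selfadjoint_bc A B)
  (lD : forall m, lagrange (D m)) (lL : lagrange L)
  (cD : forall m, fund_data_continuous (D m)) (gL : forall l, gram_pos L l)
  (cvD : forall l, fund_data_cvg D L l) (cvL : forall l, fund_data_cvg (fun=> L) L l)
  (bD : exists l0 : R, \forall m \near \oo, forall l, l <= l0 ->
     forall c1 c2 : R[i], Tmx A B (D m) l *m cv2 c1 c2 = 0 -> c1 = 0 /\ c2 = 0)
  (hlam_ : forall m l, exists S : seq nat, [/\ uniq S,
     size S = (2 - \rank (Tmx A B (D m) l))%N & forall j, j \in S <-> lam_ m j = l])
  (hlam : forall l, exists S : seq nat, [/\ uniq S,
     size S = (2 - \rank (Tmx A B L l))%N & forall j, j \in S <-> lam j = l])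
  (mono_ : forall m, {homo lam_ m : i j / (i <= j)%N >-> i <= j})
  (mono : {homo lam : i j / (i <= j)%N >-> i <= j}).

Lemma eigenvalue_cvg n : lam_ m n @[m --> \oo] --> lam n.
Proof.
have [d0 [p11 [p12 [p21 [p22 [hdet rk]]]]]] := bc_rank sa.
pose dz D' l := charfun d0 p11 p12 p21 p22 D' l.
pose sc D' l := scalarx p11 p12 p21 p22 D' l.
have dlam m j : dz (D m) (lam_ m j) = 0.
  apply/eqP/negPn/negP => nz; have [r2 _ _] := rk _ (lam_ m j) (lD m).
  have [S [_ sS hS]] := hlam_ m (lam_ m j).
  have : j \in S by apply/hS.
  by move: sS; rewrite r2//; case: S {hS}.
have sub m l (S : seq nat) : uniq S -> (forall j, j \in S -> lam_ m j = l) ->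
    (size S <= 2 - \rank (Tmx A B (D m) l))%N.
  move=> uS hS; have [S' [_ <- hS']] := hlam_ m l.
  by apply: uniq_leq_size => // j /hS /hS'.
pose mult l := projT1 (cid (hlam l)).
have multE l : [/\ uniq (mult l), size (mult l) = (2 - \rank (Tmx A B L l))%N &
   forall j, j \in mult l <-> lam j = l] by exact: (projT2 (cid (hlam l))).
apply: (@ordered_index_cvg _ _ _ mult) => //.
- by move=> l; have [h1 _ h2] := multE l.
- have [l0 hl0] := bD; exists l0; apply: filterS hl0 => m h j; rewrite ltNge; apply/negP => jl.
  have := dlam m j; have [_ r1 r0] := rk _ (lam_ m j) (lD m) => dj.
  have [v v0 vT] : exists2 v : 'rV[R[i]]_2, v != 0 & v *m (Tmx A B (D m) (lam_ m j))^T = 0.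
    apply/det0P; rewrite det_tr; apply: contraT => dn.
    have [r2 _] := rank_mx2_det (Tmx A B (D m) (lam_ m j)); have {}r2 := r2 dn.
    have [s1|s1] := pselect (sc (D m) (lam_ m j)).
      by have [] := r0 dj s1; rewrite r2.
    by have := r1 dj s1; rewrite r2.
  have Tc : Tmx A B (D m) (lam_ m j) *m cv2 (v 0 0) (v 0 1) = 0.
    have <- : v^T = cv2 (v 0 0) (v 0 1) by rewrite [LHS]cv2_eta !mxE.
    by rewrite -[LHS]trmxK trmx_mul trmxK vT trmx0.
  have [v1 v2] := h _ jl _ _ Tc.
  by have := row2_neq0 v0; rewrite v1 v2 eqxx.
- move=> mu; have [_ sM _] := multE mu; have [r2 r1 r0] := rk _ mu lL.
  rewrite sM; have [z|nz] := eqVneq (dz L mu) 0; last first.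
    rewrite (r2 nz); have [e e0 he] := charfun_neq0_near (cvD mu) nz.
    exists e => //; apply: filterS he => m hm [//|j S] _ hS.
    have lj : `|lam_ m j - mu| < e by apply: hS; rewrite inE eqxx.
    by have := hm _ lj; rewrite -/(dz _ _) dlam eqxx.
  have [s1|s1] := pselect (sc L mu).
    have [rk0 x0] := r0 z s1; rewrite rk0.
    have [e e0 he] := charfun_double_zero_le2 lD lL (gL mu) (cvD mu) z s1 x0.
    exists e => //; apply: filterS he => m [h3 h2] S uS hS.
    rewrite leqNgt; apply/negP; case: S uS hS => [|i [|j [|k S]]] // uS hS _.
    move: uS; rewrite /= !inE !negb_or => /andP[/and3P[ij ik _] /andP[/andP[jk _] _]].
    have ei : `|lam_ m i - mu| < e by apply: hS; rewrite !inE eqxx.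
    have ej : `|lam_ m j - mu| < e by apply: hS; rewrite !inE eqxx orbT.
    have ek : `|lam_ m k - mu| < e by apply: hS; rewrite !inE eqxx !orbT.
    (* Two equal values force rank 0, hence a scalar X. A third value cannot be equal, since the
       multiplicity is at most 2, nor different, since [h2] excludes further zeros nearby. *)
    have double (i' j' k' : nat) : i' != j' -> i' != k' -> j' != k' ->
        `|lam_ m i' - mu| < e -> `|lam_ m k' - mu| < e -> lam_ m i' = lam_ m j' -> False.
      move=> ij' ik' jk' ei' ek' E.
      have two := sub m (lam_ m i') [:: i'; j'].
      rewrite /= inE ij' in two.
      have {}two : (2 <= 2 - \rank (Tmx A B (D m) (lam_ m i')))%N.
        by apply: two => // t; rewrite !inE => /orP[]/eqP ->.
      have [_ q1 _] := rk _ (lam_ m i') (lD m).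
      have sci : sc (D m) (lam_ m i').
        by apply: contrapT => /(q1 (dlam m i')) rk1; move: two; rewrite rk1.
      have [E'|NE] := eqVneq (lam_ m i') (lam_ m k').
        have := sub m (lam_ m i') [:: i'; j'; k'].
        rewrite /= !inE negb_or ij' ik' jk' => /(_ isT) three.
        have : (3 <= 2 - \rank (Tmx A B (D m) (lam_ m i')))%N.
          by apply: three => t; rewrite !inE => /or3P[]/eqP ->.
        by move=> /leq_trans /(_ (leq_subr _ _)).
      have := h2 _ _ ei' ek' NE (dlam m i') sci.
      by rewrite -/(dz _ _) dlam eqxx.
    have [E1|N1] := eqVneq (lam_ m i) (lam_ m j); first exact: (double i j k).
    have [E2|N2] := eqVneq (lam_ m i) (lam_ m k).
      by apply: (double i k j) => //; rewrite eq_sym.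
    have [E3|N3] := eqVneq (lam_ m j) (lam_ m k).
      by apply: (double j k i) => //; rewrite eq_sym.
    exact: (h3 _ _ _ ei ej ek N1 N2 N3).
  rewrite (r1 z s1); have [e e0 he] := charfun_simple_zero_unique hdet lD lL (gL mu) (cvD mu) z s1.
  exists e => //; apply: filterS he => m [h1 h2] [//|i [//|j S]] uS hS.
  have ei : `|lam_ m i - mu| < e by apply: hS; rewrite !inE eqxx.
  have ej : `|lam_ m j - mu| < e by apply: hS; rewrite !inE eqxx orbT.
  have E := h1 _ _ ei ej (dlam m i) (dlam m j).
  have [_ q1 _] := rk _ (lam_ m i) (lD m).
  have := sub m (lam_ m i) [:: i; j]; rewrite (q1 (dlam m i) (h2 _ ei)).
  move: uS; rewrite /= !inE negb_or => /andP[/andP[-> _] _] /(_ isT) H.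
  by exfalso; suff : (2 <= 1)%N by []; apply: H => t; rewrite !inE => /orP[]/eqP ->.
move=> mu e e0; have [_ sM _] := multE mu; have [r2 r1 r0] := rk _ mu lL.
rewrite sM; have [z|nz] := eqVneq (dz L mu) 0; last first.
  by rewrite (r2 nz); apply: nearW => m; exists [::].
have [s1|s1] := pselect (sc L mu).
  have [rk0 x0] := r0 z s1; rewrite rk0.
  have := charfun_double_zero_near lD cD lL (gL mu) cvD (cvL mu) z s1 x0 e0.
  apply: filterS => m [[l le [dl sl]]|[l [l' [ll' le le' dl dl']]]].
    have [_ _ q0] := rk _ l (lD m); have [S [uS sS hS]] := hlam_ m l.
    exists S; split => //; first by rewrite sS (q0 dl sl).1.
    by move=> j /hS ->.
  have ex t : dz (D m) t = 0 -> exists j, lam_ m j = t.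
    move=> dt; have [_ q1 q0] := rk _ t (lD m); have [S [_ sS hS]] := hlam_ m t.
    have : (0 < size S)%N.
      rewrite sS; have [st|st] := pselect (sc (D m) t); first by rewrite (q0 dt st).1.
      by rewrite (q1 dt st).
    by case: S hS {sS} => // j S hS _; exists j; apply/hS; rewrite inE eqxx.
  have [j je] := ex _ dl; have [j' je'] := ex _ dl'.
  exists [:: j; j']; split => //=.
    by rewrite inE andbT; apply: contraNneq ll' => jj; rewrite -je -je' jj.
  by move=> t; rewrite !inE => /orP[]/eqP ->; rewrite ?je ?je'.
rewrite (r1 z s1).
have := charfun_simple_zero_near hdet cD lL (gL mu) cvD (cvL mu) z s1 e0.
apply: filterS => m [l le dl].
have [_ q1 q0] := rk _ l (lD m); have [S [_ sS hS]] := hlam_ m l.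
have : (0 < size S)%N.
  rewrite sS; have [st|st] := pselect (sc (D m) l); first by rewrite (q0 dl st).1.
  by rewrite (q1 dl st).
case: S hS {sS} => // j S hS _; exists [:: j]; split => // t.
by rewrite inE => /eqP ->; rewrite ((hS j).1 _)// inE eqxx.
Qed.

End Family.

(** Convergence in the extended reals makes the norm of the difference finite from some index on,
    and measurability then gives integrability. *)
Lemma in_L1_of_L1norm (g_ : nat -> R -> R) (g : R -> R) :
  (forall m, measurable_fun `]a, b[%classic (g_ m)) -> in_L1 a b g ->
  L1norm a b (fun x => g_ m x - g x) @[m --> \oo] --> 0%E ->
  \forall m \near \oo, in_L1 a b (g_ m).
Proof.
move=> mg hg /fine_cvgP[fin _]; apply: filterS fin => m fin.
have md : measurable_fun `]a, b[%classic (fun x => g_ m x - g x).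
  by apply: measurable_funB => //; exact: in_L1_measurable hg.
have : in_L1 a b (fun x => g_ m x - g x).
  apply/integrableP; split.
    by apply/measurable_EFinP; exact: md.
  rewrite (_ : (\int[_]_(x in _) _)%E = L1norm a b (fun x => g_ m x - g x))//.
  by rewrite ltey_eq fin.
move=> h; have := in_L1D h hg; congr in_L1.
by apply/funext => x; rewrite subrK.
Qed.

End EigenvalueIndices.

Theorem lemma2p19 (R : realType) (a b : R) (p q r s : R -> R)
    (p_ s_ : nat -> R -> R) (A B : 'M[R[i]]_2)
    (lam_ : nat -> nat -> R) (lam : nat -> R)
    (hab : a < b)
    (hp1 : in_L1 a b (fun x => (p x)^-1))
    (hq1 : in_L1 a b q) (hr1 : in_L1 a b r) (hs1 : in_L1 a b s)
    (hp : ae_on a b (fun x => 0 < p x))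
    (hr : ae_on a b (fun x => 0 < r x))
    (hpm : forall m, smooth_on_closed a b (p_ m))
    (hpm0 : forall m x, a <= x <= b -> 0 < p_ m x)
    (hsm : forall m, smooth_compact_support a b (s_ m))
    (hplim : L1norm a b (fun x => (p_ m x)^-1 - (p x)^-1) @[m --> \oo] --> 0%E)
    (hslim : L1norm a b (fun x => s_ m x - s x) @[m --> \oo] --> 0%E)
    (hAB : selfadjoint_bc A B)
    (hlam_ : forall m, SL_eigenvalues a b (p_ m) q r (s_ m) A B (lam_ m))
    (hlam : SL_eigenvalues a b p q r s A B lam)
    (n : nat) :
  lam_ m n @[m --> \oo] --> lam n.
Proof.
have Jab x : `]a, b[%classic x -> a <= x <= b.
  by rewrite /= in_itv /= => /andP[h1 h2]; rewrite !ltW.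
have mw m : measurable_fun `]a, b[%classic (fun x => (p_ m x)^-1).
  apply: open_continuous_measurable_fun; first exact: itv_open.
  move=> x; rewrite inE => xab; have [_ cp _ _] := hpm m.
  apply: cvgV; first by rewrite gt_eqF// hpm0// Jab.
  exact: within_continuous_continuous hab cp xab.
have ms m : measurable_fun `]a, b[%classic (s_ m).
  apply: open_continuous_measurable_fun; first exact: itv_open.
  move=> x; rewrite inE => xab; have [sm _] := hsm m.
  by apply: differentiable_continuous; apply/derivable1_diffP; exact: (sm 0%N x xab).
have [N1 _ hN1] := in_L1_of_L1norm mw hp1 hplim.
have [N2 _ hN2] := in_L1_of_L1norm ms hs1 hslim.
(* From this index on both coefficient sequences are integrable; shifting by [N] provides the
   hypotheses for every index and does not affect the limit. *)
pose N := (N1 + N2)%N.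
have iw m : in_L1 a b (fun x => (p_ (m + N)%N x)^-1).
  by apply: hN1; rewrite /= /N addnCA leq_addr.
have iS m : in_L1 a b (s_ (m + N)%N).
  by apply: hN2; rewrite /= /N !addnA leq_addl.
have w0 m : ae_on a b (fun x => 0 < (p_ (m + N)%N x)^-1).
  by apply: ae_onW => x /Jab xab; rewrite invr_gt0 hpm0.
have p0 m : ae_on a b (fun x => 0 < p_ (m + N)%N x).
  by apply: ae_onW => x /Jab xab; rewrite hpm0.
have dcv : primitive a b (coef_norm (fun x => (p_ (m + N)%N x)^-1 - (p x)^-1)
    (fun x => s_ (m + N)%N x - s x) (fun=> 0)) b @[m --> \oo] --> 0.
  have h1 : fine (L1norm a b (fun x => (p_ (m + N)%N x)^-1 - (p x)^-1)) @[m --> \oo] --> 0.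
    by move/fine_cvgP : hplim => [_ h]; rewrite -(cvg_shiftn N) in h.
  have h2 : fine (L1norm a b (fun x => s_ (m + N)%N x - s x)) @[m --> \oo] --> 0.
    by move/fine_cvgP : hslim => [_ h]; rewrite -(cvg_shiftn N) in h.
  rewrite -[X in _ --> X]addr0.
  rewrite [X in X @ _](_ : _ = fun m => fine (L1norm a b (fun x => (p_ (m + N)%N x)^-1 - (p x)^-1)) +
    fine (L1norm a b (fun x => s_ (m + N)%N x - s x))); first exact: cvgD.
  apply/funext => m; rewrite primitive_b.
  have i1 := in_L1_norm (in_L1B (iw m) hp1); have i2 := in_L1_norm (in_L1B (iS m) hs1).
  transitivity (\int[lebesgue_measure]_(x in `]a, b[)
      (`|(p_ (m + N)%N x)^-1 - (p x)^-1| + `|s_ (m + N)%N x - s x|)).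
    by apply: eq_Rintegral => x _; rewrite /coef_norm normr0 addr0.
  by rewrite (RintegralD (mJ a b) i1 i2).
have hr0 := hr; have wp := w_gt0 hp.
suff : lam_ (m + N)%N n @[m --> \oo] --> lam n by rewrite (cvg_shiftn N (fun m => lam_ m n)).
apply: (@eigenvalue_cvg _ A B (fun m => fundamental a b (fun x => (p_ (m + N)%N x)^-1) (s_ (m + N)%N) q r)
  (fundamental a b (fun x => (p x)^-1) s q r) (fun m => lam_ (m + N)%N)) => //.
- by move=> m; exact: fundamental_lagrange.
- exact: fundamental_lagrange.
- by move=> m; exact: fundamental_continuous.
- by move=> l; exact: fundamental_gram_pos.
- by move=> l; exact: (fundamental_cvg hab l iw iS).
- by move=> l; exact: fundamental_cvg_cst.
- exact: (kernel_bounded_below hab hAB iw iS w0 hp1 hs1 hq1 hr1 hr dcv).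
- move=> m l; exact: (eigenvalue_indices hab (iw m) hq1 hr1 (iS m) (p0 m) hr (hlam_ _)).
- move=> l; exact: (eigenvalue_indices hab hp1 hq1 hr1 hs1 hp hr hlam).
- by move=> m; have [] := hlam_ (m + N)%N.
- by have [] := hlam.
Qed.
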